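(* For every $n\in\mathbb N$ there exist positive constants $\sigma_2, C_{11}, C_{14}$ depending only on $n$, and positive constants $C_{13}(n,k)$, $k\in\mathbb N$, such that the following holds. Let $E$ be a separable Hilbert space, $X\subset E$, $0<\varepsilon<r/10$ and $0<\delta<\sigma_2r$. Suppose that for every $x\in X$ there exists an $n$-dimensional affine subspace $A_x\subset E$ such that the set $X\cap B_r(x)$ is within Hausdorff distance $\delta$ from an $\varepsilon$-net of the affine $n$-ball $A_x\cap B_r(x)$. Then there exist a closed $n$-dimensional smooth submanifold $M\subset E$ and an $\varepsilon$-net $Y$ of $M$ such that $d_H(X,Y)\le C_{14}\delta$ and: (i) the second fundamental form of $M$ at every point is bounded by $C_{11}\delta r^{-2}$; (ii) $\operatorname{Reach}(M)\ge r/3$; (iii) the normal projection $P_M:\mathcal U_{r/3}(M)\to M$ is smooth and satisfies, for all $x\in\mathcal U_{r/3}(M)$, $\|d_x^kP_M\|<C_{13}(n,k)\,\delta r^{-k}$ for all $k\ge2$, and $\|d_xP_M-P_{\vec T_yM}\|<C_{13}(n,1)\,\delta r^{-1}$, where $y=P_M(x)$ and $P_{\vec T_yM}$ is the orthogonal projector onto $\vec T_yM$.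
   Context: $B_r(x)$ is the ball of radius $r$ in $E$; $d_H$ is the Hausdorff distance in $E$; $\mathcal U_r(A)$ is the set of points of $E$ within distance $r$ of $A$ (at distance less than $r$). A subset $S$ of a metric space $Z$ is an $\varepsilon$-net if every point of $Z$ lies within distance $\varepsilon$ of $S$. A closed submanifold of $E$ is a finite-dimensional smooth submanifold that is a closed subset of $E$. $\operatorname{Reach}(M)$ is the supremum of all $r>0$ such that every $x\in\mathcal U_r(M)$ has a unique nearest point $P_M(x)$ in $M$; $P_M$ is called the normal projection. $\vec T_yM$ is the linear subspace of $E$ parallel to the tangent space of $M$ at $y$. $d_x$, $d_x^k$ denote first and $k$-th differentials, with norms induced by the norm of $E$. *)

(* Defs.v *)
From mathcomp Require Import all_boot all_order all_algebra.
From mathcomp Require Import all_classical all_reals all_analysis.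

Set Implicit Arguments.
Unset Strict Implicit.
Unset Printing Implicit Defensive.

Import Order.TTheory GRing.Theory Num.Theory.
Import numFieldNormedType.Exports.

Local Open Scope classical_set_scope.
Local Open Scope ring_scope.

Section Metric.
Context {R : realType} {E : normedModType R}.
Implicit Types (A B S M : set E) (x y : E) (r e : R).

Definition nbhd_of r A : set E := [set x | (edist_inf A x < r%:E)%E].

Definition hausdorff_dist A B : \bar R :=
  ereal_inf [set r%:E | r in
    [set r | 0 < r /\ A `<=` nbhd_of r B /\ B `<=` nbhd_of r A]].

Definition eps_net e S A : Prop :=
  S `<=` A /\ forall x, A x -> (edist_inf S x <= e%:E)%E.

Definition separable : Prop := exists2 D : set E, countable D & dense D.

Definition is_nearest M x y : Prop :=
  M y /\ forall z, M z -> `|x - y| <= `|x - z|.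

Definition reach M : \bar R :=
  ereal_sup [set r%:E | r in
    [set r | 0 < r /\
      forall x, nbhd_of r M x -> exists! y, is_nearest M x y]].

(* Only meaningful at the points that have a unique nearest point in M. *)
Definition normal_proj M x : E := xget 0 (is_nearest M x).

Definition linear_subspace (n : nat) (V : set E) : Prop :=
  exists2 e : 'I_n -> E,
    (forall t : 'I_n -> R, \sum_i t i *: e i = 0 -> forall i, t i = 0) &
    V = [set \sum_i t i *: e i | t in [set: 'I_n -> R]].

Definition affine_subspace (n : nat) A : Prop :=
  exists p V, linear_subspace n V /\ A = [set p + v | v in V].

End Metric.

Arguments separable {R} E.

Section Differentials.
Context {R : realType} {V W : normedModType R}.
Implicit Types (f : V -> W) (U : set V).

(* iter_diff f [:: v1; ...; vk] x is d^k_x f (v1, ..., vk): the k-th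
   differential is the differential at x of y |-> d^(k-1)_y f, applied to v1
   and then to v2, ..., vk. *)
Fixpoint iter_diff f (vs : seq V) : V -> W :=
  if vs is v :: vs' then fun x => 'd (iter_diff f vs') x v else f.

Definition opnorm (T : V -> W) : \bar R :=
  ereal_sup [set `|T v|%:E | v in [set v | `|v| <= 1]].

(* Operator norm of a k-linear map, given as a function of its list of
   arguments. *)
Definition multi_norm (k : nat) (T : seq V -> W) : \bar R :=
  ereal_sup [set `|T vs|%:E | vs in
    [set vs | size vs = k /\ forall v, v \in vs -> `|v| <= 1]].

Definition diff_norm f (k : nat) (x : V) : \bar R :=
  multi_norm k (fun vs => iter_diff f vs x).

(* C^infinity in the sense of Frechet: at every point of the open set U and for
   every k, d^k f is a bounded k-linear map, and y |-> d^k_y f is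
   Frechet-differentiable for the operator norm, with differential
   h |-> d^(k+1)_x f (h, ...). *)
Definition smooth_on U f : Prop :=
  open U /\ forall (k : nat) (x : V), U x ->
    (diff_norm f k x < +oo)%E /\
    forall e : R, 0 < e -> \forall h \near (0 : V),
      (multi_norm k (fun vs => (iter_diff f vs (x + h)
                               - iter_diff f vs x - iter_diff f (h :: vs) x)%R)
        <= (e * `|h|)%:E)%E.

End Differentials.

Section Submanifolds.
Context {R : realType} {E : normedModType R} (n : nat).
Implicit Types (M O : set E) (V : set 'rV[R]_n) (phi : 'rV[R]_n -> E).

(* phi is a smooth immersion of V and a homeomorphism onto M `&` O. *)
Definition local_param M V O phi : Prop :=
  [/\ smooth_on V phi, open O, phi @` V = M `&` O,
      forall a, V a -> injective ('d phi a) &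
      exists2 psi : E -> 'rV[R]_n,
        forall a, V a -> psi (phi a) = a & {within M `&` O, continuous psi}].

Definition smooth_submanifold M : Prop :=
  forall y, M y -> exists V O phi, local_param M V O phi /\ O y.

Definition closed_submanifold M : Prop := closed M /\ smooth_submanifold M.

Definition tangent_space M (y : E) : set E :=
  [set u | exists V O phi a,
    [/\ local_param M V O phi, V a, phi a = y & exists h, 'd phi a h = u]].

End Submanifolds.

Section Hilbert.
Context {R : realType} {E : normedModType R} (dotp : {dot E for idfun}).

Definition orth_projector (T : set E) (v : E) : E :=
  xget 0 [set w | T w /\ forall t, T t -> dotp (v - w) t = 0].

(* II_y(u, v) is the component normal to M of D_X Y at y, for tangent fields X,
   Y extending u, v. Taking as X and Y the constant-coefficient fields
   d phi (h), d phi (k) of a local parametrization phi gives the normal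
   component of d^2 phi (h, k), which does not depend on phi. *)
Definition second_fundamental_form (n : nat) (M : set E) (y u v : E) : E :=
  xget 0 [set w | exists V O (phi : 'rV[R]_n -> E) a h k,
    [/\ local_param M V O phi, V a, phi a = y,
        'd phi a h = u /\ 'd phi a k = v &
        let d2 := iter_diff phi [:: h; k] a in
        w = d2 - orth_projector (tangent_space n M y) d2]].

Definition second_fundamental_form_le (n : nat) (M : set E) (C : R) : Prop :=
  forall y u v, M y -> tangent_space n M y u -> tangent_space n M y v ->
    `|second_fundamental_form n M y u v| <= C * `|u| * `|v|.

End Hilbert.

(* Main.v *)
(* After rescaling to r = 1, the planes A_x are glued as follows. Choose maximal separated families
   of points of X; finitely many families, their number depending only on n, cover X. For each
   family in turn, push the space towards the plane A_i near every point i of the family by a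
   cutoff of the displacement P_i z - z. Neighbouring planes being O(delta)-close, the composite of
   these maps is z + delta u_x(z) on A_x near x, with bounds on all derivatives of u_x that depend
   only on n. M is the union of the images of the discs of A_x around x; near x it is the graph over
   A_x of a map of size O(delta).

   The map sending a graph point gamma(b) and a vector nu normal to A_x to
   gamma(b) + nu - delta (height' b)^* nu parametrizes the normal directions of the graph and is
   delta-close to the identity. Its inverse yields P_M = P_x + delta s_x with s_x bounded in every
   C^k, whence (iii). The uniqueness of nearest points within 1/3 follows from Taylor's formula
   close to the foot point and from the flatness of M further away. The differential of P_M at a
   point of M is the orthogonal projector onto the tangent space, and the second fundamental form is
   the second differential of P_M on tangent vectors, whence (i).

   Y consists of the points of M that are O(delta)-close to X. *)
Require Import Defs.
From HB Require Import structures.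
From mathcomp Require Import all_boot all_order all_algebra.
From mathcomp Require Import all_classical all_reals all_analysis.
From mathcomp Require Import interval_inference ring lra.

Set Implicit Arguments.
Unset Strict Implicit.
Unset Printing Implicit Defensive.

Import Order.TTheory GRing.Theory Num.Theory.
Import numFieldNormedType.Exports.

Local Open Scope classical_set_scope.
Local Open Scope ring_scope.

(** * Linear identities between vectors *)

(** The ambient space may have infinite dimension, while every constant may depend only on [n] and
    the order [k]. Bounds are therefore explicit functions of earlier bounds or chosen before the
    space [E], and counting arguments are made after projection to an [n]-plane. One number bounds
    all derivatives up to order [k], each derivative being a map into a normed space of operators,
    so product, chain and inverse rules are proved once by induction. The threshold on
    [d = delta / r] involves bounds of order at most two only, hence serves all [k]. The delicate
    point of the gluing is that discs over two nearby points of [X] have matching images. At the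
    stage of a centre close to both, either disc is projected completely onto the plane of that
    centre, and later stages see the same points; matching points are found by a contraction. The
    hypothesis [eps < r / 10] enters because a disc point then has a centre within 13/100 of it,
    where the cutoff equals 1. The radii 11, 13, 15, 17, 19 and 36 hundredths leave gaps larger than
    the O(d) displacements. *)

Section VectorReflection.
Context {R : comNzRingType} {V : lmodType R}.

Inductive vexpr :=
  | VZero | VVar of nat | VAdd of vexpr & vexpr | VOpp of vexpr
  | VScale of R & vexpr.

Fixpoint veval (vs : seq V) e : V :=
  match e with
  | VZero => 0
  | VVar n => nth 0 vs n
  | VAdd e f => veval vs e + veval vs f
  | VOpp e => - veval vs e
  | VScale a e => a *: veval vs e
  end.

Fixpoint vcoef e (n : nat) : R :=
  match e with
  | VZero => 0
  | VVar m => if m == n then 1 else 0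
  | VAdd e f => vcoef e n + vcoef f n
  | VOpp e => - vcoef e n
  | VScale a e => a * vcoef e n
  end.

Lemma veval_coef vs e : veval vs e = \sum_(i < size vs) vcoef e i *: vs`_i.
Proof.
elim: e => [|m|e IHe f IHf|e IH|a e IH] /=.
- by rewrite big1// => i _; rewrite scale0r.
- have [ms|ms] := ltnP m (size vs).
    rewrite (bigD1 (Ordinal ms))//= eqxx scale1r big1 ?addr0// => i im.
    case: eqP => [mi|]; last by rewrite scale0r.
    by case/eqP: im; apply: val_inj.
  rewrite nth_default// big1// => i _; case: eqP => [mi|]; last by rewrite scale0r.
  by move: (ltn_ord i); rewrite -mi ltnNge ms.
- by rewrite IHe IHf -big_split /=; apply: eq_bigr => i _; rewrite scalerDl.
- by rewrite IH -sumrN; apply: eq_bigr => i _; rewrite scaleNr.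
- by rewrite IH scaler_sumr; apply: eq_bigr => i _; rewrite scalerA.
Qed.

(** An explicit conjunction rather than a quantifier, so that [cbn] turns the hypothesis of
    [vexpr_eq] into finitely many scalar equations. *)
Fixpoint vall (n : nat) (P : nat -> Prop) : Prop :=
  if n is n'.+1 then P n' /\ vall n' P else True.

Lemma vexpr_eq vs e f : vall (size vs) (fun i => vcoef e i = vcoef f i) ->
  veval vs e = veval vs f.
Proof.
move=> h; rewrite !veval_coef; apply: eq_bigr => i _; congr (_ *: _).
elim: (size vs) i h => [[]//|n IH i /= [hn hr]].
have [->//|ni] := eqVneq (i : nat) n.
have ilt : (i < n)%N by move: (ltn_ord i); rewrite ltnS leq_eqVlt (negbTE ni).
exact: (IH (Ordinal ilt) hr).
Qed.

End VectorReflection.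

Ltac v_mem x vs :=
  lazymatch vs with
  | nil => false
  | cons ?y ?t => match x with y => true | _ => v_mem x t end
  end.
Ltac v_vars t vs :=
  lazymatch t with
  | @GRing.add _ ?a ?b => let vs1 := v_vars a vs in v_vars b vs1
  | @GRing.opp _ ?a => v_vars a vs
  | @GRing.scale _ _ _ ?a => v_vars a vs
  | @GRing.zero _ => vs
  | _ => lazymatch v_mem t vs with true => vs | false => constr:(cons t vs) end
  end.
Ltac v_idx x vs :=
  lazymatch vs with
  | cons ?y ?t => match x with y => constr:(O) | _ => let n := v_idx x t in constr:(S n) end
  end.
Ltac v_reify R t vs :=
  lazymatch t with
  | @GRing.add _ ?a ?b =>
      let ea := v_reify R a vs in let eb := v_reify R b vs in constr:(@VAdd R ea eb)
  | @GRing.opp _ ?a => let ea := v_reify R a vs in constr:(@VOpp R ea)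
  | @GRing.scale _ _ ?c ?a => let ea := v_reify R a vs in constr:(@VScale R c ea)
  | @GRing.zero _ => constr:(@VZero R)
  | _ => let n := v_idx t vs in constr:(@VVar R n)
  end.
(* Equalities between linear combinations of vectors, by comparing coefficients. *)
Ltac vlin R V :=
  lazymatch goal with
  | |- ?a = ?b =>
      let vs := v_vars a (@nil V) in
      let vs := v_vars b vs in
      let ea := v_reify R a vs in
      let eb := v_reify R b vs in
      apply: (@vexpr_eq R V vs ea eb); cbn [vall size vcoef eqn];
      rewrite ?eqxx /=; repeat (split; [|])
  end.
Ltac vring R V := vlin R V; try exact I; try ring.

(** * Bounded linear maps and derivatives with uniform bounds *)

Section BoundedOperators.
Context {R : realType} (V W : normedModType R).

Definition bounded_linear (f : V -> W) : Prop :=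
  linear f /\ exists C, forall v, `|f v| <= C * `|v|.

Definition blin_pred : {pred V -> W} := fun f => `[< bounded_linear f >].

Lemma blin_submod : submod_closed blin_pred.
Proof.
split.
  apply/asboolP; split; first by move=> a u v; rewrite scaler0 addr0.
  by exists 0 => v; rewrite normr0 mul0r.
move=> a f g /asboolP [lf [C hf]] /asboolP [lg [D hg]]; apply/asboolP; split.
  move=> b u v; rewrite [LHS]/GRing.add /= ?fctE lf lg !scalerDr.
  by rewrite !scalerA [a * b]mulrC addrACA.
exists (`|a| * C + D) => v; apply: (le_trans (ler_normD _ _)).
by rewrite mulrDl lerD// normrZ -mulrA ler_wpM2l.
Qed.

HB.instance Definition _ :=
  GRing.isSubmodClosed.Build R (V -> W) blin_pred blin_submod.

(** Bundled operators form a normed module, so the derivative of a map is again a map between normed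
    modules and can be differentiated in turn. *)
Record blin := Blin { blin_fun :> V -> W; blin_funP : blin_fun \in blin_pred }.

HB.instance Definition _ := [isSub for blin_fun].
HB.instance Definition _ := [Choice of blin by <:].
HB.instance Definition _ := [SubChoice_isSubLmodule of blin by <:].

Lemma blin_linear (A : blin) : linear A.
Proof. by case: A => f /= /asboolP[]. Qed.

HB.instance Definition _ (A : blin) :=
  GRing.isLinear.Build R V W *:%R A (blin_linear A).

Lemma blinD (A : blin) u v : A (u + v) = A u + A v. Proof. exact: linearD. Qed.
Lemma blinB (A : blin) u v : A (u - v) = A u - A v. Proof. exact: linearB. Qed.
Lemma blinZ (A : blin) a u : A (a *: u) = a *: A u. Proof. exact: linearZ. Qed.
Lemma blin0 (A : blin) : A 0 = 0. Proof. exact: linear0. Qed.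

Lemma blinP (A B : blin) : (forall v, A v = B v) -> A = B.
Proof. by move=> h; apply: val_inj; apply/funext. Qed.

Lemma blin_add (A B : blin) v : (A + B) v = A v + B v. Proof. by []. Qed.
Lemma blin_opp (A : blin) v : (- A) v = - A v. Proof. by []. Qed.
Lemma blin_scale a (A : blin) v : (a *: A) v = a *: A v. Proof. by []. Qed.
Lemma blin_zero v : (0 : blin) v = 0. Proof. by []. Qed.

Definition blin_norm (A : blin) : R :=
  sup [set `|A v| | v in [set v | `|v| <= 1]].

Lemma blin_has_sup (A : blin) :
  has_sup [set `|A v| | v in [set v | `|v| <= 1]].
Proof.
split; first by exists `|A 0|; exists 0 => //=; rewrite normr0.
case/asboolP: (blin_funP A) => _ [C hC]; exists `|C| => _ [v /= hv <-].
apply: (le_trans (hC v)); rewrite (le_trans (ler_norm _))// normrM normr_id.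
by rewrite ler_piMr.
Qed.

Lemma blin_norm_ge (A : blin) v : `|A v| <= blin_norm A * `|v|.
Proof.
have [->|v0] := eqVneq v 0; first by rewrite linear0 !normr0 mulr0.
have nv : 0 < `|v| by rewrite normr_gt0.
have : `|A (`|v|^-1 *: v)| <= blin_norm A.
  apply: (sup_upper_bound (blin_has_sup A)); exists (`|v|^-1 *: v) => //=.
  by rewrite normrZ normfV normr_id mulVf// gt_eqF.
by rewrite linearZ /= normrZ normfV normr_id mulrC ler_pdivrMr.
Qed.

Lemma blin_norm_le (A : blin) C :
  0 <= C -> (forall v, `|A v| <= C * `|v|) -> blin_norm A <= C.
Proof.
move=> C0 h; apply: ge_sup; first exact: (blin_has_sup A).1.
by move=> _ [v /= hv <-]; apply: (le_trans (h v)); rewrite ler_piMr.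
Qed.

Lemma blin_norm_ge0 (A : blin) : 0 <= blin_norm A.
Proof.
apply: (sup_upper_bound (blin_has_sup A)).
by exists 0 => /=; rewrite ?normr0// linear0 normr0.
Qed.

Lemma blin_normD A B : blin_norm (A + B) <= blin_norm A + blin_norm B.
Proof.
apply: blin_norm_le; first by rewrite addr_ge0 // blin_norm_ge0.
move=> v; rewrite blin_add mulrDl (le_trans (ler_normD _ _))// lerD//.
  exact: blin_norm_ge.
exact: blin_norm_ge.
Qed.

Lemma blin_normZ (a : R) A : blin_norm (a *: A) = `|a| * blin_norm A.
Proof.
have le b B : blin_norm (b *: B) <= `|b| * blin_norm B.
  apply: blin_norm_le => [|v]; first by rewrite mulr_ge0// blin_norm_ge0.
  by rewrite blin_scale normrZ -mulrA ler_wpM2l// blin_norm_ge.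
apply/eqP; rewrite eq_le le/=.
have [->|a0] := eqVneq a 0; first by rewrite normr0 mul0r blin_norm_ge0.
rewrite -ler_pdivlMl ?normr_gt0// -normfV.
by have := le a^-1 (a *: A); rewrite scalerA mulVf// scale1r.
Qed.

Lemma blin_norm0 A : blin_norm A = 0 -> A = 0.
Proof.
move=> h; apply: blinP => v; apply/eqP; rewrite -normr_le0.
by have := blin_norm_ge A v; rewrite h mul0r.
Qed.

HB.instance Definition _ :=
  Lmodule_isNormed.Build R blin blin_normD blin_normZ blin_norm0.

Lemma blin_ub (A : blin) v : `|A v| <= `|A| * `|v|.
Proof. exact: blin_norm_ge. Qed.

Lemma blin_lub (A : blin) C :
  0 <= C -> (forall v, `|A v| <= C * `|v|) -> `|A| <= C.
Proof. exact: blin_norm_le. Qed.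

(** The value is 0 when [f] is not bounded linear; computing with it goes through [mkblinE] and a
    proof of boundedness. *)
Definition mkblin (f : V -> W) : blin := insubd (0 : blin) f.

Lemma mkblinE f : bounded_linear f -> mkblin f =1 f.
Proof.
move=> h v; rewrite /mkblin /insubd insubT//=; first exact/asboolP.
Qed.

End BoundedOperators.

Lemma ler_small {R : realType} (x c : R) :
  (forall e, 0 < e -> x <= e * c) -> x <= 0.
Proof.
move=> h; rewrite leNgt; apply/negP => x0.
have c0 : 0 < c by have := h 1 ltr01; rewrite mul1r; apply: lt_le_trans.
have := h (x / (2 * c)); rewrite divr_gt0 ?mulr_gt0// => /(_ isT).
rewrite invfM mulrA mulfVK ?gt_eqF//; lra.
Qed.

Section Frechet.
Context {R : realType}.
Implicit Types (V W Z : normedModType R).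

Definition hasd V W (f : V -> W) x (A : blin V W) : Prop :=
  forall e, 0 < e -> \forall h \near (0 : V), `|f (x + h) - f x - A h| <= e * `|h|.

(** By homogeneity, smallness near 0 spreads to all vectors: [v] is rescaled to length [d / 2],
    inside the ball where the estimate holds. *)
Lemma blin_small V W (A : blin V W) :
  (forall e, 0 < e -> \forall h \near (0 : V), `|A h| <= e * `|h|) -> A = 0.
Proof.
move=> h; apply: blinP => v; apply/eqP; rewrite -normr_le0.
apply: (@ler_small _ _ `|v|) => e e0; have [->|v0] := eqVneq v 0.
  by rewrite linear0 !normr0 mulr0.
have nv : 0 < `|v| by rewrite normr_gt0.
have /nbhs_norm0P[d d0 hd] := h e e0.
have [t [t0 tv]] : exists t, 0 < t /\ t * `|v| = d / 2.
  by exists (d / 2 / `|v|); rewrite !divr_gt0// divfK ?gt_eqF.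
have /= := hd (t *: v).
rewrite linearZ /= !normrZ (gtr0_norm t0) tv => /(_ _).
rewrite ltr_pdivrMr// ltr_pMr// ltr1n => /(_ isT).
by rewrite -tv mulrCA ler_pM2l.
Qed.

Lemma hasd_uniq V W (f : V -> W) x A B : hasd f x A -> hasd f x B -> A = B.
Proof.
move=> hA hB; apply/eqP; rewrite -subr_eq0; apply/eqP; apply: blin_small => e e0.
have e2 : 0 < e / 2 by rewrite divr_gt0.
near=> h; rewrite blin_add blin_opp.
have -> : A h - B h = (f (x + h) - f x - B h) - (f (x + h) - f x - A h).
  by vring R W.
rewrite (splitr e) mulrDl (le_trans (ler_normB _ _))// lerD//.
- by near: h; exact: hB.
- by near: h; exact: hA.
Unshelve. all: by end_near. Qed.

(** A total function: 0 where no derivative exists, and determined by [hasd_uniq] where one does. *)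
Definition D V W (f : V -> W) x : blin V W := xget 0 [set A | hasd f x A].

Lemma hasdD V W (f : V -> W) x A : hasd f x A -> D f x = A.
Proof. by move=> h; apply: (hasd_uniq _ h); apply: (@xgetPex _ 0 [set A | hasd f x A]); exists A. Qed.

Lemma hasd_near V W (f g : V -> W) x A :
  f x = g x -> (\forall h \near (0 : V), f (x + h) = g (x + h)) ->
  hasd f x A -> hasd g x A.
Proof.
move=> fg0 fg hf e e0; near=> h.
rewrite -fg0; have <- : f (x + h) = g (x + h) by near: h.
by near: h; exact: hf.
Unshelve. all: by end_near. Qed.

Lemma open_shift V (U : set V) x : open U -> U x -> \forall h \near (0 : V), U (x + h).
Proof. by move=> oU Ux; apply/(@nbhs0P _ _ U); apply: open_nbhs_nbhs; split. Qed.

Lemma hasd_lip V W (f : V -> W) x A : hasd f x A ->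
  \forall h \near (0 : V), `|f (x + h) - f x| <= (`|A| + 1) * `|h|.
Proof.
move=> hA; near=> h; have -> : f (x + h) - f x = A h + (f (x + h) - f x - A h) by vring R W.
rewrite mulrDl (le_trans (ler_normD _ _))// lerD ?blin_ub//.
by near: h; exact: hA.
Unshelve. all: by end_near. Qed.

Lemma hasd_cont V W (f : V -> W) x A : hasd f x A ->
  (fun h => f (x + h) - f x) @ (0 : V) --> (0 : W).
Proof.
move=> /hasd_lip hl; apply/cvgr0Pnorm_le => e e0.
have c0 : 0 < `|A| + 1 by rewrite ltr_wpDl.
near=> h.
apply: (@le_trans _ _ ((`|A| + 1) * `|h|)); first by near: h.
rewrite -ler_pdivlMl//; near: h.
by apply: nbhs0_le; rewrite mulr_gt0// invr_gt0.
Unshelve. all: by end_near. Qed.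

Lemma hasd_continuous V W (f : V -> W) x A : hasd f x A -> {for x, continuous f}.
Proof.
move=> /hasd_cont /cvgr0Pnorm_le h; apply/cvgrPdist_le => e e0.
apply/nbhs0P; near=> k; rewrite distrC; near: k; exact: h.
Unshelve. all: by end_near. Qed.

Lemma hasd_cst V W (c : W) (x : V) : hasd (fun _ => c) x 0.
Proof.
by move=> e e0; near=> h; rewrite subrr sub0r blin_zero oppr0 normr0 mulr_ge0// ltW.
Unshelve. all: by end_near. Qed.

Lemma hasd_lin V W (A : blin V W) x : hasd A x A.
Proof.
move=> e e0; near=> h; rewrite linearD [A x + _]addrC addrK subrr normr0.
by rewrite mulr_ge0// ltW.
Unshelve. all: by end_near. Qed.

Lemma hasd_add V W (f g : V -> W) x A B : hasd f x A -> hasd g x B ->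
  hasd (fun y => f y + g y) x (A + B).
Proof.
move=> hA hB e e0; have e2 : 0 < e / 2 by rewrite divr_gt0.
near=> h; rewrite blin_add.
have -> : f (x + h) + g (x + h) - (f x + g x) - (A h + B h) =
  (f (x + h) - f x - A h) + (g (x + h) - g x - B h).
  by vring R W.
rewrite (splitr e) mulrDl (le_trans (ler_normD _ _))// lerD//.
- by near: h; exact: hA.
- by near: h; exact: hB.
Unshelve. all: by end_near. Qed.

Lemma bounded_linear_comp V W Z (A : blin W Z) (B : blin V W) : bounded_linear (A \o B).
Proof.
split=> [a u v|]; first by rewrite /= !linearP.
by exists (`|A| * `|B|) => v; rewrite /= (le_trans (blin_ub _ _))// -mulrA ler_wpM2l// blin_ub.
Qed.

Definition bcomp V W Z (A : blin W Z) (B : blin V W) : blin V Z := mkblin (A \o B).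

Lemma bcompE V W Z (A : blin W Z) (B : blin V W) v : bcomp A B v = A (B v).
Proof. exact: mkblinE (bounded_linear_comp A B) v. Qed.

Lemma hasd_comp V W Z (f : W -> Z) (g : V -> W) x A B :
  hasd f (g x) A -> hasd g x B -> hasd (f \o g) x (bcomp A B).
Proof.
move=> hA hB e e0.
have b0 : 0 < `|B| + 1 by rewrite ltr_wpDl.
have a0 : 0 < `|A| + 1 by rewrite ltr_wpDl.
have e1 : 0 < e / 2 / (`|B| + 1) by rewrite !divr_gt0.
have e2 : 0 < e / 2 / (`|A| + 1) by rewrite !divr_gt0.
have hc := hasd_cont hB (hA _ e1).
near=> h; rewrite bcompE /=; set k := g (x + h) - g x.
have <- : g x + k = g (x + h) by rewrite addrC subrK.
have -> : f (g x + k) - f (g x) - A (B h) =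
  (f (g x + k) - f (g x) - A k) + A (k - B h).
  by rewrite (blinB A k (B h)); vring R Z.
rewrite (splitr e) mulrDl (le_trans (ler_normD _ _))// lerD//.
  apply: (@le_trans _ _ (e / 2 / (`|B| + 1) * `|k|)).
    by rewrite /k; near: h; exact: hc.
  rewrite -mulrA ler_pM2l ?divr_gt0// ler_pdivrMl//.
  by rewrite /k; near: h; exact: hasd_lip hB.
apply: (le_trans (blin_ub _ _)).
apply: (@le_trans _ _ ((`|A| + 1) * `|k - B h|)); first by rewrite ler_wpM2r// lerDl.
rewrite -ler_pdivlMl// mulrA [_^-1 * _]mulrC /k; near: h; exact: hB.
Unshelve. all: by end_near. Qed.

(** This one notion covers composition of operators, scaling by a function, the inner product and
    evaluation of an operator, so that a single Leibniz rule serves all of them. *)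
Definition bilin V1 V2 W (b : V1 -> V2 -> W) (C : R) : Prop :=
  [/\ forall y, linear (b ^~ y), forall x, linear (b x) &
      forall x y, `|b x y| <= C * `|x| * `|y|].

Lemma bilin0l V1 V2 W (b : V1 -> V2 -> W) C y : bilin b C -> b 0 y = 0.
Proof.
by case=> h _ _; have := h y (-1) 0 0; rewrite scaler0 addr0 scaleN1r addNr.
Qed.

Lemma bilin0r V1 V2 W (b : V1 -> V2 -> W) C x : bilin b C -> b x 0 = 0.
Proof.
by case=> _ h _; have := h x (-1) 0 0; rewrite scaler0 addr0 scaleN1r addNr.
Qed.

Lemma bilinDl V1 V2 W (b : V1 -> V2 -> W) C x x' y : bilin b C ->
  b (x + x') y = b x y + b x' y.
Proof. by case=> h _ _; have := h y 1 x x'; rewrite !scale1r. Qed.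

Lemma bilinDr V1 V2 W (b : V1 -> V2 -> W) C x y y' : bilin b C ->
  b x (y + y') = b x y + b x y'.
Proof. by case=> _ h _; have := h x 1 y y'; rewrite !scale1r. Qed.

Lemma bilinNl V1 V2 W (b : V1 -> V2 -> W) C x y : bilin b C -> b (- x) y = - b x y.
Proof.
move=> hb; have := bilin0l y hb; case: hb => h _ _.
by have := h y (-1) x 0; rewrite !addr0 !scaleN1r => -> ->; rewrite addr0.
Qed.

Lemma bilinNr V1 V2 W (b : V1 -> V2 -> W) C x y : bilin b C -> b x (- y) = - b x y.
Proof.
move=> hb; have := bilin0r x hb; case: hb => _ h _.
by have := h x (-1) y 0; rewrite !addr0 !scaleN1r => -> ->; rewrite addr0.
Qed.

(** The two terms of the derivative of [b (f x) (g x)]. Each is again bilinear with the constant of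
    [b], so the Leibniz rule can be iterated. *)
Definition bilin_lift_l V V1 V2 W (b : V1 -> V2 -> W) (A : blin V V1) (y : V2) : blin V W :=
  mkblin (fun h => b (A h) y).
Definition bilin_lift_r V V1 V2 W (b : V1 -> V2 -> W) (x : V1) (B : blin V V2) : blin V W :=
  mkblin (fun h => b x (B h)).

Lemma bilin_lift_lE V V1 V2 W (b : V1 -> V2 -> W) C (A : blin V V1) y h :
  0 <= C -> bilin b C -> bilin_lift_l b A y h = b (A h) y.
Proof.
move=> C0 [h1 h2 h3]; apply: (@mkblinE _ V W (fun h => b (A h) y)); split.
  by move=> a u v; rewrite linearP h1.
exists (C * `|A| * `|y|) => v; apply: (le_trans (h3 _ _)).
rewrite -!mulrA ler_wpM2l// [`|y| * _]mulrC !mulrA ler_wpM2r// blin_ub//.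
Qed.

Lemma bilin_lift_rE V V1 V2 W (b : V1 -> V2 -> W) C x (B : blin V V2) h :
  0 <= C -> bilin b C -> bilin_lift_r b x B h = b x (B h).
Proof.
move=> C0 [h1 h2 h3]; apply: (@mkblinE _ V W (fun h => b x (B h))); split.
  by move=> a u v; rewrite linearP h2.
exists (C * `|x| * `|B|) => v; apply: (le_trans (h3 _ _)).
by rewrite -[leRHS]mulrA ler_wpM2l// ?mulr_ge0// blin_ub.
Qed.

Lemma bilin_lift_l_bilin V V1 V2 W (b : V1 -> V2 -> W) C :
  0 <= C -> bilin b C -> bilin (@bilin_lift_l V V1 V2 W b) C.
Proof.
move=> C0 hb; split.
- move=> y a A B; apply: blinP => h.
  rewrite blin_add blin_scale !(bilin_lift_lE _ _ _ C0 hb) blin_add blin_scale.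
  by case: hb => ->.
- move=> A a y z; apply: blinP => h.
  rewrite blin_add blin_scale !(bilin_lift_lE _ _ _ C0 hb).
  by case: hb => _ ->.
- move=> A y; apply: blin_lub; first by rewrite !mulr_ge0.
  move=> v; rewrite (bilin_lift_lE _ _ _ C0 hb); case: hb => _ _ h3.
  apply: (le_trans (h3 _ _)).
  by rewrite -!mulrA ler_wpM2l// [`|y| * _]mulrC !mulrA ler_wpM2r// blin_ub.
Qed.

Lemma bilin_lift_r_bilin V V1 V2 W (b : V1 -> V2 -> W) C :
  0 <= C -> bilin b C -> bilin (@bilin_lift_r V V1 V2 W b) C.
Proof.
move=> C0 hb; split.
- move=> B a x y; apply: blinP => h.
  rewrite blin_add blin_scale !(bilin_lift_rE _ _ _ C0 hb).
  by case: hb => ->.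
- move=> x a A B; apply: blinP => h.
  rewrite blin_add blin_scale !(bilin_lift_rE _ _ _ C0 hb) blin_add blin_scale.
  by case: hb => _ ->.
- move=> x B; apply: blin_lub; first by rewrite !mulr_ge0.
  move=> v; rewrite (bilin_lift_rE _ _ _ C0 hb); case: hb => _ _ h3.
  apply: (le_trans (h3 _ _)).
  by rewrite -[leRHS]mulrA ler_wpM2l// ?mulr_ge0// blin_ub.
Qed.

Lemma hasd_bilin V V1 V2 W (b : V1 -> V2 -> W) C (f : V -> V1) (g : V -> V2) x A B :
  0 <= C -> bilin b C -> hasd f x A -> hasd g x B ->
  hasd (fun y => b (f y) (g y)) x (bilin_lift_l b A (g x) + bilin_lift_r b (f x) B).
Proof.
move=> C0 hb hA hB e e0.
(* The errors [b k l], [b (k - A h) (g x)] and [b (f x) (l - B h)] add up to at most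
   [(M - 1) * (e / M)] times the norm of [h]; the summand 1 keeps [M] positive. *)
pose M := C * (`|f x| + `|g x| + (`|A| + 1) * (`|B| + 1)) + 1.
have M0 : 0 < M.
  by rewrite ltr_wpDl// mulr_ge0// !addr_ge0// mulr_ge0// addr_ge0.
have e1 : 0 < e / M by rewrite divr_gt0.
near=> h; rewrite blin_add (bilin_lift_lE _ _ _ C0 hb) (bilin_lift_rE _ _ _ C0 hb).
have [k kE] : {k | k = f (x + h) - f x} by eexists.
have [l lE] : {l | l = g (x + h) - g x} by eexists.
have -> : b (f (x + h)) (g (x + h)) - b (f x) (g x) - (b (A h) (g x) + b (f x) (B h)) =
   b k l + (b (k - A h) (g x) + b (f x) (l - B h)).
  have -> : f (x + h) = f x + k by rewrite kE; vring R V1.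
  have -> : g (x + h) = g x + l by rewrite lE; vring R V2.
  rewrite !(bilinDl _ _ _ hb) !(bilinDr _ _ _ hb) (bilinNl _ _ hb) (bilinNr _ _ hb).
  vring R W.
have bC : forall u v, `|b u v| <= C * `|u| * `|v| by case: hb.
have kh : `|k| <= (`|A| + 1) * `|h| by rewrite ?kE ?lE; near: h; exact: hasd_lip.
have lh : `|l| <= (`|B| + 1) * `|h| by rewrite ?kE ?lE; near: h; exact: hasd_lip.
have kA : `|k - A h| <= e / M * `|h| by rewrite kE; near: h; exact: hA.
have lB : `|l - B h| <= e / M * `|h| by rewrite lE; near: h; exact: hB.
have he : `|h| <= e / M by near: h; exact: nbhs0_le.
apply: (@le_trans _ _ (C * (((`|A| + 1) * `|h|) * ((`|B| + 1) * (e / M))) +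
   (C * (e / M * `|h|) * `|g x| + C * `|f x| * (e / M * `|h|)))).
  apply: (le_trans (ler_normD _ _)); apply: lerD.
    apply: (le_trans (bC _ _)); rewrite -mulrA ler_wpM2l// ler_pM//.
    apply: (le_trans lh); rewrite ler_wpM2l// addr_ge0//.
  apply: (le_trans (ler_normD _ _)); apply: lerD.
    apply: (le_trans (bC _ _)); rewrite ler_wpM2r// ler_wpM2l//.
  apply: (le_trans (bC _ _)); rewrite ler_wpM2l// mulr_ge0//.
have -> : C * ((`|A| + 1) * `|h| * ((`|B| + 1) * (e / M))) +
   (C * (e / M * `|h|) * `|g x| + C * `|f x| * (e / M * `|h|)) = (M - 1) * (e / M * `|h|).
  by rewrite /M; ring.
have -> : e * `|h| = M * (e / M * `|h|) by field; rewrite gt_eqF.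
rewrite ler_wpM2r//; first by rewrite mulr_ge0// ltW.
by rewrite gerBl.
Unshelve. all: by end_near. Qed.

(** One constant for all orders up to [k]. The codomain [W] is quantified inside, since the
    recursion passes to [D f], whose values are operators. *)
Fixpoint Sm V (k : nat) : forall W, R -> set V -> (V -> W) -> Prop :=
  match k with
  | 0%N => fun W K U f => forall x, U x -> `|f x| <= K
  | k'.+1 => fun W K U f => [/\ forall x, U x -> `|f x| <= K,
      forall x, U x -> hasd f x (D f x) & Sm k' K U (D f)]
  end.

(** Variant without a bound on [f] itself, needed for unbounded maps such as affine projections and
    inverses of near-identity maps; at order 0 it says nothing. *)
Definition DSm V (k : nat) W (K : R) (U : set V) (f : V -> W) : Prop :=
  if k is k'.+1 then
    (forall x, U x -> hasd f x (D f x)) /\ Sm k' K U (D f)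
  else True.

Lemma Sm_bound V k W K U (f : V -> W) x : Sm k K U f -> U x -> `|f x| <= K.
Proof. by case: k => [|k] /=; [exact|case=> h _ _; exact: h]. Qed.

Lemma Sm_le V k W K K' U (f : V -> W) : K <= K' -> Sm k K U f -> Sm k K' U f.
Proof.
move=> KK; elim: k W f => [|k IH] W f /=.
  by move=> h x Ux; apply: le_trans (h x Ux) KK.
case=> h1 h2 h3; split=> //; last exact: IH.
by move=> x Ux; apply: le_trans (h1 x Ux) KK.
Qed.

Lemma Sm_sub V k W K (U U' : set V) (f : V -> W) : U' `<=` U -> Sm k K U f -> Sm k K U' f.
Proof.
move=> UU; elim: k W f => [|k IH] W f /=; first by move=> h x /UU; exact: h.
by case=> h1 h2 h3; split; [move=> x /UU; exact: h1|move=> x /UU; exact: h2|exact: IH].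
Qed.

Lemma Sm_union V k W K (U U' : set V) (f : V -> W) :
  Sm k K U f -> Sm k K U' f -> Sm k K (U `|` U') f.
Proof.
elim: k W f => [|k IH] W f /=; first by move=> h h' x [/h|/h'].
by case=> h1 h2 h3 [h1' h2' h3']; split; [move=> x [/h1|/h1']|move=> x [/h2|/h2']|exact: IH].
Qed.

Lemma Sm_pred V k W K U (f : V -> W) : Sm k.+1 K U f -> Sm k K U f.
Proof.
elim: k W f => [|k IH] W f; first by case.
by move=> [h1 h2 h3]; split=> //; exact: IH.
Qed.

Lemma Sm_leq V k k' W K U (f : V -> W) : (k <= k')%N -> Sm k' K U f -> Sm k K U f.
Proof.
move=> /subnKC <-; elim: (k' - k)%N => [|m IH]; first by rewrite addn0.
by rewrite addnS => /Sm_pred.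
Qed.

Lemma DSm_leq V k k' W K U (f : V -> W) : (k <= k')%N -> DSm k' K U f -> DSm k K U f.
Proof.
case: k k' => [//|k] [//|k'] kk [h1 h2]; split=> //; exact: Sm_leq h2.
Qed.

Lemma DSm_le V k W K K' U (f : V -> W) : K <= K' -> DSm k K U f -> DSm k K' U f.
Proof. by case: k => [//|k] KK [h1 h2]; split=> //; exact: Sm_le h2. Qed.

Lemma SmE V k W K U (f : V -> W) :
  Sm k K U f <-> (forall x, U x -> `|f x| <= K) /\ DSm k K U f.
Proof.
case: k => [|k] /=; first by split=> [|[]].
by split=> [[? ? ?]|[? [? ?]]]; split.
Qed.

Lemma D_near V W (U : set V) (f g : V -> W) x : open U -> (forall y, U y -> f y = g y) ->
  U x -> D f x = D g x.
Proof.
move=> oU fg Ux; congr (xget _ _); apply/funext => A; apply/propext.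
have nU := open_shift oU Ux.
by split; apply: hasd_near; rewrite ?fg//; near=> h; rewrite fg//; near: h.
Unshelve. all: by end_near. Qed.

Lemma Sm_ext V k W K (U : set V) (f g : V -> W) : open U -> (forall y, U y -> f y = g y) ->
  Sm k K U f -> Sm k K U g.
Proof.
move=> oU; elim: k W f g => [|k IH] W f g fg /=.
  by move=> h x Ux; rewrite -fg//; exact: h.
have nU x : U x -> \forall h \near (0 : V), U (x + h) by exact: open_shift.
case=> h1 h2 h3; split.
- by move=> x Ux; rewrite -fg//; exact: h1.
- move=> x Ux; rewrite -(D_near oU fg)//; apply: hasd_near (h2 x Ux); rewrite ?fg//.
  by near=> h; rewrite fg//; near: h; exact: nU.
- by apply: IH h3 => y Uy; exact: D_near oU fg Uy.
Unshelve. all: by end_near. Qed.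

Lemma DSm_ext V k W K (U : set V) (f g : V -> W) : open U -> (forall y, U y -> f y = g y) ->
  DSm k K U f -> DSm k K U g.
Proof.
case: k => [//|k] oU fg [h1 h2]; split; last first.
  by apply: Sm_ext h2 => // y Uy; exact: D_near oU fg Uy.
move=> x Ux; rewrite -(D_near oU fg)//; apply: hasd_near (h1 x Ux); rewrite ?fg//.
have := open_shift oU Ux; apply: filterS => h Uh; rewrite fg//.
Qed.

Lemma DSm_intro V k W K U (f : V -> W) (A : V -> blin V W) : open U ->
  (forall x, U x -> hasd f x (A x)) -> Sm k K U A -> DSm k.+1 K U f.
Proof.
move=> oU fA hA.
have DA x : U x -> A x = D f x by move=> Ux; rewrite (hasdD (fA x Ux)).
split=> [x Ux|]; first by rewrite -DA//; exact: fA.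
exact: Sm_ext hA.
Qed.

Lemma Sm_intro V k W K U (f : V -> W) (A : V -> blin V W) : open U ->
  (forall x, U x -> `|f x| <= K) ->
  (forall x, U x -> hasd f x (A x)) -> Sm k K U A -> Sm k.+1 K U f.
Proof. by move=> oU bf fA hA; apply/SmE; split=> //; exact: DSm_intro hA. Qed.

Lemma Sm_cst V k W K (U : set V) (c : W) : `|c| <= K -> open U -> Sm k K U (fun _ => c).
Proof.
move=> cK oU; have K0 : 0 <= K by apply: le_trans cK.
elim: k W c cK => [|k IH] W c cK //.
apply: (@Sm_intro _ _ _ _ _ _ (fun _ => 0)) => //; first by move=> x _; exact: hasd_cst.
by apply: IH; rewrite normr0.
Qed.

Lemma DSm_lin V k W K (A : blin V W) : `|A| <= K -> DSm k K setT A.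
Proof.
move=> AK; case: k => // k; apply: (@DSm_intro _ _ _ _ _ _ (fun _ => A)); first exact: openT.
  by move=> x _; exact: hasd_lin.
by apply: Sm_cst => //; exact: openT.
Qed.

Lemma Sm_add V k W K1 K2 (U : set V) (f g : V -> W) : open U ->
  Sm k K1 U f -> Sm k K2 U g -> Sm k (K1 + K2) U (fun x => f x + g x).
Proof.
move=> oU; elim: k W f g => [|k IH] W f g.
  by move=> h1 h2 x Ux; rewrite (le_trans (ler_normD _ _))// lerD ?h1 ?h2.
move=> [h1 h2 h3] [h1' h2' h3'].
apply: (@Sm_intro _ _ _ _ _ _ (fun x => D f x + D g x)) => //.
- by move=> x Ux; rewrite (le_trans (ler_normD _ _))// lerD ?h1 ?h1'.
- by move=> x Ux; apply: hasd_add; [exact: h2|exact: h2'].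
- exact: IH.
Qed.

Lemma DSm_add V k W K1 K2 (U : set V) (f g : V -> W) : open U ->
  DSm k K1 U f -> DSm k K2 U g -> DSm k (K1 + K2) U (fun x => f x + g x).
Proof.
case: k => [//|k] oU [h1 h2] [h1' h2'].
apply: (@DSm_intro _ _ _ _ _ _ (fun x => D f x + D g x)) => //; last exact: Sm_add.
by move=> x Ux; apply: hasd_add; [exact: h1|exact: h1'].
Qed.

Lemma bcomp_bilin V W Z : bilin (@bcomp V W Z) 1.
Proof.
split.
- by move=> B a A A'; apply: blinP => v; rewrite blin_add blin_scale !bcompE blin_add blin_scale.
- by move=> A a B B'; apply: blinP => v; rewrite blin_add blin_scale !bcompE blin_add blin_scale blinD blinZ.
- move=> A B; rewrite mul1r; apply: blin_lub; first by rewrite mulr_ge0.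
  by move=> v; rewrite bcompE (le_trans (blin_ub _ _))// -mulrA ler_wpM2l// blin_ub.
Qed.

(** Each differentiation produces two terms of the same kind with the same constant, hence the
    factor [2 ^+ k]. *)
Lemma Sm_bilin V k V1 V2 W (b : V1 -> V2 -> W) C K1 K2 (U : set V) (f : V -> V1) (g : V -> V2) :
  open U -> 0 <= C -> 0 <= K1 -> 0 <= K2 -> bilin b C ->
  Sm k K1 U f -> Sm k K2 U g -> Sm k (2 ^+ k * (C * K1 * K2)) U (fun x => b (f x) (g x)).
Proof.
move=> oU C0 K10 K20; elim: k V1 V2 W b f g => [|k IH] V1 V2 W b f g hb hf hg.
  move=> x Ux; rewrite expr0 mul1r; case: (hb) => _ _ h.
  by rewrite (le_trans (h _ _))// ler_pM// ?mulr_ge0// ?ler_wpM2l// ?hf ?hg.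
case: (hf) => h1 h2 h3; case: (hg) => h1' h2' h3'.
apply: (@Sm_intro _ _ _ _ _ _
  (fun x => bilin_lift_l b (D f x) (g x) + bilin_lift_r b (f x) (D g x))) => //.
- move=> x Ux; apply: (@le_trans _ _ (C * K1 * K2)); last first.
    by rewrite ler_peMl ?mulr_ge0// exprn_ege1// ler1n.
  case: (hb) => _ _ h.
  by rewrite (le_trans (h _ _))// ler_pM// ?mulr_ge0// ?ler_wpM2l// ?h1 ?h1'.
- by move=> x Ux; apply: (hasd_bilin C0 hb); [exact: h2|exact: h2'].
- rewrite exprS -mulrA mulr_natl mulr2n; apply: Sm_add => //.
    by apply: IH => //; [exact: bilin_lift_l_bilin|exact: Sm_pred].
  by apply: IH => //; [exact: bilin_lift_r_bilin|exact: Sm_pred].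
Qed.

(** By the chain rule the derivative is [bcomp (D f (g x)) (D g x)]: the second summand is the bound
    of [Sm_bilin] for it, with [1] the constant of [bcomp_bilin], and the first bounds the
    values. *)
Fixpoint comp_bound k (Kf Kg : R) : R :=
  if k is k'.+1 then Kf + 2 ^+ k' * (1 * comp_bound k' Kf Kg * Kg) else Kf.

Lemma comp_bound_ge0 k Kf Kg : 0 <= Kf -> 0 <= Kg -> 0 <= comp_bound k Kf Kg.
Proof. by move=> f0 g0; elim: k => [//|k IH] /=; rewrite addr_ge0// !mulr_ge0// exprn_ge0. Qed.

Lemma Sm_comp V k W Z Kf Kg (U : set V) (U2 : set W) (f : W -> Z) (g : V -> W) :
  open U -> 0 <= Kf -> 0 <= Kg -> (forall x, U x -> U2 (g x)) ->
  Sm k Kf U2 f -> DSm k Kg U g -> Sm k (comp_bound k Kf Kg) U (fun x => f (g x)).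
Proof.
move=> oU f0 g0 gU; elim: k Z f => [|k IH] Z f hf hg.
  by move=> x Ux; apply: hf; exact: gU.
case: (hf) => h1 h2 h3; case: (hg) => h1' h2'.
apply: (@Sm_intro _ _ _ _ _ _ (fun x => bcomp (D f (g x)) (D g x))) => //.
- move=> x Ux; rewrite (le_trans (h1 _ (gU _ Ux)))//= lerDl !mulr_ge0// ?exprn_ge0//.
  exact: comp_bound_ge0.
- by move=> x Ux; apply: hasd_comp; [apply: h2; exact: gU|exact: h1'].
- apply: (@Sm_le _ _ _ (2 ^+ k * (1 * comp_bound k Kf Kg * Kg))); first by rewrite /= lerDr.
  apply: Sm_bilin => //; [exact: comp_bound_ge0|exact: bcomp_bilin|].
  apply: IH => //; exact: DSm_leq hg.
Qed.

Lemma DSm_comp V k W Z Kf Kg (U : set V) (U2 : set W) (f : W -> Z) (g : V -> W) :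
  open U -> 0 <= Kf -> 0 <= Kg -> (forall x, U x -> U2 (g x)) ->
  DSm k Kf U2 f -> DSm k Kg U g -> DSm k (comp_bound k Kf Kg) U (fun x => f (g x)).
Proof.
move=> oU f0 g0 gU; case: k => [//|k] [h2 h3] [h1' h2'].
apply: (@DSm_intro _ _ _ _ _ _ (fun x => bcomp (D f (g x)) (D g x))) => //.
- by move=> x Ux; apply: hasd_comp; [apply: h2; exact: gU|exact: h1'].
- apply: (@Sm_le _ _ _ (2 ^+ k * (1 * comp_bound k Kf Kg * Kg))); first by rewrite /= lerDr.
  apply: Sm_bilin => //; [exact: comp_bound_ge0|exact: bcomp_bilin|].
  apply: (@Sm_comp _ _ _ _ _ _ _ U2) => //.
  by apply: (@DSm_leq _ _ k.+1).
Qed.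

Definition bpost V W Z (T : blin W Z) : blin (blin V W) (blin V Z) := mkblin (@bcomp V W Z T).

Lemma bpostE V W Z (T : blin W Z) (A : blin V W) : bpost V T A = bcomp T A.
Proof.
case: (bcomp_bilin V W Z) => _ h1 h2; apply: (@mkblinE _ _ _ (@bcomp V W Z T)); split=> //.
by exists `|T| => B; have := h2 T B; rewrite mul1r.
Qed.

Lemma bpost_norm V W Z (T : blin W Z) : `|bpost V T| <= `|T|.
Proof.
apply: blin_lub => // A; rewrite bpostE; case: (bcomp_bilin V W Z) => _ _ h.
by have := h T A; rewrite mul1r.
Qed.

Lemma Sm_lin V k W Z K (U : set V) (T : blin W Z) (f : V -> W) : open U -> 0 <= K ->
  Sm k K U f -> Sm k (`|T| * K) U (fun x => T (f x)).
Proof.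
move=> oU K0; elim: k W Z T f => [|k IH] W Z T f.
  by move=> h x Ux; rewrite (le_trans (blin_ub _ _))// ler_wpM2l// h.
case=> h1 h2 h3.
apply: (@Sm_intro _ _ _ _ _ _ (fun x => bpost V T (D f x))) => //.
- by move=> x Ux; rewrite (le_trans (blin_ub _ _))// ler_wpM2l// h1.
- by move=> x Ux; rewrite bpostE; apply: hasd_comp; [exact: hasd_lin|exact: h2].
- apply: Sm_le (IH _ _ _ _ h3); rewrite ler_wpM2r ?bpost_norm//.
Qed.

End Frechet.

(** * Inverses of near-identity maps *)

Section NearIdentity.
Context {R : realType} {E : completeNormedModType R}.

(** The solution is the fixed point of the contraction sending [x] to [y - S x]; completeness of [E]
    enters here. *)
Lemma near_id_bij (S : E -> E) : (forall x y, `|S x - S y| <= 2^-1 * `|x - y|) ->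
  forall y, exists x, x + S x = y.
Proof.
move=> hS y.
have f0 : forall x, setT x -> setT ((fun x => y - S x) x) by [].
pose f : {fun [set: E] >-> [set: E]} :=
  HB.pack (fun x : E => y - S x) (@isFun.Build _ _ setT setT _ f0).
have [] := @banach_fixed_point R E setT f.
- exists 2^-1%:nng; split => /=; first by rewrite invf_lt1// ltr1n.
  move=> [u v] _ /=.
  have -> : y - S u - (y - S v) = - (S u - S v) by vring R E.
  by rewrite normrN; exact: hS.
- exact: closedT.
- by exists 0.
- by move=> x _ /= xE; exists x; rewrite {1}xE subrK.
Qed.

Lemma near_id_inj (S : E -> E) (x y : E) : (forall x y, `|S x - S y| <= 2^-1 * `|x - y|) ->
  `|x - y| <= 2 * `|(x + S x) - (y + S y)|.
Proof.
move=> hS; have := hS x y.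
have h : `|x - y| <= `|(x + S x) - (y + S y)| + `|S x - S y|.
  have {1}-> : x - y = (x + S x) - (y + S y) - (S x - S y) by vring R E.
  exact: ler_normB.
lra.
Qed.

Lemma near_id_linear_inverse (A : blin E E) : `|A| <= 2^-1 ->
  exists J : blin E E, [/\ forall v, J v + A (J v) = v, forall v, J (v + A v) = v & `|J| <= 2].
Proof.
move=> A2.
have lA x y : `|A x - A y| <= 2^-1 * `|x - y|.
  by rewrite -blinB (le_trans (blin_ub _ _))// ler_wpM2r.
have [J hJ] := choice (near_id_bij lA).
have uJ u v : u + A u = v -> J v = u.
  move=> uv; apply/eqP; rewrite -subr_eq0 -normr_le0.
  by rewrite (le_trans (near_id_inj _ _ lA))// hJ uv subrr normr0 mulr0.
have bJ : forall v, `|J v| <= 2 * `|v|.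
  move=> v; have := near_id_inj (J v) 0 lA.
  by rewrite hJ blin0 addr0 !subr0.
have lJ : bounded_linear J.
  split; last by exists 2.
  move=> a u v; apply: uJ; rewrite blinD blinZ -[in RHS](hJ u) -[in RHS](hJ v).
  vring R E.
exists (mkblin J); split.
- by move=> v; rewrite !mkblinE.
- by move=> v; rewrite mkblinE//; exact: uJ.
- by apply: blin_lub => // v; rewrite mkblinE.
Qed.

Definition id_blin : blin E E := mkblin id.

Lemma id_blinE v : id_blin v = v.
Proof. by apply: (@mkblinE _ _ _ id); split=> //; exists 1 => u; rewrite mul1r. Qed.

Lemma id_blin_norm : `|id_blin| <= 1.
Proof. by apply: blin_lub => // v; rewrite id_blinE mul1r. Qed.

End NearIdentity.

Section SmoothInverse.
Context {R : realType}.

(* The derivative of [y |-> (T y)^-1] is [h |-> - J (T' h) J]. *)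
Lemma hasd_inverse (V : normedModType R) (E : completeNormedModType R)
    (T J : V -> blin E E) (B : blin V (blin E E)) x :
  (forall y v, J y (T y v) = v) -> (forall y v, T y (J y v) = v) -> (forall y, `|J y| <= 2) ->
  hasd T x B ->
  hasd J x (- bilin_lift_r (@bcomp R E E E) (J x) (bilin_lift_l (@bcomp R E E E) B (J x))).
Proof.
move=> JT TJ J2 hB e e0.
(* 4 and 8 collect the factors 2 from the bounds on [J] and [J (x + h)] in the two error terms [b1]
   and [b2] below. *)
pose M := 4 + 8 * ((`|B| + 1) * `|B|).
have M0 : 0 < M by rewrite ltr_pwDl// !mulr_ge0// addr_ge0.
have e1 : 0 < e / M by rewrite divr_gt0.
near=> h.
rewrite blin_opp (bilin_lift_rE _ _ _ ler01 (bcomp_bilin _ _ _)).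
rewrite (bilin_lift_lE _ _ _ ler01 (bcomp_bilin _ _ _)) opprK.
have [k kE] : {k | k = T (x + h) - T x} by eexists.
have kB : `|k - B h| <= e / M * `|h| by rewrite kE; near: h; exact: hB.
have kl : `|k| <= (`|B| + 1) * `|h| by rewrite kE; near: h; exact: hasd_lip.
have he : `|h| <= e / M by near: h; exact: nbhs0_le.
apply: blin_lub; first by rewrite mulr_ge0// ltW.
move=> v; rewrite blin_add blin_add blin_opp !bcompE.
(* The resolvent identity; together with the uniform bound 2 on [J] it replaces a separate proof
   that [J] is continuous. *)
have dJ w : J (x + h) w - J x w = - J (x + h) (k (J x w)).
  rewrite kE blin_add blin_opp TJ blinB JT; vring R E.
have -> : J (x + h) v - J x v + J x (B h (J x v)) =
   - J (x + h) ((k - B h) (J x v)) + J (x + h) (k (J x (B h (J x v)))).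
  have := dJ (B h (J x v)); move/(canRL (subrK _)).
  have := dJ v; move/(canRL (subrK _)) => -> .
  rewrite (blin_add k) blin_opp blinB => ->.
  vring R E.
rewrite (le_trans (ler_normD _ _))// normrN.
have b1 : `|J (x + h) ((k - B h) (J x v))| <= 2 * (e / M * `|h| * (2 * `|v|)).
  rewrite (le_trans (blin_ub _ _))// ler_pM// (le_trans (blin_ub _ _))// ler_pM//.
  by rewrite (le_trans (blin_ub _ _))// ler_wpM2r.
have b2 : `|J (x + h) (k (J x (B h (J x v))))| <=
    2 * ((`|B| + 1) * (e / M) * (2 * (`|B| * `|h| * (2 * `|v|)))).
  rewrite (le_trans (blin_ub _ _))// ler_pM// (le_trans (blin_ub _ _))// ler_pM//.
    by rewrite (le_trans kl)// ler_wpM2l// addr_ge0.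
  rewrite (le_trans (blin_ub _ _))// ler_pM// (le_trans (blin_ub _ _))// ler_pM//.
    exact: blin_ub.
  by rewrite (le_trans (blin_ub _ _))// ler_wpM2r.
apply: (le_trans (lerD b1 b2)).
have -> : 2 * (e / M * `|h| * (2 * `|v|)) +
  2 * ((`|B| + 1) * (e / M) * (2 * (`|B| * `|h| * (2 * `|v|)))) =
  M * (e / M * `|h| * `|v|) by rewrite /M; ring.
by rewrite le_eqVlt; apply/orP; left; apply/eqP; field; rewrite gt_eqF.
Unshelve. all: by end_near. Qed.

(** Two nested applications of [Sm_bilin] to the derivative of [J], which is a product of [J], [D T]
    and [J]; the summand 2 bounds [J] itself. *)
Fixpoint inverse_bound (k : nat) (KT : R) : R :=
  if k is k'.+1 then
    2 + 2 ^+ k' * (1 * inverse_bound k' KT * (2 ^+ k' * (1 * KT * inverse_bound k' KT)))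
  else 2.

Lemma inverse_bound_ge0 k KT : 0 <= KT -> 0 <= inverse_bound k KT.
Proof. by move=> h; elim: k => [//|k IH] /=; rewrite addr_ge0// !mulr_ge0// exprn_ge0. Qed.

Lemma Sm_opp (V W : normedModType R) k K (U : set V) (f : V -> W) :
  open U -> 0 <= K -> Sm k K U f -> Sm k K U (fun x => - f x).
Proof.
move=> oU K0 hf.
have bN : bounded_linear (fun x : W => - x).
  split; first by move=> a u v; rewrite opprD scalerN.
  by exists 1 => v; rewrite normrN mul1r.
have nN : `|mkblin (fun x : W => - x)| <= 1.
  by apply: blin_lub => // v; rewrite mkblinE// normrN mul1r.
apply: (@Sm_ext _ _ _ _ _ _ (fun x => mkblin (fun x : W => - x) (f x))) => //.
  by move=> y _; rewrite mkblinE.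
by apply: Sm_le (Sm_lin _ oU K0 hf); rewrite ler_piMl.
Qed.

Lemma Sm_inverse (V : normedModType R) (E : completeNormedModType R) k
    (T J : V -> blin E E) KT :
  0 <= KT ->
  (forall y v, J y (T y v) = v) -> (forall y v, T y (J y v) = v) -> (forall y, `|J y| <= 2) ->
  DSm k KT setT T -> Sm k (inverse_bound k KT) setT J.
Proof.
move=> K0 JT TJ J2; elim: k => [|k IH] hT; first by move=> x _; exact: J2.
have hJ : Sm k (inverse_bound k KT) setT J by apply: IH; exact: DSm_leq hT.
have I0 := inverse_bound_ge0 k K0.
case: hT => h1 h2.
have oT := @openT V.
apply: (@Sm_intro _ _ _ _ _ _ _ (fun x =>
   - bilin_lift_r (@bcomp R E E E) (J x) (bilin_lift_l (@bcomp R E E E) (D T x) (J x)))) => //.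
- by move=> x _; rewrite (le_trans (J2 x))//= lerDl !mulr_ge0// exprn_ge0.
- by move=> x _; apply: hasd_inverse => //; exact: h1.
- apply: Sm_opp => //; first exact: (inverse_bound_ge0 k.+1).
  rewrite /=; apply: (@Sm_le _ _ _ _ (2 ^+ k * (1 * inverse_bound k KT *
     (2 ^+ k * (1 * KT * inverse_bound k KT))))); first by rewrite lerDr.
  apply: Sm_bilin => //; first by rewrite !mulr_ge0// exprn_ge0.
    by apply: bilin_lift_r_bilin => //; exact: bcomp_bilin.
  apply: Sm_bilin => //.
  by apply: bilin_lift_l_bilin => //; exact: bcomp_bilin.
Qed.

(** The derivative of the inverse [G] at [y] is the inverse of [id + D S (G y)], whose bound uses
    that of [G] one order lower. At order 0 [DSm] is vacuous, hence the value 0. *)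
Fixpoint diffeo_bound (k : nat) (K : R) : R :=
  if k is k'.+1 then inverse_bound k' (1 + comp_bound k' K (diffeo_bound k' K)) else 0.

Lemma diffeo_bound_ge0 k K : 0 <= K -> 0 <= diffeo_bound k K.
Proof.
move=> K0; elim: k => [//|k IH] /=; apply: inverse_bound_ge0.
by rewrite addr_ge0// comp_bound_ge0.
Qed.

Lemma near_id_diffeo (E : completeNormedModType R) (S G : E -> E) :
  (forall x y, `|S x - S y| <= 2^-1 * `|x - y|) ->
  (forall x, hasd S x (D S x) /\ `|D S x| <= 2^-1) ->
  (forall y, G y + S (G y) = y) ->
  forall k K, 0 <= K -> DSm k K setT S -> DSm k (diffeo_bound k K) setT G.
Proof.
move=> lS dS hG.
have /choice[J hJ] : forall y, exists J : blin E E,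
  [/\ forall v, J v + D S (G y) (J v) = v, forall v, J (v + D S (G y) v) = v & `|J| <= 2].
  by move=> y; apply: near_id_linear_inverse; case: (dS (G y)).
have J2 y : `|J y| <= 2 by case: (hJ y).
have GL y y' : `|G y - G y'| <= 2 * `|y - y'|.
  by rewrite (le_trans (near_id_inj _ _ lS))// !hG.
have hasG y : hasd G y (J y).
  move=> e e0; have e4 : 0 < e / 4 by rewrite divr_gt0.
  have cG : (fun h => G (y + h) - G y) @ (0 : E) --> (0 : E).
    apply/cvgr0Pnorm_le => d d0; near=> h.
    rewrite (le_trans (GL _ _))// [y + h]addrC addrK mulrC -ler_pdivlMr//.
    by near: h; apply: nbhs0_le; rewrite divr_gt0.
  have hc := cG _ ((dS (G y)).1 _ e4).
  near=> h.
  have [k kE] : {k | k = G (y + h) - G y} by eexists.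
  have GE : G (y + h) = G y + k by rewrite kE; vring R E.
  have rk : `|S (G y + k) - S (G y) - D S (G y) k| <= e / 4 * `|k|.
    by rewrite kE; near: h; exact: hc.
  have kh : `|k| <= 2 * `|h| by rewrite kE (le_trans (GL _ _))// [y + h]addrC addrK.
  (* Subtracting the equations [hG] at [y + h] and at [y] gives [h] as [id + D S (G y)] applied to
     [k], plus a remainder. Applying [J] leaves [k] plus an error of at most [2 * (e / 4) * 2] times
     the norm of [h]. *)
  have hE : h = k + D S (G y) k + (S (G y + k) - S (G y) - D S (G y) k).
    have -> : h = (y + h) - y by vring R E.
    rewrite -[in LHS](hG (y + h)) -[X in _ - X = _](hG y) GE; vring R E.
  rewrite -kE {1}hE blinD; case: (hJ y) => _ -> _.
  rewrite opprD addrA subrr sub0r normrN (le_trans (blin_ub _ _))//.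
  rewrite (@le_trans _ _ (2 * (e / 4 * (2 * `|h|))))//; last lra.
  by rewrite ler_pM// (le_trans rk)// ler_pM2l.
elim=> [//|k IH] K K0 hS.
apply: (@DSm_intro _ _ _ _ _ _ _ J); first exact: openT.
  by move=> x _; exact: hasG.
case: hS => hS1 hS2.
have oT := @openT E.
apply: (@Sm_inverse _ _ _ (fun y => id_blin + D S (G y))) => //.
- by rewrite addr_ge0// comp_bound_ge0// diffeo_bound_ge0.
- by move=> y v; rewrite blin_add id_blinE; case: (hJ y).
- by move=> y v; rewrite blin_add id_blinE; case: (hJ y).
- have h0 : Sm k (1 + comp_bound k K (diffeo_bound k K)) setT (fun y => id_blin + D S (G y)).
    apply: Sm_add => //; first by apply: Sm_cst => //; exact: id_blin_norm.
    apply: (@Sm_comp _ _ _ _ _ _ _ _ setT) => //; first exact: diffeo_bound_ge0.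
    apply: IH => //; exact: (@DSm_leq _ _ k k.+1).
  by case/SmE: h0.
Unshelve. all: by end_near. Qed.

End SmoothInverse.

(** * Iterated differentials *)

Section Bridge.
Context {R : realType}.
Implicit Types (V W Z : normedModType R).

Lemma blin_continuous V W (A : blin V W) : continuous A.
Proof. by move=> x; apply: (hasd_continuous (hasd_lin A x)). Qed.

Lemma hasd_littleo V W (f : V -> W) x (A : blin V W) : hasd f x A ->
  f \o shift x = cst (f x) + (A : {linear V -> W}) +o_ (0 : V) id.
Proof.
move=> hA; apply/eqaddoP => e e0; near=> h.
rewrite /= (_ : (_ - _) h = f (x + h) - f x - A h).
  by near: h; exact: hA.
by rewrite !fctE /= [h + x]addrC opprD addrA.
Unshelve. all: by end_near. Qed.

Lemma hasd_diff V W (f : V -> W) x (A : blin V W) v : hasd f x A -> 'd f x v = A v.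
Proof.
by move=> hA; rewrite (diff_unique (@blin_continuous V W A) (hasd_littleo hA)).
Qed.

Lemma diff_D V W (f : V -> W) x v : hasd f x (D f x) -> 'd f x v = D f x v.
Proof. exact: hasd_diff. Qed.

Lemma hasd_differentiable V W (f : V -> W) x (A : blin V W) : hasd f x A -> differentiable f x.
Proof.
move=> hA; have dA := diff_unique (@blin_continuous V W A) (hasd_littleo hA).
apply/diff_locallyP; rewrite dA; split; [exact: blin_continuous|exact: hasd_littleo].
Qed.

(** Directional derivatives are images of [D f] under this operator, which lets bounds on [D f] pass
    to ['d f x v] through [Sm_lin]. *)
Definition eval_blin V W (v : V) : blin (blin V W) W := mkblin (fun A : blin V W => A v).

Lemma eval_blinE V W (v : V) (A : blin V W) : eval_blin W v A = A v.
Proof.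
apply: (@mkblinE _ _ _ (fun A : blin V W => A v)); split=> //.
by exists `|v| => B; rewrite mulrC blin_ub.
Qed.

Lemma eval_blin_norm V W (v : V) : `|eval_blin W v| <= `|v|.
Proof. by apply: blin_lub => // A; rewrite eval_blinE mulrC blin_ub. Qed.

Lemma DSm_eval V W m K (U : set V) (f : V -> W) v : open U -> 0 <= K ->
  DSm m.+1 K U f -> Sm m (`|v| * K) U (fun x => 'd f x v).
Proof.
move=> oU K0 [h1 h2].
apply: (@Sm_ext _ _ _ _ _ _ (fun x => eval_blin W v (D f x))) => //.
  by move=> y Uy; rewrite eval_blinE diff_D//; exact: h1.
by apply: Sm_le (Sm_lin _ oU K0 h2); rewrite ler_wpM2r// eval_blin_norm.
Qed.

(** Every direction costs one order of differentiability and a factor equal to its norm. With at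
    least one direction the values themselves are bounded, hence [Sm] in the conclusion. *)
Lemma DSm_iter_cons V W v vs m K (U : set V) (f : V -> W) : open U -> 0 <= K ->
  DSm (size vs + m).+1 K U f ->
  Sm m (\prod_(w <- v :: vs) `|w| * K) U (iter_diff f (v :: vs)).
Proof.
move=> oU K0; elim: vs v m => [|w vs IH] v m hf.
  by rewrite big_cons big_nil mulr1; apply: DSm_eval.
rewrite big_cons -mulrA; apply: DSm_eval => //.
  by rewrite mulr_ge0// prodr_ge0.
by have [] := (SmE _ _ _ _).1 (IH w m.+1 ltac:(by rewrite addnS)).
Qed.

Lemma DSm_iter V W vs m K (U : set V) (f : V -> W) : open U -> 0 <= K ->
  DSm (size vs + m) K U f -> DSm m (\prod_(w <- vs) `|w| * K) U (iter_diff f vs).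
Proof.
move=> oU K0; case: vs => [|v vs] hf; first by rewrite big_nil mul1r.
by have [] := (SmE _ _ _ _).1 (DSm_iter_cons v (vs := vs) oU K0 hf).
Qed.

Lemma iter_diff_cons V W (f : V -> W) v vs x : iter_diff f (v :: vs) x = 'd (iter_diff f vs) x v.
Proof. by []. Qed.

Lemma iter_diff_ext V W vs K (U : set V) (f g : V -> W) : open U -> 0 <= K ->
  (forall x, U x -> f x = g x) -> DSm (size vs) K U f ->
  forall x, U x -> iter_diff f vs x = iter_diff g vs x.
Proof.
move=> oU K0 fg; elim: vs => [|v vs IH] hf x Ux; first exact: fg.
rewrite !iter_diff_cons.
have IH' := IH (DSm_leq (leqnSn _) hf).
have [h1 _] : DSm 1 (\prod_(w <- vs) `|w| * K) U (iter_diff f vs).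
  by apply: DSm_iter; rewrite ?addn1.
have hg : hasd (iter_diff g vs) x (D (iter_diff f vs) x).
  apply: hasd_near (h1 x Ux); first exact: IH'.
  by near=> h; apply: IH'; near: h; exact: open_shift.
exact: etrans (hasd_diff v (h1 x Ux)) (esym (hasd_diff v hg)).
Unshelve. all: by end_near. Qed.

Lemma iter_diff_lin V W Z vs K (U : set V) (T : blin W Z) (g : V -> W) : open U -> 0 <= K ->
  DSm (size vs) K U g ->
  forall x, U x -> iter_diff (fun y => T (g y)) vs x = T (iter_diff g vs x).
Proof.
move=> oU K0; elim: vs => [//|v vs IH] hf x Ux.
rewrite !iter_diff_cons.
have IH' := IH (DSm_leq (leqnSn _) hf).
have [h1 _] : DSm 1 (\prod_(w <- vs) `|w| * K) U (iter_diff g vs).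
  by apply: DSm_iter; rewrite ?addn1.
have hg : hasd (iter_diff (fun y => T (g y)) vs) x (bcomp T (D (iter_diff g vs) x)).
  apply: (@hasd_near _ _ _ (fun y => T (iter_diff g vs y))).
  - by rewrite IH'.
  - by near=> h; rewrite IH'//; near: h; exact: open_shift.
  - by apply: hasd_comp; [exact: hasd_lin|exact: h1].
by rewrite (hasd_diff _ hg) bcompE (hasd_diff _ (h1 x Ux)).
Unshelve. all: by end_near. Qed.

(** In [iter_diff] the head of the list is the outermost differentiation, so the last vector is used
    first. Inductions that pass from [f] to [D f] therefore peel the list at its end. *)
Lemma iter_diff_rcons V W (f : V -> W) vs v :
  iter_diff f (rcons vs v) = iter_diff (fun x => 'd f x v) vs.
Proof. by elim: vs => [|w vs /= ->]. Qed.

Lemma iter_diff_D V W vs K (U : set V) (f : V -> W) v : open U -> 0 <= K ->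
  DSm (size vs).+1 K U f ->
  forall x, U x -> iter_diff f (rcons vs v) x = iter_diff (D f) vs x v.
Proof.
move=> oU K0 [h1 h2] x Ux; rewrite iter_diff_rcons.
have h3 : DSm (size vs) K U (D f) by case/SmE: h2.
rewrite (@iter_diff_ext _ _ vs (`|v| * K) U _ (fun x => eval_blin W v (D f x)))//.
- by rewrite (@iter_diff_lin _ _ _ _ K U)// eval_blinE.
- by rewrite mulr_ge0.
- by move=> y Uy; rewrite eval_blinE diff_D//; exact: h1.
- by have [] := (SmE _ _ _ _).1 (DSm_eval v oU K0 (conj h1 h2 : DSm (size vs).+1 K U f)).
Qed.

(** The neighbourhood of 0 is independent of [vs], as the operator norm in [smooth_on] requires: the
    induction passes to [D f] and evaluates at the last vector, which contributes only its norm. *)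
Lemma iter_diff_taylor V k W K (U : set V) (f : V -> W) x e : open U -> 0 <= K ->
  DSm k.+1 K U f -> U x -> 0 < e -> \forall h \near (0 : V), forall vs, size vs = k ->
  `|iter_diff f vs (x + h) - iter_diff f vs x - iter_diff f (h :: vs) x|
    <= e * `|h| * \prod_(w <- vs) `|w|.
Proof.
move=> oU K0 + Ux e0; elim: k W f => [|k IH] W f hf.
  case: (hf) => h1 _; have := h1 x Ux _ e0; apply: filterS => h hh vs /size0nil -> /=.
  by rewrite big_nil mulr1 diff_D//; exact: h1.
case: (hf) => h1 h2.
have h3 : DSm k.+1 K U (D f) by case/SmE: h2.
near=> h; case/lastP => [//|vs v]; rewrite size_rcons => -[sv].
have Uh : U (x + h) by near: h; exact: open_shift.
have hf' : DSm k.+1 K U f by apply: DSm_leq hf.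
have hf'' : DSm (size (h :: vs)).+1 K U f by rewrite /= sv.
rewrite -rcons_cons !(@iter_diff_D _ _ _ K U)// ?sv//.
rewrite -blin_opp -blin_add -blin_opp -blin_add (le_trans (blin_ub _ _))//.
rewrite big_rcons /= mulrC [_ * `|v|]mulrC mulrCA ler_wpM2l//.
by move: vs sv {hf''}; near: h; exact: IH.
Unshelve. all: by end_near. Qed.

Lemma multi_norm_le V W k (T : seq V -> W) (C : R) :
  (forall vs, size vs = k -> (forall v, v \in vs -> `|v| <= 1) -> `|T vs| <= C) ->
  (multi_norm k T <= C%:E)%E.
Proof.
move=> h; apply: ge_ereal_sup => _ [vs [sv nv] <-]; rewrite lee_fin; exact: h.
Qed.

Lemma prod_le1 V (vs : seq V) : (forall v, v \in vs -> `|v| <= 1) -> \prod_(w <- vs) `|w| <= 1.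
Proof.
elim: vs => [|v vs IH] h; first by rewrite big_nil.
rewrite big_cons mulr_ile1//; first exact: prodr_ge0.
  by apply: h; rewrite mem_head.
by apply: IH => w wv; apply: h; rewrite in_cons wv orbT.
Qed.

Lemma diff_norm_le V W k K (U : set V) (f : V -> W) x : open U -> 0 <= K ->
  DSm k.+1 K U f -> U x -> (diff_norm f k.+1 x <= K%:E)%E.
Proof.
move=> oU K0 hf Ux; apply: multi_norm_le => -[//|v vs] [sv] nv.
have hs : DSm (size vs + 0).+1 K U f by rewrite addn0 sv.
apply: (le_trans (Sm_bound (DSm_iter_cons v oU K0 hs) Ux)).
by rewrite ler_piMl// prod_le1.
Qed.

Lemma smooth_onP V W (U : set V) (f : V -> W) : open U ->
  (forall k x, U x -> exists K U', [/\ 0 <= K, open U', U' x & DSm k K U' f]) ->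
  smooth_on U f.
Proof.
move=> oU h; split=> // k x Ux; split.
  case: k => [|k].
    apply: (@le_lt_trans _ _ `|f x|%:E); last by rewrite ltry.
    by apply: multi_norm_le => vs /size0nil ->.
  have [K [U' [K0 oU' U'x hf]]] := h k.+1 x Ux.
  by apply: (le_lt_trans (diff_norm_le oU' K0 hf U'x)); rewrite ltry.
move=> e e0; have [K [U' [K0 oU' U'x hf]]] := h k.+1 x Ux.
have := iter_diff_taylor oU' K0 hf U'x e0; apply: filterS => w hw.
apply: multi_norm_le => vs sv nv; apply: (le_trans (hw vs sv)).
by rewrite ler_piMr// ?prod_le1// mulr_ge0// ltW.
Qed.

Lemma iter_diff_add V W vs K1 K2 (U : set V) (f g : V -> W) : open U -> 0 <= K1 -> 0 <= K2 ->
  DSm (size vs) K1 U f -> DSm (size vs) K2 U g ->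
  forall x, U x -> iter_diff (fun y => f y + g y) vs x = iter_diff f vs x + iter_diff g vs x.
Proof.
move=> oU K10 K20; elim: vs => [//|v vs IH] hf hg x Ux.
rewrite !iter_diff_cons.
have IH' := IH (DSm_leq (leqnSn _) hf) (DSm_leq (leqnSn _) hg).
have [h1 _] : DSm 1 (\prod_(w <- vs) `|w| * K1) U (iter_diff f vs).
  by apply: DSm_iter; rewrite ?addn1.
have [h1' _] : DSm 1 (\prod_(w <- vs) `|w| * K2) U (iter_diff g vs).
  by apply: DSm_iter; rewrite ?addn1.
have hd : hasd (iter_diff (fun y => f y + g y) vs) x
    (D (iter_diff f vs) x + D (iter_diff g vs) x).
  apply: (@hasd_near _ _ _ (fun y => iter_diff f vs y + iter_diff g vs y)).
  - by rewrite IH'.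
  - by near=> h; rewrite IH'//; near: h; exact: open_shift.
  - by apply: hasd_add; [exact: h1|exact: h1'].
apply: (etrans (hasd_diff v hd)); by rewrite blin_add; congr (_ + _); apply: esym; apply: hasd_diff; [exact: h1|exact: h1'].
Unshelve. all: by end_near. Qed.

(** Two explicit final directions express an order of at least two. This is why the affine part of
    the normal projection drops out of its higher differentials. *)
Lemma iter_diff_affine V W (A : blin V W) c v w vs x :
  iter_diff (fun y => A y + c) (rcons (rcons vs v) w) x = 0.
Proof.
have hA y : hasd (fun y => A y + c) y A.
  by rewrite -[A]addr0; apply: hasd_add; [rewrite addr0; exact: hasd_lin|exact: hasd_cst].
rewrite iter_diff_rcons (_ : (fun x => _) = cst (A w)); last first.
  by apply/funext => y; rewrite (hasd_diff _ (hA y)).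
have hc (c0 : W) : (fun y : V => 'd (cst c0) y v) = cst 0.
  by apply/funext => y; rewrite (hasd_diff _ (@hasd_cst _ _ _ c0 y)).
rewrite iter_diff_rcons hc.
elim: vs x => [|u vs IH] x //=.
rewrite (_ : iter_diff _ vs = cst 0); last by apply/funext => y; exact: IH.
by rewrite (hasd_diff _ (@hasd_cst _ _ _ 0 x)).
Qed.

End Bridge.

(** * Cutoff functions and inner products *)

Section Bump.
Context {R : realType}.

Definition id_real : blin R R := mkblin (fun x : R => x).

Lemma id_realE (h : R) : id_real h = h.
Proof. by apply: (@mkblinE _ _ _ (fun x : R => x)); split=> //; exists 1 => u; rewrite mul1r. Qed.

Lemma id_real_norm : `|id_real| <= 1.
Proof. by apply: blin_lub => // v; rewrite id_realE mul1r. Qed.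

Lemma scale_id_realE (c h : R) : (c *: id_real) h = c * h.
Proof. by rewrite [LHS]blin_scale id_realE. Qed.

Lemma is_derive_hasd (f : R -> R) (x c : R) : is_derive x 1 f c -> hasd f x (c *: id_real).
Proof.
move=> [df dv] e e0.
have /eqaddoP /(_ _ e0) := derivable_nbhs df.
apply: filterS => h.
have -> : ((fun h0 : R => (f \o shift x) h0%:A) - (cst (f x) +  *:%R^~ ('D_1 f x))) h =
  f (x + h) - f x - (c *: id_real) h => //.
rewrite scale_id_realE -dv mulrC -addrA -opprD.
by congr (f _ - _); rewrite /GRing.scale /= mulr1 addrC.
Qed.

(** The flat function exp(-1/x) divided by [x ^+ m]. The family is closed under differentiation, the
    derivative of [theta m] being [theta m.+2] minus [m] times [theta m.+1], so all orders are
    treated at once. *)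
Definition theta (m : nat) (x : R) : R :=
  if 0 < x then x^-1 ^+ m * expR (- x^-1) else 0.

(** With y = 1/x, the exponential series gives exp(y) >= y^m / m!. *)
Lemma theta_bound m x : `|theta m x| <= m`!%:R.
Proof.
rewrite /theta; case: ifPn => [x0|_]; last by rewrite normr0.
have y0 : 0 <= x^-1 by rewrite invr_ge0 ltW.
rewrite ger0_norm ?mulr_ge0 ?exprn_ge0 ?expR_ge0// expRN ler_pdivrMr ?expR_gt0//.
case: m => [|m]; first by rewrite expr0 fact0 mul1r -expR0 ler_expR.
have := expR_ge1Dxn m y0; have : (0 : R) < (m.+1)`!%:R by rewrite ltr0n fact_gt0.
move=> f0 h; rewrite mulrC -ler_pdivrMr//.
by apply: le_trans h; rewrite lerDr.
Qed.

Lemma theta_derive m x : x != 0 ->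
  hasd (theta m) x ((theta m.+2 x - m%:R * theta m.+1 x) *: id_real).
Proof.
move=> x0; have [xlt|xgt|/eqP] := ltrgtP x 0; last by rewrite (negbTE x0).
  have t0 k y : y < 0 -> theta k y = 0 by move=> y0; rewrite /theta ltNge ltW.
  have -> : (theta m.+2 x - m%:R * theta m.+1 x) *: id_real = 0.
    by rewrite !t0// mulr0 subrr scale0r.
  apply: (@hasd_near _ _ _ (fun _ => 0)); last exact: hasd_cst.
    by rewrite t0.
  near=> h; rewrite t0//; near: h.
  by apply: (@open_shift _ _ [set y : R | y < 0]) => //; exact: open_lt.
have -> : theta m.+2 x - m%:R * theta m.+1 x =
   x^-1 ^+ m * (expR (- x^-1) * x ^- 2) + expR (- x^-1) * (m%:R * x^-1 ^+ m.-1 * (- x ^- 2)).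
  rewrite /theta xgt; by rewrite -!exprVn; case: m => [|m] /=; rewrite !exprS ?expr0; ring.
apply: (@hasd_near R R R (fun y : R => y^-1 ^+ m * expR (- y^-1) : R)).
- by rewrite /theta xgt.
- near=> h; rewrite /theta ifT//; near: h.
  by apply: (@open_shift _ _ [set y : R | 0 < y]) => //; exact: open_gt.
apply: is_derive_hasd.
have dV : is_derive x 1 (fun y : R => y^-1) (- x ^- 2 *: 1).
  by apply: (@is_deriveV _ id) => //; exact: is_derive_id.
have dN := is_deriveN dV.
have dX := is_deriveX m dV.
have dE := @is_derive1_comp R expR (- [eta GRing.inv]) x _ _ (is_derive_expR (- x^-1)) dN.
have := is_deriveM dX dE.
rewrite (_ : _ * (expR \o _) = fun y : R => y^-1 ^+ m * expR (- y^-1)); last first.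
  by apply/funext => y; rewrite exprfctE.
move=> h; apply: (is_derive_eq h).
rewrite exprfctE /GRing.scale /= !mulr1 opprK.
by congr (_ + _); rewrite mulrA.
Unshelve. all: by end_near. Qed.

(** [theta m h] is [h * h] times the bounded quantity [theta m.+2 h], hence o(h). *)
Lemma theta_derive0 m : hasd (theta m) 0 0.
Proof.
move=> e e0.
have f0 : (0 : R) < (m.+2)`!%:R by rewrite ltr0n fact_gt0.
have d0 : 0 < e / (m.+2)`!%:R by rewrite divr_gt0.
near=> h; rewrite add0r blin_zero subr0 [theta m 0]/theta ltxx subr0.
have [h0|h0] := ltP 0 h; last by rewrite /theta ltNge h0 normr0 mulr_ge0// ltW.
have -> : theta m h = h * h * theta m.+2 h.
  by rewrite /theta h0 !exprS; field; rewrite gt_eqF.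
rewrite !normrM -mulrA mulrC ler_wpM2r//.
apply: (@le_trans _ _ (e / (m.+2)`!%:R * (m.+2)`!%:R)); last by rewrite divfK ?gt_eqF.
rewrite ler_pM ?theta_bound//; near: h; exact: nbhs0_le.
Unshelve. all: by end_near. Qed.

Lemma theta_hasd m x : hasd (theta m) x ((theta m.+2 x - m%:R * theta m.+1 x) *: id_real).
Proof.
have [->|x0] := eqVneq x 0; last exact: theta_derive.
have -> : (theta m.+2 0 - m%:R * theta m.+1 0) *: id_real = 0.
  by rewrite /theta ltxx mulr0 subrr scale0r.
exact: theta_derive0.
Qed.

Lemma bounded_linear_scale (W : normedModType R) (c : R) : bounded_linear (fun x : W => c *: x).
Proof.
split; last by exists `|c| => v; rewrite normrZ.
by move=> a u v; rewrite scalerDr !scalerA mulrC.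
Qed.

Lemma bounded_linear_line (W : normedModType R) (w : W) : bounded_linear (fun x : R => x *: w).
Proof.
split; last by exists `|w| => v; rewrite normrZ mulrC.
by move=> a u v; rewrite scalerDl scalerA.
Qed.

Lemma Sm_scale (V W : normedModType R) k K (U : set V) (c : R) (f : V -> W) :
  open U -> 0 <= K -> Sm k K U f -> Sm k (`|c| * K) U (fun x => c *: f x).
Proof.
move=> oU K0 hf; have bc := bounded_linear_scale W c.
have nc : `|mkblin (fun x : W => c *: x)| <= `|c|.
  by apply: blin_lub => // v; rewrite mkblinE// normrZ.
apply: (@Sm_ext _ _ _ _ _ _ (fun x => mkblin (fun x : W => c *: x) (f x))) => //.
  by move=> y _; rewrite mkblinE.
by apply: Sm_le (Sm_lin _ oU K0 hf); rewrite ler_wpM2r.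
Qed.

Lemma Sm_line (V W : normedModType R) k K (U : set V) (w : W) (f : V -> R) :
  open U -> 0 <= K -> Sm k K U f -> Sm k (`|w| * K) U (fun x => f x *: w).
Proof.
move=> oU K0 hf; have bc := bounded_linear_line w.
have nc : `|mkblin (fun x : R => x *: w)| <= `|w|.
  by apply: blin_lub => // v; rewrite mkblinE// normrZ mulrC.
apply: (@Sm_ext _ _ _ _ _ _ (fun x => mkblin (fun x : R => x *: w) (f x))) => //.
  by move=> y _; rewrite mkblinE.
by apply: Sm_le (Sm_lin _ oU K0 hf); rewrite ler_wpM2r.
Qed.

Fixpoint theta_const (k m : nat) : R :=
  if k is k'.+1 then m`!%:R + (theta_const k' m.+2 + m%:R * theta_const k' m.+1) else m`!%:R.

Lemma theta_const_ge0 k m : 0 <= theta_const k m.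
Proof. by elim: k m => [//|k IH] m /=; rewrite !addr_ge0// mulr_ge0. Qed.

Lemma theta_Sm k m : Sm k (theta_const k m) setT (theta m).
Proof.
have oT := @openT R.
elim: k m => [|k IH] m; first by move=> x _; exact: theta_bound.
have c0 := theta_const_ge0 k.
apply: (@Sm_intro R R k R _ _ _ (fun x => (theta m.+2 x - m%:R * theta m.+1 x) *: id_real)) => //.
- by move=> x _; rewrite (le_trans (theta_bound _ _))//= lerDl addr_ge0// mulr_ge0.
- by move=> x _; exact: theta_hasd.
- have h : Sm k (theta_const k m.+2 + m%:R * theta_const k m.+1) setT
      (fun x => theta m.+2 x - m%:R * theta m.+1 x).
    have := Sm_scale (- m%:R) oT (c0 m.+1) (IH m.+1).
    rewrite normrN normr_nat => h; have := Sm_add oT (IH m.+2) h.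
    by apply: Sm_ext => // y _; rewrite scaleNr.
  have := @Sm_line _ _ _ _ _ id_real _ oT _ h.
  rewrite addr_ge0 ?mulr_ge0// => /(_ isT); apply: Sm_le.
  rewrite [leRHS]/= -[leLHS]addr0 addrC lerD// ?ler0n//.
  by rewrite ler_piMl// ?id_real_norm// addr_ge0// mulr_ge0.
Qed.

(** A smooth transition obtained by composing [theta 0] with itself: no quotient of functions has to
    be differentiated, only a constant is divided out. *)
Definition step (s : R) : R := (theta 0 (theta 0 1))^-1 * theta 0 (theta 0 1 - theta 0 s).

Lemma theta1_gt0 : 0 < theta 0 1.
Proof. by rewrite /theta ltr01 expr0 mul1r expR_gt0. Qed.

Lemma step_le0 s : s <= 0 -> step s = 1.
Proof.
move=> s0; rewrite /step [theta 0 s]/theta ltNge s0 subr0 mulVf// gt_eqF//.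
by rewrite {1}/theta theta1_gt0 expr0 mul1r expR_gt0.
Qed.

Lemma step_ge1 s : 1 <= s -> step s = 0.
Proof.
move=> s1; have s0 : 0 < s by apply: lt_le_trans s1.
rewrite /step [theta 0 (_ - _)]/theta ifF ?mulr0//; apply/negbTE; rewrite -leNgt subr_le0.
rewrite /theta ltr01 s0 !expr0 !mul1r ler_expR lerN2 invr1 invf_le1//.
Qed.

Lemma step_Sm k : exists2 K, 0 <= K & Sm k K setT step.
Proof.
have oT := @openT R.
have c0 := theta_const_ge0 k 0.
have h : Sm k (`|theta 0 1| + theta_const k 0) setT (fun s => theta 0 1 - theta 0 s).
  by apply: Sm_add => //; [exact: Sm_cst|apply: Sm_opp => //; exact: theta_Sm].
have [_ h'] := (SmE _ _ _ _).1 h.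
have k0 : 0 <= `|theta 0 1| + theta_const k 0 by rewrite addr_ge0.
have h2 := Sm_comp oT c0 k0 (fun _ _ => I) (theta_Sm k 0) h'.
have b0 := comp_bound_ge0 k c0 k0.
exists (`|(theta 0 (theta 0 1))^-1| * comp_bound k (theta_const k 0) (`|theta 0 1| + theta_const k 0)).
  by rewrite mulr_ge0.
exact: (@Sm_scale _ _ _ _ _ _ (fun s => theta 0 (theta 0 1 - theta 0 s)) oT b0 h2).
Qed.

End Bump.

Section DotProduct.
Context {R : realType} {E : normedModType R} (dotp : {dot E for idfun}).
Hypothesis dotpE : forall x : E, dotp x x = `|x| ^+ 2.

Lemma dotpC x y : dotp x y = dotp y x.
Proof. by rewrite hermC expr0 mul1r. Qed.

Lemma dotpDl x y z : dotp (x + y) z = dotp x z + dotp y z.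
Proof. exact: linearDl. Qed.

Lemma dotpDr x y z : dotp z (x + y) = dotp z x + dotp z y.
Proof. by rewrite dotpC dotpDl ![dotp z _]dotpC. Qed.

Lemma dotpZl a x z : dotp (a *: x) z = a * dotp x z.
Proof. exact: linearZl_LR. Qed.

Lemma dotpZr a x z : dotp z (a *: x) = a * dotp z x.
Proof. by rewrite dotpC dotpZl [dotp z _]dotpC. Qed.

Lemma dotpNl x z : dotp (- x) z = - dotp x z.
Proof. by rewrite -scaleN1r dotpZl mulN1r. Qed.

Lemma dotpNr x z : dotp z (- x) = - dotp z x.
Proof. by rewrite dotpC dotpNl [dotp z _]dotpC. Qed.

Lemma dotpBl x y z : dotp (x - y) z = dotp x z - dotp y z.
Proof. by rewrite dotpDl dotpNl. Qed.

Lemma dotpBr x y z : dotp z (x - y) = dotp z x - dotp z y.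
Proof. by rewrite dotpDr dotpNr. Qed.

Lemma dotp0l z : dotp 0 z = 0.
Proof. by rewrite -(scale0r 0) dotpZl mul0r. Qed.

Lemma dotp0r z : dotp z 0 = 0.
Proof. by rewrite dotpC dotp0l. Qed.

Lemma normD_sqr x y : `|x + y| ^+ 2 = `|x| ^+ 2 + 2 * dotp x y + `|y| ^+ 2.
Proof. by rewrite -!dotpE dotpDl !dotpDr [dotp y x]dotpC; ring. Qed.

Lemma dotp_le x y : `|dotp x y| <= `|x| * `|y|.
Proof.
have [->|y0] := eqVneq y 0; first by rewrite dotp0r !normr0 mulr0.
have ny : 0 < `|y| by rewrite normr_gt0.
have h : 0 <= `|(`|y| ^+ 2) *: x - dotp x y *: y| ^+ 2 by rewrite exprn_ge0.
rewrite -dotpE dotpBl !dotpBr !dotpZl !dotpZr !dotpE [dotp y x]dotpC in h.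
have {}h : dotp x y ^+ 2 <= (`|x| * `|y|) ^+ 2.
  rewrite -(@ler_pM2l _ (`|y| ^+ 2)) ?exprn_gt0// -subr_ge0; move: h; congr (0 <= _).
  by ring.
rewrite -(@ler_pXn2r _ 2) ?nnegrE ?mulr_ge0//.
by rewrite real_normK ?num_real.
Qed.

Lemma dotp_bilin : bilin (fun x y : E => dotp x y : R) 1.
Proof.
split; last by move=> x y; rewrite mul1r dotp_le.
- by move=> y a u v; rewrite dotpDl dotpZl.
- by move=> x a u v; rewrite dotpDr dotpZr.
Qed.

(** The squared norm [dotp z z] is used because, unlike the norm, it is smooth at 0 as well. *)
Definition bump (a b : R) (z : E) : R := step ((dotp z z - a ^+ 2) / (b ^+ 2 - a ^+ 2)).

Lemma bump_in a b z : 0 <= a -> a < b -> `|z| <= a -> bump a b z = 1.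
Proof.
move=> a0 ab za; apply: step_le0.
rewrite pmulr_lle0 ?invr_gt0 ?subr_gt0 ?subr_le0 ?dotpE ?ler_pXn2r ?ltr_pXn2r ?nnegrE//.
by apply: le_trans a0 (ltW ab).
Qed.

Lemma bump_out a b z : 0 <= a -> a < b -> b <= `|z| -> bump a b z = 0.
Proof.
move=> a0 ab za; apply: step_ge1; have b0 : 0 <= b by apply: le_trans a0 (ltW ab).
rewrite ler_pdivlMr ?mul1r ?lerD2r ?subr_gt0 ?dotpE ?ler_pXn2r ?ltr_pXn2r ?nnegrE//.
Qed.

End DotProduct.

Lemma DSm_sub {R : realType} (V W : normedModType R) k K (U U' : set V) (f : V -> W) :
  U' `<=` U -> DSm k K U f -> DSm k K U' f.
Proof.
case: k => [//|k] UU [h1 h2]; split; first by move=> x /UU; exact: h1.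
exact: Sm_sub h2.
Qed.

(** The bound is fixed before [E]. Since [dotp z z] is unbounded, derivatives are estimated on the
    ball of radius [b + 1]; outside radius [b] the function vanishes, and these two open sets cover
    [E]. *)
Lemma bump_Sm {R : realType} k (a b : R) : 0 <= a -> a < b -> exists2 K, 0 <= K &
  forall (E : completeNormedModType R) (dotp : {dot E for idfun}),
   (forall x : E, dotp x x = `|x| ^+ 2) -> Sm k K setT (bump dotp a b).
Proof.
move=> a0 ab; have b0 : 0 < b by apply: le_lt_trans ab.
have [K K0 hK] := @step_Sm R k.
pose L := 2 ^+ k * (1 * (b + 1) * (b + 1)) : R.
have L0 : 0 <= L by rewrite !mulr_ge0 ?exprn_ge0// addr_ge0// ltW.
pose M := `|(b ^+ 2 - a ^+ 2)^-1| * (L + `|- a ^+ 2|).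
have M0 : 0 <= M by rewrite mulr_ge0// addr_ge0.
exists (comp_bound k K M); first exact: comp_bound_ge0.
move=> E dotp dotpE.
pose U1 := [set z : E | `|z| < b + 1]; pose U2 := [set z : E | b < `|z|].
have oU1 : open U1 by apply: (@open_comp _ _ (fun z : E => `|z|) [set x | x < b + 1]);
  [move=> z _; exact: norm_continuous|exact: open_lt].
have oU2 : open U2 by apply: (@open_comp _ _ (fun z : E => `|z|) [set x | b < x]);
  [move=> z _; exact: norm_continuous|exact: open_gt].
have -> : [set: E] = U1 `|` U2.
  apply/esym; rewrite -subTset => z _ /=; have [zb|zb] := leP `|z| b; [left|right] => //.
  by apply: le_lt_trans zb _; rewrite ltrDl.
apply: Sm_union; last first.
  apply: (@Sm_ext _ _ _ _ _ _ (fun _ => 0)) => //.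
    by move=> y /ltW yb; rewrite bump_out.
  by apply: Sm_cst; rewrite ?normr0//; exact: comp_bound_ge0.
have hid : Sm k (b + 1) U1 (fun z : E => z).
  apply/SmE; split; first by move=> z /ltW.
  apply: (@DSm_ext _ _ _ _ _ _ id_blin) => //; first by move=> z _; rewrite id_blinE.
  apply: (@DSm_sub _ _ _ _ _ setT) => //; apply: DSm_lin.
  by rewrite (le_trans id_blin_norm)// lerDr ltW.
have b1 : 0 <= b + 1 by rewrite addr_ge0// ltW.
have h1 := Sm_bilin oU1 ler01 b1 b1 (dotp_bilin dotpE) hid hid.
have h2 := Sm_add oU1 h1 (Sm_cst k (lexx `|- a ^+ 2|) oU1).
have La : 0 <= L + `|- a ^+ 2| by rewrite addr_ge0.
have h3 := Sm_scale ((b ^+ 2 - a ^+ 2)^-1) oU1 La h2.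
have h4 := Sm_comp oU1 K0 M0 (fun _ _ => I) hK ((SmE _ _ _ _).1 h3).2.
apply: (Sm_ext oU1 _ h4) => y _; by rewrite /bump; congr (step _); rewrite mulrC.
Qed.

(** * Orthogonal projections *)

Section Frames.
Context {R : realType} {E : completeNormedModType R} (dotp : {dot E for idfun}).
Hypothesis dotpE : forall x : E, dotp x x = `|x| ^+ 2.

Definition orthonormal n (e : 'I_n -> E) := forall i j, dotp (e i) (e j) = (i == j)%:R.

Definition proj n (e : 'I_n -> E) (v : E) : E := \sum_i dotp v (e i) *: e i.

Lemma dotp_suml I (r : seq I) (P : pred I) (F : I -> E) v :
  dotp (\sum_(i <- r | P i) F i) v = \sum_(i <- r | P i) dotp (F i) v.
Proof.
by elim/big_rec2: _ => [|i y z _ <-]; [exact: dotp0l|rewrite dotpDl].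
Qed.

Lemma dotp_sumr I (r : seq I) (P : pred I) (F : I -> E) v :
  dotp v (\sum_(i <- r | P i) F i) = \sum_(i <- r | P i) dotp v (F i).
Proof. by rewrite dotpC dotp_suml; apply: eq_bigr => i _; rewrite dotpC. Qed.

Section Projection.
Variables (n : nat) (e : 'I_n -> E).
Hypothesis one : orthonormal e.

Lemma projD u v : proj e (u + v) = proj e u + proj e v.
Proof. by rewrite -big_split /=; apply: eq_bigr => i _; rewrite dotpDl scalerDl. Qed.

Lemma projZ a v : proj e (a *: v) = a *: proj e v.
Proof. by rewrite scaler_sumr; apply: eq_bigr => i _; rewrite dotpZl scalerA. Qed.

Lemma projN v : proj e (- v) = - proj e v.
Proof. by rewrite -scaleN1r projZ scaleN1r. Qed.

Lemma projB u v : proj e (u - v) = proj e u - proj e v.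
Proof. by rewrite projD projN. Qed.

Lemma dotp_span (t : 'I_n -> R) j : dotp (\sum_i t i *: e i) (e j) = t j.
Proof.
rewrite dotp_suml (bigD1 j)//= dotpZl one eqxx mulr1 big1 ?addr0// => i ij.
by rewrite dotpZl one (negbTE ij) mulr0.
Qed.

Lemma dotp_proj_e v j : dotp (proj e v) (e j) = dotp v (e j).
Proof. exact: dotp_span. Qed.

Lemma proj_span (t : 'I_n -> R) : proj e (\sum_i t i *: e i) = \sum_i t i *: e i.
Proof. by apply: eq_bigr => i _; rewrite dotp_span. Qed.

Lemma projK v : proj e (proj e v) = proj e v.
Proof. exact: proj_span. Qed.

Lemma dotp_projC u v : dotp (proj e u) v = dotp u (proj e v).
Proof.
rewrite dotp_suml dotp_sumr; apply: eq_bigr => i _.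
by rewrite dotpZl dotpZr mulrC [dotp (e i) v]dotpC.
Qed.

Lemma dotp_projQ u v : dotp (proj e u) (v - proj e v) = 0.
Proof. by rewrite dotpBr !dotp_projC projK subrr. Qed.

Lemma proj_pyth v : `|v| ^+ 2 = `|proj e v| ^+ 2 + `|v - proj e v| ^+ 2.
Proof.
have {1}-> : v = proj e v + (v - proj e v) by vring R E.
by rewrite (normD_sqr dotpE) dotp_projQ mulr0 addr0.
Qed.

Lemma proj_le v : `|proj e v| <= `|v|.
Proof.
rewrite -(@ler_pXn2r _ 2) ?nnegrE// (proj_pyth v) lerDl exprn_ge0//.
Qed.

Lemma projQ_le v : `|v - proj e v| <= `|v|.
Proof.
rewrite -(@ler_pXn2r _ 2) ?nnegrE// (proj_pyth v) lerDr exprn_ge0//.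
Qed.

Lemma bounded_linear_proj : bounded_linear (proj e).
Proof.
split; first by move=> a u v; rewrite projD projZ.
by exists 1 => v; rewrite mul1r proj_le.
Qed.

Definition projb : blin E E := mkblin (proj e).

Lemma projbE v : projb v = proj e v.
Proof. exact: mkblinE bounded_linear_proj v. Qed.

Lemma projb_norm : `|projb| <= 1.
Proof. by apply: blin_lub => // v; rewrite projbE mul1r proj_le. Qed.

End Projection.

Lemma gram_schmidt n (e : 'I_n -> E) :
  (forall t : 'I_n -> R, \sum_i t i *: e i = 0 -> forall i, t i = 0) ->
  exists2 f : 'I_n -> E, orthonormal f &
    [set \sum_i t i *: e i | t in [set: 'I_n -> R]] =
    [set \sum_i t i *: f i | t in [set: 'I_n -> R]].
Proof.
elim: n e => [|n IH] e ind.
  exists e; [by case|by []].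
have [|f onf spf] := IH (fun i => e (widen_ord (leqnSn n) i)).
  move=> t t0 i.
  (* [insub] extends the coefficients by 0 at the last index, so that independence of [e] applies to
     its first [n] vectors. *)
  pose t' (j : 'I_n.+1) := if insub (j : nat) is Some k then t k else 0.
  have t'w k : t' (widen_ord (leqnSn n) k) = t k by rewrite /t' /= valK.
  have t'm : t' ord_max = 0 by rewrite /t' insubF//= ltnn.
  rewrite -t'w; apply: ind; rewrite big_ord_recr /= t'm scale0r addr0 -[RHS]t0.
  by apply: eq_bigr => k _; rewrite t'w.
pose w := e ord_max - proj f (e ord_max).
have pf v : exists t : 'I_n -> R, proj f v = \sum_i t i *: e (widen_ord (leqnSn n) i).
  have : [set \sum_i t i *: f i | t in [set: 'I_n -> R]] (proj f v).
    by exists (fun i => dotp v (f i)).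
  by rewrite -spf => -[t _ <-]; exists t.
have w0 : w != 0.
  apply/negP => /eqP w0; have [t tE] := pf (e ord_max).
  pose t' (j : 'I_n.+1) := if insub (j : nat) is Some k then - t k else 1.
  have t'w k : t' (widen_ord (leqnSn n) k) = - t k by rewrite /t' /= valK.
  have t'm : t' ord_max = 1 by rewrite /t' insubF//= ltnn.
  have := ind t' _ ord_max; rewrite t'm => h.
  suff /h/eqP : \sum_i t' i *: e i = 0 by rewrite oner_eq0.
  rewrite big_ord_recr /= t'm scale1r -[RHS]w0 /w tE addrC -sumrN; congr (_ + _).
  by apply: eq_bigr => k _; rewrite t'w scaleNr.
have nw : `|w| != 0 by rewrite normr_eq0.
pose g (j : 'I_n.+1) := if insub (j : nat) is Some k then f k else `|w|^-1 *: w.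
have gw k : g (widen_ord (leqnSn n) k) = f k by rewrite /g /= valK.
have gm : g ord_max = `|w|^-1 *: w by rewrite /g insubF//= ltnn.
have wf k : dotp w (f k) = 0 by rewrite dotpBl dotp_proj_e// subrr.
have wgm : `|w| *: g ord_max = w by rewrite gm scalerA mulfV// scale1r.
have ordP (j : 'I_n.+1) : j = ord_max \/ exists k, j = widen_ord (leqnSn n) k.
  have [jn|jn] := ltnP j n; last by left; apply/val_inj/eqP; rewrite eqn_leq jn -ltnS ltn_ord.
  by right; exists (Ordinal jn); apply: val_inj.
have wne k : (widen_ord (leqnSn n) k == ord_max) = false.
  by apply/negbTE; rewrite neq_ltn /= ltn_ord.
exists g.
  move=> i j; case: (ordP i) => [->|[k ->]]; case: (ordP j) => [->|[l ->]].
  - by rewrite eqxx gm dotpZl dotpZr dotpE [RHS](_ : _ = 1)//; field; exact: nw.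
  - by rewrite gm gw dotpZl wf mulr0 eq_sym wne.
  - by rewrite gm gw dotpZr dotpC wf mulr0 wne.
  - by rewrite !gw onf.
apply/seteqP; split=> _ [t _ <-].
  have : [set \sum_i t i *: f i | t in [set: 'I_n -> R]]
      (\sum_i t (widen_ord (leqnSn n) i) *: e (widen_ord (leqnSn n) i)).
    by rewrite -spf; exists (fun i => t (widen_ord (leqnSn n) i)).
  move=> [s _ sE].
  (* The components of [e ord_max] along the [f k] move into the first coefficients; what remains is
     a multiple of [w], that is, of the last new vector. *)
  pose s' (j : 'I_n.+1) := if insub (j : nat) is Some k
     then s k + t ord_max * dotp (e ord_max) (f k) else t ord_max * `|w|.
  have s'w k : s' (widen_ord (leqnSn n) k) = s k + t ord_max * dotp (e ord_max) (f k).
    by rewrite /s' /= valK.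
  have s'm : s' ord_max = t ord_max * `|w| by rewrite /s' insubF//= ltnn.
  exists s' => //; rewrite !big_ord_recr /= s'm -scalerA wgm -sE.
  rewrite (eq_bigr (fun i => s i *: f i + t ord_max *: (dotp (e ord_max) (f i) *: f i))).
    rewrite big_split /= -scaler_sumr -/(proj f _) /w -addrA; congr (_ + _); vring R E.
  by move=> i _; rewrite s'w gw scalerDl scalerA.
have [s sE] := pf (e ord_max).
have : [set \sum_i t i *: e (widen_ord (leqnSn n) i) | t in [set: 'I_n -> R]]
      (\sum_i t (widen_ord (leqnSn n) i) *: f i).
  by rewrite spf; exists (fun i => t (widen_ord (leqnSn n) i)).
move=> [q _ qE]; pose a := t ord_max / `|w|.
pose s' (j : 'I_n.+1) := if insub (j : nat) is Some k then q k - a * s k else a.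
have s'w k : s' (widen_ord (leqnSn n) k) = q k - a * s k by rewrite /s' /= valK.
have s'm : s' ord_max = a by rewrite /s' insubF//= ltnn.
exists s' => //; rewrite !big_ord_recr /= s'm gm scalerA -/a.
under [in RHS]eq_bigr => i _ do rewrite gw.
rewrite -qE (eq_bigr (fun i => q i *: e (widen_ord (leqnSn n) i) -
   a *: (s i *: e (widen_ord (leqnSn n) i)))).
  rewrite sumrB -scaler_sumr -sE /w -addrA; congr (_ + _); vring R E.
by move=> i _; rewrite s'w scalerBl scalerA.
Qed.

End Frames.

(** * Packing and separated sets *)

Section MeanValue.
Context {R : realType}.

Lemma hasd_is_derive (f : R -> R) (x : R) (A : blin R R) : hasd f x A -> is_derive x 1 f (A 1).
Proof.
move=> hA; have df := hasd_differentiable hA.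
apply: DeriveDef; first exact/derivable1_diffP.
by rewrite deriveE// (hasd_diff _ hA).
Qed.

(** The scalar mean value theorem is applied to the inner product of [f (x + t *: h)] with the total
    increment [w]; the increment of that function is the square of the norm of [w]. *)
Lemma hasd_mean_value (V E : normedModType R) (dotp : {dot E for idfun})
    (f : V -> E) (x h : V) (A : R -> blin V E) (C : R) :
  (forall x : E, dotp x x = `|x| ^+ 2) ->
  (forall t, 0 <= t <= 1 -> hasd f (x + t *: h) (A t)) ->
  (forall t, 0 <= t <= 1 -> `|A t h| <= C) ->
  `|f (x + h) - f x| <= C.
Proof.
move=> dotpE hA hC; set w := f (x + h) - f x.
pose phi (t : R) : R := dotp (f (x + t *: h)) w.
have bl : bounded_linear (fun v : E => dotp v w : R).
  split; first by move=> a u v; rewrite dotpDl dotpZl.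
  by exists `|w| => v; rewrite mulrC [`|v| * _]mulrC mulrC dotp_le.
have bh := bounded_linear_line h.
have dphi (t : R) : 0 <= t <= 1 -> is_derive t 1 phi (dotp (A t h) w).
  move=> t01.
  have h1 : hasd (fun t : R => x + t *: h) t (mkblin (fun t : R => t *: h)).
    rewrite -[mkblin _]add0r; apply: hasd_add; first exact: hasd_cst.
    apply: (@hasd_near _ _ _ (mkblin (fun t : R => t *: h))); last exact: hasd_lin.
      by rewrite mkblinE.
    by near=> k; rewrite mkblinE.
  have h2 := @hasd_comp R R V E f (fun t : R => x + t *: h) t _ _ (hA t t01) h1.
  have h3 := @hasd_comp R R E R (mkblin (fun v : E => dotp v w : R)) _ t _ _ (hasd_lin _ _) h2.
  have h4 : hasd phi t (bcomp (mkblin (fun v : E => dotp v w : R))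
       (bcomp (A t) (mkblin (fun t : R => t *: h)))).
    apply: hasd_near h3; first by rewrite /= mkblinE.
    by near=> k; rewrite /= mkblinE.
  have := hasd_is_derive h4.
  by rewrite !bcompE mkblinE// (@mkblinE _ _ _ _ bh) scale1r.
have [||t t01] := @MVT R phi (fun t => dotp (A t h) w) 0 1 ltr01.
- by move=> t /[!in_itv]/= /andP[t0 t1]; apply: dphi; rewrite !ltW.
- apply: derivable_within_continuous => t; rewrite in_itv/= => t01.
  by have [] := dphi t t01.
rewrite /phi scale1r scale0r addr0 subr0 mulr1 -dotpBl -/w dotpE => wE.
have C0 : 0 <= C.
  by apply: le_trans (hC 0 _); rewrite ?lexx ?ler01// normr_ge0.
have [->|w0] := eqVneq w 0; first by rewrite normr0.
have nw : 0 < `|w| by rewrite normr_gt0.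
rewrite -(@ler_pM2r _ `|w|)// -expr2 wE (le_trans (ler_norm _))// (le_trans (dotp_le dotpE _ _))//.
rewrite ler_wpM2r// hC//.
by move: t01; rewrite in_itv/= => /andP[/ltW -> /ltW ->].
Unshelve. all: by end_near. Qed.

End MeanValue.

Section Packing.
Context {R : realType}.

(** Pigeonhole on the [n] coordinates of the projection to the plane, not on the ambient space; this
    makes [N] depend on [n] alone. *)
Lemma packing n : exists N : nat, forall (E : completeNormedModType R) (dotp : {dot E for idfun})
    (e : 'I_n -> E) (c : E) (p : 'I_N -> E),
  (forall x : E, dotp x x = `|x| ^+ 2) -> orthonormal dotp e ->
  (forall i, `|p i - c| <= 1) ->
  ~ (forall i j, i != j -> 100^-1 <= `|proj dotp e (p i - p j)|).
Proof.
(* Two points in the same cell of side [1 / m] differ by less than [1 / m] in each coordinate, hence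
   by at most [n / m < 1 / 100] after projection. Coordinates lie in [-1, 1], so there are
   [2 * m + 1] possible integer parts. *)
pose m := (100 * n).+1.
exists #|{ffun 'I_n -> 'I_(2 * m).+1}|.+1 => E dotp e c p dotpE one pc sep.
pose a i k : R := (dotp (p i - c) (e k) + 1) * m%:R.
have ne k : `|e k| = 1.
  by apply/eqP; rewrite -(@eqrXn2 _ 2)// ?expr1n -?dotpE ?one ?eqxx.
have m0 : 0 < m%:R :> R by rewrite ltr0n.
have a_ge i k : 0 <= a i k.
  have := dotp_le dotpE (p i - c) (e k); rewrite ne mulr1 => /le_trans /(_ (pc i)).
  rewrite ler_norml => /andP[h _]; rewrite /a mulr_ge0 ?(ltW m0)//; lra.
have a_le i k : a i k <= (2 * m)%:R.
  rewrite natrM ler_wpM2r ?(ltW m0)//.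
  have := dotp_le dotpE (p i - c) (e k); rewrite ne mulr1 => /le_trans /(_ (pc i)).
  by rewrite ler_norml => /andP[_]; lra.
have ib i k : (Num.truncn (a i k) < (2 * m).+1)%N.
  rewrite ltnS -(@ler_nat R); have /andP[+ _] := truncn_itv (a_ge i k).
  by move/le_trans; apply.
pose F i := [ffun k => Ordinal (ib i k)].
suff inj : injective F.
  by have := leq_card F inj; rewrite card_ord ltnn.
move=> i j Fij; apply: contraPeq sep => ij /(_ i j ij); apply/negP; rewrite -ltNge.
have cl k : `|dotp (p i - p j) (e k)| < m%:R^-1.
  have /(congr1 val) /= tij : F i k = F j k by rewrite Fij.
  rewrite !ffunE /= in tij.
  have /andP[i1 i2] := truncn_itv (a_ge i k); have /andP[j1 j2] := truncn_itv (a_ge j k).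
  rewrite -[_^-1]mul1r ltr_pdivlMr// -[X in _ * X]gtr0_norm// -normrM.
  have -> : dotp (p i - p j) (e k) * m%:R = a i k - a j k.
    rewrite /a; have -> : p i - p j = (p i - c) - (p j - c) by vring R E.
    by rewrite dotpBl; ring.
  move: i1 i2 j1 j2; rewrite tij -!natr1 => *; rewrite ltr_norml; lra.
apply: (@le_lt_trans _ _ (\sum_(k < n) m%:R^-1)).
  rewrite (le_trans (ler_norm_sum _ _ _))//; apply: ler_sum => k _.
  by rewrite normrZ ne mulr1 ltW.
have -> : \sum_(k < n) m%:R^-1 = n%:R / m%:R :> R by rewrite sumr_const card_ord mulr_natl.
by rewrite ltr_pdivrMr// ltr_pdivlMl// -natrM ltr_nat.
Qed.

End Packing.

Section Separated.
Context {R : realType} {E : normedModType R}.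

Definition separated_by (r : R) (A : set E) :=
  forall x y, A x -> A y -> x <> y -> r <= `|x - y|.

(** By Zorn's lemma: a point of [S] at distance at least [r] from a maximal family could be added to
    it. *)
Lemma max_separated (S : set E) (r : R) : 0 < r -> exists A, [/\ A `<=` S, separated_by r A &
  forall s, S s -> exists2 t, A t & `|s - t| < r].
Proof.
move=> r0.
have [|A [[AS sA] maxA]] := @Zorn_bigcup E [set A | A `<=` S /\ separated_by r A].
  move=> F FP tot; split; first by move=> x [A FA Ax]; exact: (FP A FA).1.
  move=> x y [A FA Ax] [B FB By]; have [AB|BA] := tot A B FA FB.
    by apply: (FP B FB).2 => //; exact: AB.
  by apply: (FP A FA).2 => //; exact: BA.
exists A; split=> // s Ss; apply: contrapT => h.
have far t : A t -> r <= `|s - t|.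
  by move=> At; rewrite leNgt; apply/negP => st; apply: h; exists t.
apply: (maxA (A `|` [set s])).
  split; first by move=> x; left.
  move=> /(_ s (or_intror erefl)) /far; rewrite subrr normr0 leNgt r0//.
split; first by move=> x [/AS|->].
move=> x y [Ax|->] [Ay|->] xy //.
- exact: sA.
- by rewrite distrC; exact: far.
- exact: far.
Qed.

(* Maximal [D]-separated subsets of what the previous classes leave uncovered. *)
Lemma separated_classes (S : set E) (D rho : R) : 0 < D ->
  exists C : nat -> set E, [/\ forall c, C c `<=` S, forall c, separated_by D (C c) &
    forall c s, S s ->
     (exists c', (c' < c)%N /\ exists2 y, C c' y & `|s - y| < rho) \/
     (exists t, [/\ C c t, `|s - t| < D & forall c' y, (c' < c)%N -> C c' y -> rho <= `|t - y|])].
Proof.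
move=> D0.
have /choice[M hM] : forall B : set E, exists A, [/\ A `<=` [set s | S s /\ forall y, B y -> rho <= `|s - y|],
   separated_by D A & forall s, S s -> (forall y, B y -> rho <= `|s - y|) -> exists2 t, A t & `|s - t| < D].
  move=> B; have [A [h1 h2 h3]] := max_separated [set s | S s /\ forall y, B y -> rho <= `|s - y|] D0.
  by exists A; split=> // s Ss hs; apply: h3.
pose B := fix B c := if c is c'.+1 then B c' `|` M (B c') else set0.
have BP c y : B c y <-> exists c', (c' < c)%N /\ M (B c') y.
  elim: c => [|c IH]; first by split=> [//|[c' []]].
  split=> [[/IH[c' [cc h]]|h]|[c' [cc h]]].
  - by exists c'; split=> //; exact: ltnW.
  - by exists c.
  - by move: cc; rewrite ltnS leq_eqVlt => /predU1P[<-|cc]; [right|left; apply/IH; exists c'].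
exists (fun c => M (B c)); split.
- by move=> c s; case: (hM (B c)) => h _ _ /h[].
- by move=> c; case: (hM (B c)).
- move=> c s Ss; have [hs|hs] := pselect (forall y, B c y -> rho <= `|s - y|).
    right; case: (hM (B c)) => h1 _ /(_ s Ss hs)[t At st]; exists t; split=> //.
    by move=> c' y cc hy; have [_] := h1 t At; apply; apply/BP; exists c'.
  left; move/existsNP: hs => [y /not_implyP[/BP[c' [cc hy]] /negP]].
  by rewrite -ltNge => ys; exists c'; split=> //; exists y.
Qed.

End Separated.

(** * Pushing a plane towards neighbouring planes *)

Section SmoothProducts.
Context {R : realType}.

Lemma scale_bilin (W : normedModType R) : bilin (fun (a : R) (v : W) => a *: v) 1.
Proof.
split; last by move=> a v; rewrite normrZ mul1r.
- by move=> v a b c; rewrite scalerDl scalerA.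
- by move=> a b u v; rewrite scalerDr !scalerA mulrC.
Qed.

(** Where [g] is not controlled the cutoff vanishes identically on an open set, so the product and
    its derivatives are 0 there. *)
Lemma Sm_cutoff (V W : normedModType R) k (K1 K2 : R) (U1 U2 : set V) (f : V -> R) (g : V -> W) :
  open U1 -> open U2 -> U1 `|` U2 = setT -> 0 <= K1 -> 0 <= K2 ->
  Sm k K1 setT f -> Sm k K2 U1 g -> (forall x, U2 x -> f x = 0) ->
  Sm k (2 ^+ k * (1 * K1 * K2)) setT (fun x => f x *: g x).
Proof.
move=> oU1 oU2 UT K10 K20 hf hg f0; rewrite -UT; apply: Sm_union.
  apply: Sm_bilin => //; first exact: scale_bilin.
  exact: Sm_sub hf.
apply: (@Sm_ext _ _ _ _ _ _ (fun _ => 0)) => //.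
  by move=> y /f0 ->; rewrite scale0r.
by apply: Sm_cst; rewrite ?normr0 ?mulr_ge0 ?exprn_ge0.
Qed.

Lemma DSm_shift (V W : normedModType R) k K (U : set V) (f : V -> W) (c : W) : open U -> 0 <= K ->
  DSm k K U f -> DSm k K U (fun x => f x + c).
Proof.
move=> oU K0 hf; rewrite -[K]addr0; apply: DSm_add => //.
have := Sm_cst k (lexx `|c|) oU; case: k hf => [//|k] hf [h1 h2 h3]; split=> //.
apply: (@Sm_ext _ _ _ _ _ _ (fun _ => 0)) => //.
  by move=> y _; rewrite (hasdD (@hasd_cst _ _ _ c y)).
by apply: Sm_cst; rewrite ?normr0.
Qed.

Lemma DSm_affine (V W : normedModType R) k K (A : blin V W) (c : W) : `|A| <= K ->
  DSm k K setT (fun x => A x + c).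
Proof.
move=> AK; apply: DSm_shift; [exact: openT|exact: le_trans AK|exact: DSm_lin].
Qed.

End SmoothProducts.

Section AffineFrames.
Context {R : realType} {E : completeNormedModType R} (dotp : {dot E for idfun}) (n : nat).
Hypothesis dotpE : forall x : E, dotp x x = `|x| ^+ 2.

Definition frame : Type := (E * ('I_n -> E))%type.
Implicit Types fr : frame.

Definition aproj fr (z : E) : E := fr.1 + proj dotp fr.2 (z - fr.1).

Definition framed fr := orthonormal dotp fr.2.

Lemma aprojB fr z w : aproj fr z - aproj fr w = proj dotp fr.2 (z - w).
Proof. rewrite /aproj !projB; vring R E. Qed.

Lemma aprojD fr z v : aproj fr (z + v) = aproj fr z + proj dotp fr.2 v.
Proof. by have := aprojB fr (z + v) z; rewrite [z + v]addrC addrK => <-; vring R E. Qed.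

Lemma aproj_lip fr z w : framed fr -> `|aproj fr z - aproj fr w| <= `|z - w|.
Proof. by move=> hf; rewrite aprojB proj_le. Qed.

Lemma aprojK fr z : framed fr -> aproj fr (aproj fr z) = aproj fr z.
Proof. by move=> hf; rewrite {1}/aproj [aproj fr z - _]addrC addKr projK. Qed.

Lemma proj_aproj fr z w : framed fr -> proj dotp fr.2 (aproj fr z - aproj fr w) = aproj fr z - aproj fr w.
Proof. by move=> hf; rewrite aprojB projK. Qed.

Lemma proj_aprojQ fr z : framed fr -> proj dotp fr.2 (z - aproj fr z) = 0.
Proof.
move=> hf; have -> : z - aproj fr z = (z - fr.1) - proj dotp fr.2 (z - fr.1).
  by rewrite /aproj; vring R E.
by rewrite projB projK// subrr.
Qed.

Lemma aproj_dist fr z w : framed fr -> `|aproj fr z - z| <= `|aproj fr w - w| + `|z - w|.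
Proof.
move=> hf; have -> : aproj fr z - z = (aproj fr w - w) - ((z - w) - proj dotp fr.2 (z - w)).
  by rewrite -aprojB; vring R E.
by rewrite (le_trans (ler_normB _ _))// lerD// projQ_le.
Qed.

Lemma aproj_near fr z w : framed fr -> aproj fr w = w -> `|aproj fr z - z| <= `|z - w|.
Proof.
by move=> hf wE; have := aproj_dist z w hf; rewrite wE subrr normr0 add0r.
Qed.

Lemma aprojE fr : framed fr -> aproj fr = fun z => projb dotp fr.2 z + (fr.1 - proj dotp fr.2 fr.1).
Proof. by move=> hf; apply/funext => z; rewrite /aproj projbE// projB; vring R E. Qed.

Lemma DSm_aproj k fr : framed fr -> DSm k 1 setT (aproj fr).
Proof. by move=> hf; rewrite aprojE//; apply: DSm_affine; exact: projb_norm. Qed.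

Lemma hasd_aproj fr z : framed fr -> hasd (aproj fr) z (projb dotp fr.2).
Proof.
move=> hf; rewrite aprojE//; rewrite -[projb _ _]addr0; apply: hasd_add; last exact: hasd_cst.
by rewrite addr0; exact: hasd_lin.
Qed.

Lemma dist_aproj_continuous fr x : framed fr -> continuous (fun z => `|aproj fr z - x|).
Proof.
move=> hf z; apply: cvg_norm; apply: cvgB; last exact: cvg_cst.
exact: hasd_continuous (hasd_aproj z hf).
Qed.

Definition chi (fr : frame) (x : E) (a b : R) (z : E) : R := bump dotp a b (aproj fr z - x).

(* The factor [d^-1] makes this bounded, because the planes of [fr] and [fri] are [O(d)]-close. *)
Definition stage_shift (fr fri : frame) (d : R) (z : E) : E :=
  d^-1 *: (aproj fri (aproj fr z) - aproj fr z).

(** Let b be [aproj fr z + d *: u z]. Where [chi] is 1, the displacement from b to its projection on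
    the plane of [fri] is [d] times the bracket, because the projection is affine; so the new [u] is
    again a displacement divided by [d]. The factor [chi] keeps [stage_shift] bounded globally. *)
Definition stage (fr : frame) (x : E) (d : R) (o : option (E * frame)) (u : E -> E) (z : E) : E :=
  if o is Some (i, fri) then
    u z + bump dotp (13 / 100) (15 / 100) (aproj fr z + d *: u z - i) *:
      (chi fr x (1 / 2) 1 z *: stage_shift fr fri d z + (proj dotp fri.2 (u z) - u z))
  else u z.

Fixpoint stages (fr : frame) (x : E) (d : R) (st : nat -> option (E * frame)) (c : nat) : E -> E :=
  if c is c'.+1 then stage fr x d (st c') (stages fr x d st c') else fun _ => 0.

Definition close_frames (fr fri : frame) (x : E) (d : R) : Prop :=
  [/\ framed fri, `|aproj fri x - x| <= 2 * d &
      forall v, `|proj dotp fri.2 v - proj dotp fr.2 v| <= 240 * d * `|v|].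

(** The map is affine with linear part of norm at most 240 by [close_frames], and its value at [x]
    has norm at most 4. On the given set the projection of [z - x] has norm at most 4, and 240 * 4 +
    4 <= 1000. *)
Lemma stage_shift_Sm k (K : R) fr fri x d : 1000 <= K -> 0 < d -> d <= 1 -> framed fr -> `|aproj fr x - x| <= 2 * d ->
  close_frames fr fri x d ->
  Sm k K [set z | `|aproj fr z - x| < 2] (stage_shift fr fri d).
Proof.
move=> K1000 d0 d1 hf frx [hfi frix cl].
have dn : `|d^-1| = d^-1 by rewrite ger0_norm// invr_ge0 ltW.
have AE z w : stage_shift fr fri d z - stage_shift fr fri d w =
    d^-1 *: (proj dotp fri.2 (proj dotp fr.2 (z - w)) - proj dotp fr.2 (proj dotp fr.2 (z - w))).
  rewrite projK// /stage_shift -scalerBr; congr (_ *: _).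
  rewrite -(aprojB fr) -(aprojB fri); vring R E.
have L v : `|d^-1 *: (proj dotp fri.2 (proj dotp fr.2 v) - proj dotp fr.2 (proj dotp fr.2 v))| <= 240 * `|proj dotp fr.2 v|.
  by rewrite normrZ dn ler_pdivrMl// (le_trans (cl _))// [_ * d]mulrC -mulrA.
apply/SmE; split.
  move=> z /= zx; have -> : stage_shift fr fri d z =
      (stage_shift fr fri d z - stage_shift fr fri d x) + stage_shift fr fri d x by vring R E.
  rewrite AE (le_trans (ler_normD _ _))//.
  have h1 := L (z - x).
  have h2 : `|proj dotp fr.2 (z - x)| <= `|aproj fr z - x| + `|aproj fr x - x|.
    rewrite -aprojB; have -> : aproj fr z - aproj fr x = (aproj fr z - x) - (aproj fr x - x) by vring R E.
    exact: ler_normB.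
  have h3 : `|stage_shift fr fri d x| <= 4.
    rewrite normrZ dn ler_pdivrMl//.
    have h3 := aproj_dist (aproj fr x) x hfi.
    by rewrite (le_trans h3)// mulrC; lra.
  lra.
have bA : bounded_linear (fun v => d^-1 *: (proj dotp fri.2 (proj dotp fr.2 v) - proj dotp fr.2 (proj dotp fr.2 v))).
  split; first by move=> a u v; rewrite !(projD, projZ); vring R E.
  exists 240 => v; rewrite (le_trans (L v))// (ler_wpM2l (ler0n R _))// proj_le//.
apply: (@DSm_ext _ _ _ _ _ _ (fun z => mkblin (fun v => d^-1 *: (proj dotp fri.2 (proj dotp fr.2 v) -
   proj dotp fr.2 (proj dotp fr.2 v))) z + stage_shift fr fri d 0)).
- apply: (@open_comp _ _ (fun z => `|aproj fr z - x|) [set y | y < 2]); last exact: open_lt.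
  by move=> z _; exact: dist_aproj_continuous.
- move=> z _; rewrite mkblinE//; have := AE z 0; rewrite subr0 => <-; vring R E.
- apply: (@DSm_sub _ _ _ _ _ setT) => //; apply: DSm_affine.
  apply: blin_lub => [|v]; first by apply: le_trans K1000; exact: ler0n.
  rewrite (mkblinE bA); apply: (le_trans (L v)).
  have := ler_wpM2r (normr_ge0 v) K1000.
  have := proj_le dotpE hf v; have := normr_ge0 v; lra.
Qed.

End AffineFrames.

Section StageBounds.
Context {R : realType}.

Lemma chi_Sm k (a b : R) : 0 <= a -> a < b -> exists2 K, 0 <= K &
  forall (E : completeNormedModType R) (dotp : {dot E for idfun}) n (fr : frame n) (x : E),
   (forall x : E, dotp x x = `|x| ^+ 2) -> framed dotp fr -> Sm k K setT (chi dotp fr x a b).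
Proof.
move=> a0 ab; have [K K0 hK] := bump_Sm k a0 ab.
exists (comp_bound k K 1) => [|E dotp n fr x dotpE hf]; first exact: comp_bound_ge0.
apply: (@Sm_comp _ _ _ _ _ _ _ _ setT) => //; [exact: openT|exact: hK|].
by apply: DSm_shift => //; [exact: openT|exact: DSm_aproj].
Qed.

(** The bound does not depend on [d]: outside [stage_shift] this number occurs only in [d *: u z],
    where [d <= 1] is used. *)
Lemma stage_Sm k (Ku : R) : 0 <= Ku -> exists2 K, 0 <= K &
  forall (E : completeNormedModType R) (dotp : {dot E for idfun}) n (fr : frame n) (x : E) (d : R)
    (o : option (E * frame n)) (u : E -> E),
   (forall x : E, dotp x x = `|x| ^+ 2) -> framed dotp fr -> 0 < d -> d <= 1 ->
   `|aproj dotp fr x - x| <= 2 * d ->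
   (forall i fri, o = Some (i, fri) -> close_frames dotp fr fri x d) ->
   Sm k Ku setT u -> Sm k K setT (stage dotp fr x d o u).
Proof.
move=> Ku0.
have b1 : 0 <= 13 / 100 :> R by lra.
have b2 : 13 / 100 < 15 / 100 :> R by lra.
have [Kb Kb0 hKb] := bump_Sm k b1 b2.
have b3 : 0 <= 1 / 2 :> R by lra.
have b4 : 1 / 2 < 1 :> R by lra.
have [Kc Kc0 hKc] := chi_Sm k b3 b4.
have u1 : 0 <= 1 + Ku by rewrite addr_ge0.
have c0 : 0 <= comp_bound k Kb (1 + Ku) by exact: comp_bound_ge0.
have [Kz Kz1000] : exists Kz : R, 1000 <= Kz by exists 1000.
have Kz0 : 0 <= Kz by apply: le_trans Kz1000; exact: ler0n.
pose Kr := 2 ^+ k * (1 * Kc * Kz) + (Ku + Ku).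
have Kr0 : 0 <= Kr by rewrite addr_ge0 ?mulr_ge0 ?exprn_ge0 ?addr_ge0.
pose K := Ku + 2 ^+ k * (1 * comp_bound k Kb (1 + Ku) * Kr).
have KuK : Ku <= K by rewrite lerDl !mulr_ge0// exprn_ge0.
exists K => [|E dotp n fr x d [[i fri]|] u dotpE hf d0 d1 frx cl hu]; last 2 first.
- have [hfi frix pc] := cl i fri erefl.
  have oT := @openT E.
  apply: Sm_add => //; apply: Sm_bilin => //; first exact: scale_bilin.
    apply: (@Sm_comp _ _ _ _ _ _ _ _ setT) => //; first exact: hKb.
    apply: DSm_shift => //; apply: DSm_add => //; first exact: DSm_aproj.
    have [_ h] := (SmE _ _ _ _).1 (Sm_scale d oT Ku0 hu).
    by apply: DSm_le h; rewrite gtr0_norm// ler_piMl.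
  apply: Sm_add => //.
    pose U1 := [set z | `|aproj dotp fr z - x| < 2]; pose U2 := [set z | 1 < `|aproj dotp fr z - x|].
    have cf := dist_aproj_continuous dotpE (x := x) hf.
    apply: (@Sm_cutoff _ _ _ _ _ _ U1 U2) => //.
    + by apply: (@open_comp _ _ (fun z => `|aproj dotp fr z - x|) [set y | y < 2]); [move=> z _; exact: cf|exact: open_lt].
    + by apply: (@open_comp _ _ (fun z => `|aproj dotp fr z - x|) [set y | 1 < y]); [move=> z _; exact: cf|exact: open_gt].
    + apply/seteqP; split=> // z _; have [h|h] := ltP (`|aproj dotp fr z - x|) 2; [by left|right].
      by apply: lt_le_trans h; lra.
    + exact: hKc.
    + exact: stage_shift_Sm.
    + by move=> z /ltW; exact: bump_out.
  apply: Sm_add => //; last exact: Sm_opp.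
  have h := Sm_lin (projb dotp fri.2) oT Ku0 hu.
  apply: (@Sm_ext _ _ _ _ _ _ (fun z => projb dotp fri.2 (u z))) => //.
    by move=> y _; rewrite projbE.
  by apply: Sm_le h; rewrite ler_piMl// projb_norm.
- exact: Sm_le hu.
- exact: le_trans KuK.
Qed.

(** Each stage enlarges the bound, so uniformity rests on the number [N] of classes being fixed in
    advance. *)
Lemma stages_Sm N k : exists2 K, 0 <= K &
  forall (E : completeNormedModType R) (dotp : {dot E for idfun}) n (fr : frame n) (x : E) (d : R)
    (st : nat -> option (E * frame n)),
   (forall x : E, dotp x x = `|x| ^+ 2) -> framed dotp fr -> 0 < d -> d <= 1 ->
   `|aproj dotp fr x - x| <= 2 * d ->
   (forall c i fri, st c = Some (i, fri) -> close_frames dotp fr fri x d) ->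
   forall c, (c <= N)%N -> Sm k K setT (stages dotp fr x d st c).
Proof.
elim: N => [|N [K K0 hK]].
  exists 0 => // E dotp n fr x d st dotpE hf d0 d1 frx cl c; rewrite leqn0 => /eqP ->.
  by apply: Sm_cst; rewrite ?normr0//; exact: openT.
have [K' K'0 hK'] := stage_Sm k K0.
exists (K + K') => [|E dotp n fr x d st dotpE hf d0 d1 frx cl c]; first exact: addr_ge0.
rewrite leq_eqVlt => /predU1P[->|cN].
  apply: (@Sm_le _ _ _ _ K'); first by rewrite lerDr.
  apply: hK' => //; first by move=> i fri; exact: cl.
  exact: hK.
by apply: (@Sm_le _ _ _ _ K); [rewrite lerDl|exact: hK].
Qed.

End StageBounds.

(** * Sets close to planes *)

Section NearlyFlat.
Context {R : realType} {E : completeNormedModType R} (dotp : {dot E for idfun}) (n : nat).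
Hypothesis dotpE : forall x : E, dotp x x = `|x| ^+ 2.
Variables (X : set E) (fr : E -> frame (E := E) n) (eps d : R).

(** The hypothesis of the theorem at [r = 1]. The intermediate net is eliminated by the triangle
    inequality, at the cost of the terms [2 * d] and [eps + 3 * d]. *)
Definition nearly_flat : Prop :=
  [/\ forall x, X x -> framed dotp (fr x),
      forall x y, X x -> X y -> `|y - x| < 1 -> `|aproj dotp (fr x) y - y| <= 2 * d,
      forall x a, X x -> aproj dotp (fr x) a = a -> `|a - x| < 1 ->
        exists q, [/\ X q, `|q - x| < 1 & `|a - q| <= eps + 3 * d] &
      [/\ 0 < d, 100 * d <= 1 / 100, 0 < eps & eps < 10^-1] ].

Hypothesis flat : nearly_flat.

Local Notation P x := (aproj dotp (fr x)).
Local Notation pi x := (proj dotp (fr x).2).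

Let Xfr x : X x -> framed dotp (fr x). Proof. by case: flat => h _ _ _; exact: h. Qed.
Let XP x y : X x -> X y -> `|y - x| < 1 -> `|P x y - y| <= 2 * d.
Proof. by case: flat => _ h _ _; exact: h. Qed.
Let XPx x : X x -> `|P x x - x| <= 2 * d.
Proof. by move=> Xx; apply: XP => //; rewrite subrr normr0. Qed.
Let XQ x a : X x -> P x a = a -> `|a - x| < 1 -> exists q, [/\ X q, `|q - x| < 1 & `|a - q| <= eps + 3 * d].
Proof. by case: flat => _ _ h _; exact: h. Qed.

Lemma sub_aproj x u v : (u - P x u) - (v - P x v) = (u - v) - pi x (u - v).
Proof. by rewrite -aprojB; vring R E. Qed.

(* With [m] the norm of the normal part [T] of [P y] on the direction of [P x], points [q] of [X]
   near [P x x + t / 4] give [m / 4 <= 8 d + m (eps + 3 d)]: only the smallness of the mesh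
   [eps] matters, not the dimension. *)
Lemma proj_half_close x y v : X x -> X y -> `|x - y| <= 59 / 100 ->
  `|pi x v - pi y (pi x v)| <= 60 * d * `|v|.
Proof.
have [_ _ _ [d0 d1 eps0 eps1]] := flat.
move=> Xx Xy xy; have hx := Xfr Xx; have hy := Xfr Xy.
have bT : bounded_linear (fun v => pi x v - pi y (pi x v)).
  split; first by move=> a u w; rewrite !(projD, projZ); vring R E.
  by exists 1 => w; rewrite mul1r (le_trans (projQ_le dotpE hy _))// proj_le.
pose T := mkblin (fun v => pi x v - pi y (pi x v)).
have TE w : T w = pi x w - pi y (pi x w) by exact: (mkblinE bT).
rewrite -TE (le_trans (blin_ub _ _))// ler_wpM2r//.
pose m := `|T|; have m0 : 0 <= m by exact: normr_ge0.
have key t : pi x t = t -> `|t| = 1 -> 4^-1 * `|T t| <= 8 * d + m * (eps + 3 * d).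
  move=> pt nt; pose a := P x x + 4^-1 *: t.
  have Pa : P x a = a by rewrite /a aprojD// aprojK// projZ pt.
  have n4 : `|4^-1 *: t| = 4^-1 by rewrite normrZ nt mulr1 gtr0_norm.
  have ax : `|a - x| <= 2 * d + 4^-1.
    have -> : a - x = (P x x - x) + 4^-1 *: t by rewrite /a; vring R E.
    by rewrite (le_trans (ler_normD _ _))// n4 lerD2r XPx.
  have [|q [Xq qx aq]] := XQ Xx Pa; first by apply: (le_lt_trans ax); lra.
  have qx1 : `|q - x| <= 5 * d + 4^-1 + eps.
    have -> : q - x = (a - x) - (a - q) by vring R E.
    by rewrite (le_trans (ler_normB _ _))//; lra.
  have qy : `|q - y| < 1.
    have -> : q - y = (q - x) + (x - y) by vring R E.
    by rewrite (le_lt_trans (ler_normD _ _))//; lra.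
  have xy1 : `|x - y| < 1 by lra.
  have h1 : `|(q - x) - pi y (q - x)| <= 4 * d.
    rewrite -sub_aproj (le_trans (ler_normB _ _))// ![`|_ - P y _|]distrC.
    by have := XP Xy Xq qy; have := XP Xy Xx xy1; lra.
  have h2 : `|(q - x) - pi x (q - x)| <= 4 * d.
    rewrite -sub_aproj (le_trans (ler_normB _ _))// ![`|_ - P x _|]distrC.
    by have := XP Xx Xq qx; have := XPx Xx; lra.
  have h3 : `|T (q - x)| <= 8 * d.
    rewrite TE; have -> : pi x (q - x) - pi y (pi x (q - x)) =
      ((q - x) - pi y (q - x)) - (((q - x) - pi x (q - x)) - pi y ((q - x) - pi x (q - x))).
      by rewrite (projB _ _ _ (pi x (q - x))); vring R E.
    rewrite (le_trans (ler_normB _ _))//.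
    have := projQ_le dotpE hy ((q - x) - pi x (q - x)); lra.
  have h4 : 4^-1 *: T t = T (q - x) + T (a - q).
    rewrite -blinD -blinZ !TE; have -> : q - x + (a - q) = 4^-1 *: t - (x - P x x) by rewrite /a; vring R E.
    by rewrite (projB _ _ _ (x - P x x)) proj_aprojQ// subr0.
  have -> : 4^-1 * `|T t| = `|4^-1 *: T t| by rewrite normrZ gtr0_norm.
  rewrite h4 (le_trans (ler_normD _ _))// lerD//.
  by rewrite (le_trans (blin_ub _ _))// ler_wpM2l.
have key2 : 4^-1 * m <= 8 * d + m * (eps + 3 * d).
  rewrite mulrC -ler_pdivlMr ?invr_gt0// invrK.
  apply: blin_lub => [|w].
    by rewrite mulr_ge0// addr_ge0// ?mulr_ge0// ?addr_ge0 ?mulr_ge0//; exact: ltW.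
  have [w0|w0] := eqVneq (pi x w) 0.
    rewrite TE w0 -(scale0r 0) projZ !scale0r subr0 normr0 mulr_ge0// mulr_ge0//.
    by rewrite addr_ge0// ?mulr_ge0// ?addr_ge0 ?mulr_ge0//; exact: ltW.
  have nw : 0 < `|pi x w| by rewrite normr_gt0.
  have nt : `| `|pi x w|^-1 *: pi x w| = 1 by rewrite normrZ normfV normr_id mulVf ?gt_eqF.
  have := key _ _ nt; rewrite projZ projK// => /(_ erefl).
  have -> : T (`|pi x w|^-1 *: pi x w) = `|pi x w|^-1 *: T w by rewrite blinZ !TE projK.
  rewrite normrZ normfV normr_id => h.
  have h' : `|T w| <= (8 * d + m * (eps + 3 * d)) * 4 * `|pi x w|.
    rewrite -ler_pdivrMr// -ler_pdivrMr//; apply: le_trans h.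
    by rewrite mulrC [X in _ * X <= _]mulrC.
  apply: (le_trans h'); rewrite ler_wpM2l ?proj_le// mulr_ge0//.
  by rewrite addr_ge0// ?mulr_ge0// ?addr_ge0 ?mulr_ge0//; exact: ltW.
rewrite -/T -/m.
(* Since [eps + 3 * d] is at most 11/100, below 1/4, the term with [m] is absorbed into the left
   side of [key2] and leaves [m <= 60 * d]. *)
have : m * (eps + 3 * d) <= m * (11 / 100) by rewrite ler_wpM2l//; lra.
lra.
Qed.

(** The remaining operator [pi y (1 - pi x)] is the adjoint of [(1 - pi x) pi y], which
    [proj_half_close] bounds with [x] and [y] exchanged. *)
Lemma proj_close_near x y v : X x -> X y -> `|x - y| <= 59 / 100 ->
  `|pi x v - pi y v| <= 120 * d * `|v|.
Proof.
have [_ _ _ [d0 d1 eps0 eps1]] := flat.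
move=> Xx Xy xy; have hx := Xfr Xx; have hy := Xfr Xy.
have -> : pi x v - pi y v = (pi x v - pi y (pi x v)) - pi y (v - pi x v).
  by rewrite (projB _ _ v); vring R E.
rewrite (le_trans (ler_normB _ _))//.
have h1 := proj_half_close v Xx Xy xy.
suff : `|pi y (v - pi x v)| <= 60 * d * `|v| by lra.
set w := pi y (v - pi x v).
have [->|w0] := eqVneq w 0; first by rewrite normr0 mulr_ge0// mulr_ge0// ltW.
have nw : 0 < `|w| by rewrite normr_gt0.
rewrite -(@ler_pM2r _ `|w|)// -expr2 -dotpE.
have -> : dotp w w = dotp v (pi y w - pi x (pi y w)).
  by rewrite {1}/w dotp_projC dotpBl dotpBr [dotp (pi x v) _]dotp_projC.
rewrite (le_trans (ler_norm _))// (le_trans (dotp_le dotpE _ _))//.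
rewrite distrC in xy.
have := proj_half_close w Xy Xx xy.
move=> h; apply: (le_trans (ler_wpM2l (normr_ge0 v) h)); lra.
Qed.

(** The larger range is reached by passing through a point [q] of [X] near the midpoint, at distance
    at most 59/100 from both; the bound doubles. *)
Lemma proj_close x y v : X x -> X y -> `|x - y| <= 95 / 100 ->
  `|pi x v - pi y v| <= 240 * d * `|v|.
Proof.
have [_ _ _ [d0 d1 eps0 eps1]] := flat.
move=> Xx Xy xy; have hx := Xfr Xx.
pose m := 2^-1 *: (x + y).
have mx : `|m - x| <= 48 / 100.
  have -> : m - x = 2^-1 *: (y - x) by rewrite /m; vlin R E; first [exact I|by field].
  by rewrite normrZ distrC gtr0_norm//; lra.
have my : `|m - y| <= 48 / 100.
  have -> : m - y = 2^-1 *: (x - y) by rewrite /m; vlin R E; first [exact I|by field].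
  by rewrite normrZ gtr0_norm//; lra.
have xy1 : `|y - x| < 1 by rewrite distrC; lra.
have Pm : `|P x m - m| <= 2 * d.
  have -> : P x m - m = 2^-1 *: ((P x x - x) + (P x y - y)).
    have hm : m = x + 2^-1 *: (y - x) by rewrite /m; vlin R E; first [exact I|by field].
    have hy' : P x y = P x x + pi x (y - x) by rewrite -aprojD; congr (P x _); vring R E.
    rewrite hy' [in P x m]hm aprojD projZ hm; vlin R E; first [exact I|by field].
  rewrite normrZ gtr0_norm//.
  have := ler_normD (P x x - x) (P x y - y); have := XPx Xx; have := XP Xx Xy xy1; lra.
have [||q [Xq qx Pq]] := @XQ x (P x m) Xx; first exact: aprojK.
  have -> : P x m - x = (P x m - m) + (m - x) by vring R E.
  by rewrite (le_lt_trans (ler_normD _ _))//; lra.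
have qm : `|m - q| <= eps + 5 * d.
  have -> : m - q = (P x m - q) - (P x m - m) by vring R E.
  by rewrite (le_trans (ler_normB _ _))//; lra.
have h1 : `|x - q| <= 59 / 100.
  have -> : x - q = (m - q) - (m - x) by vring R E.
  by rewrite (le_trans (ler_normB _ _))//; lra.
have h2 : `|q - y| <= 59 / 100.
  have -> : q - y = (m - y) - (m - q) by vring R E.
  by rewrite (le_trans (ler_normB _ _))//; lra.
have -> : pi x v - pi y v = (pi x v - pi q v) + (pi q v - pi y v) by vring R E.
rewrite (le_trans (ler_normD _ _))//.
have := proj_close_near v Xx Xq h1; have := proj_close_near v Xq Xy h2; lra.
Qed.

Lemma aproj_close x y z : X x -> X y -> `|x - y| <= 95 / 100 ->
  `|P x z - P y z| <= 240 * d * `|z - x| + 4 * d.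
Proof.
have [_ _ _ [d0 d1 eps0 eps1]] := flat.
move=> Xx Xy xy.
have xy1 : `|x - y| < 1 by lra.
have -> : P x z - P y z = (pi x (z - x) - pi y (z - x)) + ((P x x - x) - (P y x - x)).
  by rewrite -!aprojB; vring R E.
rewrite (le_trans (ler_normD _ _))// lerD//; first exact: proj_close.
rewrite (le_trans (ler_normB _ _))//.
by have := XPx Xx; have := XP Xy Xx xy1; lra.
Qed.

Lemma close_frames_near x y : X x -> X y -> `|x - y| <= 95 / 100 ->
  close_frames dotp (fr x) (fr y) x d.
Proof.
have [_ _ _ [d0 d1 eps0 eps1]] := flat.
move=> Xx Xy xy; have xy1 : `|x - y| < 1 by lra.
split; [exact: Xfr|exact: XP|move=> v; rewrite distrC; exact: proj_close].
Qed.

End NearlyFlat.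

(** * Gluing the planes *)

Lemma Sm_lip {R : realType} (V E : normedModType R) (dotp : {dot E for idfun}) (f : V -> E) K x y :
  (forall x : E, dotp x x = `|x| ^+ 2) -> Sm 1 K setT f -> `|f x - f y| <= K * `|x - y|.
Proof.
move=> dotpE [_ h1 h2]; have {1}-> : x = y + (x - y) by vring R V.
apply: (hasd_mean_value (A := fun t => D f (y + t *: (x - y))) dotpE) => t _; first exact: h1.
by rewrite (le_trans (blin_ub _ _))// ler_wpM2r// h2.
Qed.

Section Classes.
Context {R : realType}.

(** A point missed by the first [N] classes has in each of them a centre within 72/100, and these
    centres are 2/100 apart. Being [2 * d]-close to one plane, they remain 1/100 apart after
    projection, which contradicts [packing]. *)
Lemma center_classes n : exists N : nat, forall (E : completeNormedModType R)
   (dotp : {dot E for idfun}) (X : set E) (fr : E -> frame n) (eps d : R),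
  (forall x : E, dotp x x = `|x| ^+ 2) -> nearly_flat dotp X fr eps d ->
  exists C : nat -> set E, [/\ forall c, C c `<=` X, forall c, separated_by (72 / 100) (C c) &
    forall x, X x -> exists c, (c < N)%N /\ exists2 y, C c y & `|x - y| < 2 / 100].
Proof.
have [N pN] := @packing R n; exists N => E dotp X fr eps d dotpE flat.
have D0 : 0 < 72 / 100 :> R by lra.
have [C [CX Cs Cc]] := separated_classes X (2 / 100) D0; exists C; split=> // x Xx.
apply: contrapT => hx.
have /choice[t ht] : forall c, exists t, (c < N)%N -> [/\ C c t, `|x - t| < 72 / 100 &
    forall c' y, (c' < c)%N -> C c' y -> 2 / 100 <= `|t - y|].
  move=> c; have [cN|cN] := ltnP c N; last by exists x.
  have [[c' [cc hy]]|[t ht]] := Cc c x Xx; last by exists t.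
  by case: hx; exists c'; split=> //; exact: ltn_trans cN.
have [fX Pd _ [d0 d1 _ _]] := flat.
have tX (i : 'I_N) : [/\ X (t i), `|x - t i| < 72 / 100 & `|aproj dotp (fr x) (t i) - t i| <= 2 * d].
  have [h1 h2 _] := ht i (ltn_ord i); split=> //; first exact: CX h1.
  by apply: Pd => //; [exact: CX h1|rewrite distrC; lra].
apply: (pN E dotp (fr x).2 x (fun i : 'I_N => t i) dotpE); first exact: fX.
  by move=> i; have [_ h _] := tX i; rewrite distrC; lra.
move=> i j ij.
have sep : 2 / 100 <= `|t i - t j|.
  have [h1 _ h2] := ht i (ltn_ord i); have [h1' _ h2'] := ht j (ltn_ord j).
  have [lij|lij|eij] := ltngtP i j; [by rewrite distrC; exact: (h2' _ _ lij h1)|exact: (h2 _ _ lij h1')|].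
  by move: ij; rewrite (val_inj eij) eqxx.
have [_ _ hi] := tX i; have [_ _ hj] := tX j.
have : `|t i - t j| <= `|proj dotp (fr x).2 (t i - t j)| + (2 * d + 2 * d).
  have {1}-> : t i - t j = proj dotp (fr x).2 (t i - t j) - ((aproj dotp (fr x) (t i) - t i) - (aproj dotp (fr x) (t j) - t j)).
    by rewrite -aprojB; vring R E.
  by rewrite (le_trans (ler_normB _ _))// lerD2l (le_trans (ler_normB _ _))// lerD.
lra.
Qed.

End Classes.

Section Construction.
Context {R : realType} {E : completeNormedModType R} (dotp : {dot E for idfun}) (n : nat).
Hypothesis dotpE : forall x : E, dotp x x = `|x| ^+ 2.
Variables (X : set E) (fr : E -> frame (E := E) n) (eps d : R).
Hypothesis flat : nearly_flat dotp X fr eps d.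
Variables (N : nat) (C : nat -> set E).
Hypothesis CX : forall c, C c `<=` X.
Hypothesis Csep : forall c, separated_by (72 / 100) (C c).
Hypothesis Ccov : forall x, X x -> exists c, (c < N)%N /\ exists2 y, C c y & `|x - y| < 2 / 100.

Local Notation P x := (aproj dotp (fr x)).
Local Notation pi x := (proj dotp (fr x).2).

(** Separation by 72/100 leaves at most one centre within 36/100 of [x], so the choice is forced;
    with [None] the stage does nothing. *)
Definition centers (x : E) (c : nat) : option (E * frame (E := E) n) :=
  if pselect (exists i, C c i /\ `|i - x| < 36 / 100) is left h then
    Some (projT1 (cid h), fr (projT1 (cid h)))
  else None.

(** A map of the whole space, so that the discs of different planes are moved by the same map. By
    separation at most one centre of the class is close enough to act on [z]. *)
Definition flatten_step (c : nat) (z : E) : E :=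
  if pselect (exists i, C c i /\ `|i - z| < 15 / 100) is left h then
    z + bump dotp (13 / 100) (15 / 100) (z - projT1 (cid h)) *: (P (projT1 (cid h)) z - z)
  else z.

Fixpoint flatten (c : nat) (z : E) : E :=
  if c is c'.+1 then flatten_step c' (flatten c' z) else z.

Definition offset (x : E) (c : nat) : E -> E := stages dotp (fr x) x d (centers x) c.

Variable K : R.
Hypothesis offset_Sm : forall x c, X x -> (c <= N)%N -> Sm 1 K setT (offset x c).
Hypothesis dK_small : 100 * (100 * (d + d * K)) <= 1 / 100.

Let Xfr x : X x -> framed dotp (fr x). Proof. by case: flat => h _ _ _; exact: h. Qed.
Let XP x y : X x -> X y -> `|y - x| < 1 -> `|P x y - y| <= 2 * d.
Proof. by case: flat => _ h _ _; exact: h. Qed.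
Let XPx x : X x -> `|P x x - x| <= 2 * d.
Proof. by move=> Xx; apply: XP => //; rewrite subrr normr0. Qed.
Let XQ x a : X x -> P x a = a -> `|a - x| < 1 -> exists q, [/\ X q, `|q - x| < 1 & `|a - q| <= eps + 3 * d].
Proof. by case: flat => _ _ h _; exact: h. Qed.

Let r0 : 0 <= 13 / 100 :> R. Proof. by lra. Qed.
Let r1 : 13 / 100 < 15 / 100 :> R. Proof. by lra. Qed.
Let half0 : 0 <= 1 / 2 :> R. Proof. by lra. Qed.
Let half1 : 1 / 2 < 1 :> R. Proof. by lra. Qed.

Lemma centers_close x c i fri : X x -> centers x c = Some (i, fri) -> close_frames dotp (fr x) fri x d.
Proof.
move=> Xx; rewrite /centers; case: pselect => // h [_ <-].
have [hC hx] := projT2 (cid h); apply: (close_frames_near dotpE flat) => //; first exact: (CX hC).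
by rewrite distrC; lra.
Qed.

Lemma class_uniq c i j (z : E) : C c i -> C c j -> `|i - z| < 36 / 100 -> `|j - z| < 36 / 100 -> i = j.
Proof.
move=> Ci Cj iz jz; apply: contrapT => ij.
have := Csep Ci Cj ij; rewrite leNgt => /negP; apply.
have -> : i - j = (i - z) - (j - z) by vring R E.
by rewrite (le_lt_trans (ler_normB _ _))//; lra.
Qed.

Lemma flatten_stepE c i z : C c i -> `|i - z| < 36 / 100 ->
  flatten_step c z = z + bump dotp (13 / 100) (15 / 100) (z - i) *: (P i z - z).
Proof.
move=> Ci iz; rewrite /flatten_step; case: pselect => [h|h].
  have [hC hz] := projT2 (cid h); have -> // : projT1 (cid h) = i by apply: (class_uniq hC Ci _ iz); lra.
have zi : 15 / 100 <= `|z - i|.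
  by rewrite leNgt distrC; apply/negP => hz; apply: h; exists i.
by rewrite (bump_out dotpE r0 r1 zi) scale0r addr0.
Qed.

Lemma flatten_step_in c i z : C c i -> `|z - i| <= 13 / 100 -> flatten_step c z = P i z.
Proof.
move=> Ci iz; rewrite (flatten_stepE Ci); last by rewrite distrC; lra.
rewrite (bump_in dotpE r0 r1 iz) scale1r; vring R E.
Qed.

Lemma offset_le x c z : X x -> (c <= N)%N -> `|d *: offset x c z| <= d * K.
Proof.
have [_ _ _ [d0 _ _ _]] := flat.
move=> Xx cN; rewrite normrZ gtr0_norm// ler_pM2l//.
exact: Sm_bound (offset_Sm Xx cN) I.
Qed.

(** [stage] was designed to follow [flatten_step] on the plane of [x]; the induction compares them
    one class at a time. *)
Lemma flatten_local x a c : X x -> P x a = a -> `|a - x| <= 19 / 100 -> (c <= N)%N ->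
  flatten c a = a + d *: offset x c a.
Proof.
have [_ _ _ [d0 _ _ _]] := flat.
have dKs := dK_small.
have dn0 : d != 0 by rewrite gt_eqF.
move=> Xx Pa ax; elim: c => [|c IH] cN; first by rewrite /= scaler0 addr0.
have cN' := ltnW cN.
rewrite /= IH// {IH}; set b := a + d *: offset x c a.
have ba : `|b - a| <= d * K.
  have -> : b - a = d *: offset x c a by rewrite /b; vring R E.
  exact: offset_le.
have bx : `|b - x| < 20 / 100.
  have -> : b - x = (b - a) + (a - x) by vring R E.
  by rewrite (le_lt_trans (ler_normD _ _))//; lra.
rewrite /offset /= -/(offset x c).
(* A centre acting on [b] lies within 15/100 of it, hence within 36/100 of [x], because [b] is
   within 20/100 of [x]. So [centers x c] misses no active centre. *)
have [[i [Ci ix]]|hi] := pselect (exists i, C c i /\ `|i - x| < 36 / 100); last first.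
  rewrite /centers; case: pselect => [//|_] /=; rewrite /flatten_step; case: pselect => // h.
  exfalso; apply: hi; have [hC hz] := projT2 (cid h); exists (projT1 (cid h)); split=> //.
  have -> : projT1 (cid h) - x = (projT1 (cid h) - b) + (b - x) by vring R E.
  by rewrite (le_lt_trans (ler_normD _ _))//; lra.
have -> : centers x c = Some (i, fr i).
  rewrite /centers; case: pselect => [h|h]; last by case: h; exists i.
  by have [hC hz] := projT2 (cid h); rewrite (class_uniq hC Ci hz ix).
have fE : flatten_step c b = b + bump dotp (13 / 100) (15 / 100) (b - i) *: (P i b - b).
  have [iz|iz] := ltP (`|i - b|) (36 / 100); first exact: flatten_stepE.
  have bi : 15 / 100 <= `|b - i| by rewrite distrC; lra.
  rewrite (bump_out dotpE r0 r1 bi) scale0r addr0.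
  rewrite /flatten_step; case: pselect => // h; exfalso; have [hC hz] := projT2 (cid h).
  have ji : projT1 (cid h) = i.
    apply: (class_uniq hC Ci) ix.
    have -> : projT1 (cid h) - x = (projT1 (cid h) - b) + (b - x) by vring R E.
    by rewrite (le_lt_trans (ler_normD _ _))//; lra.
  by move: hz; rewrite ji; lra.
have Pax : `|P x a - x| <= 1 / 2 by rewrite Pa; lra.
rewrite fE /stage /chi (bump_in dotpE half0 half1 Pax) scale1r Pa -/b /stage_shift Pa.
have -> : P i b = P i a + d *: pi i (offset x c a) by rewrite /b aprojD projZ.
set m := bump _ _ _ _; rewrite /b; vlin R E; first [exact I|by field].
Qed.

Lemma flatten_eq c a a' : (c <= N)%N -> flatten c a = flatten c a' -> flatten N a = flatten N a'.
Proof.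
move=> /subnKC <-; elim: (N - c)%N => [|m IH]; first by rewrite addn0.
by rewrite addnS /= => h; rewrite IH.
Qed.

(** [eps + 3 * d] and the covering radius 2/100 add up to less than 13/100 because [eps < 1 / 10];
    the margin 1/125 absorbs the displacements caused by the earlier stages. *)
Lemma cover x a : X x -> P x a = a -> `|a - x| < 1 ->
  exists c i, [/\ (c < N)%N, C c i & `|a - i| <= 13 / 100 - 1 / 125].
Proof.
have [_ _ _ [d0 d1 eps0 eps1]] := flat.
have dKs := dK_small.
move=> Xx Pa ax; have [q [Xq _ aq]] := XQ Xx Pa ax.
have [c [cN [i Ci qi]]] := Ccov Xq; exists c, i; split=> //.
have -> : a - i = (a - q) + (q - i) by vring R E.
by rewrite (le_trans (ler_normD _ _))//; lra.
Qed.

(** The stage of a centre [i] near [a] sends a neighbourhood of [a] onto the plane of [i]. It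
    suffices to find [a'] in the plane of [x'] that has reached the same point [b] after this stage,
    because the later stages then coincide. *)
Lemma transfer x x' a : X x -> X x' -> P x a = a -> `|a - x| <= 17 / 100 -> `|a - x'| <= 17 / 100 ->
  exists a', [/\ P x' a' = a', `|a' - a| <= 200 * d + 4 * (d * K) & flatten N a' = flatten N a].
Proof.
have [_ _ _ [d0 d1 eps0 eps1]] := flat.
have dKs := dK_small.
have D240 : 0 <= 240 * d by lra.
move=> Xx Xx' Pa ax ax'; have hx := Xfr Xx; have hx' := Xfr Xx'.
have dK0 : 0 <= d * K.
  by apply: le_trans (offset_le a Xx (leq0n N)); exact: normr_ge0.
have [|c [i [cN Ci ai]]] := cover Xx Pa; first lra.
have Xi := CX Ci; have hi := Xfr Xi; have cN' := ltnW cN.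
have xi : `|x - i| <= 95 / 100.
  have -> : x - i = (a - i) - (a - x) by vring R E.
  by rewrite (le_trans (ler_normB _ _))//; lra.
have x'i : `|x' - i| <= 95 / 100.
  have -> : x' - i = (a - i) - (a - x') by vring R E.
  by rewrite (le_trans (ler_normB _ _))//; lra.
have ix' : `|i - x'| <= 95 / 100 by rewrite distrC.
set a1 := flatten c a.
have a1E : a1 = a + d *: offset x c a by apply: flatten_local => //; lra.
have a1a : `|a1 - a| <= d * K.
  have -> : a1 - a = d *: offset x c a by rewrite a1E; vring R E.
  exact: offset_le.
have a1i : `|a1 - i| <= 13 / 100.
  have -> : a1 - i = (a1 - a) + (a - i) by vring R E.
  by rewrite (le_trans (ler_normD _ _))//; lra.
pose b := P i a1.
have fb : flatten c.+1 a = b by rewrite /= -/a1 (flatten_step_in Ci).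
have ba : `|b - a| <= 45 * d + 2 * (d * K).
  have h1 := aproj_close dotpE flat a Xx Xi xi.
  have h2 : `|P i a1 - P i a| <= d * K by apply: le_trans a1a; exact: aproj_lip.
  have -> : b - a = (P i a1 - P i a) - (P x a - P i a) by rewrite Pa /b; vring R E.
  rewrite (le_trans (ler_normB _ _))//.
  have : 240 * d * `|a - x| <= 240 * d * (17 / 100) by rewrite (ler_wpM2l D240).
  lra.
pose S w := pi i (P x' (P i w) - P i w + d *: offset x' c (P x' (P i w))).
have lip1 : forall z z', `|offset x' c z - offset x' c z'| <= K * `|z - z'|.
  by move=> z z'; apply: (Sm_lip _ _ dotpE); exact: offset_Sm.
have K0 : 0 <= K by rewrite -(pmulr_rge0 _ d0).
have SL w w' : `|S w - S w'| <= 2^-1 * `|w - w'|.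
  have -> : S w - S w' = pi i (pi x' (pi i (w - w')) - pi i (pi i (w - w'))) +
     d *: pi i (offset x' c (P x' (P i w)) - offset x' c (P x' (P i w'))).
    rewrite /S -projB -projZ -projD; congr (pi i _).
    rewrite projK// -!aprojB; vring R E.
  rewrite (le_trans (ler_normD _ _))//.
  have h1 : `|pi i (pi x' (pi i (w - w')) - pi i (pi i (w - w')))| <= 240 * d * `|w - w'|.
    rewrite (le_trans (proj_le dotpE hi _))// (le_trans (proj_close dotpE flat _ Xx' Xi x'i))//.
    by rewrite (ler_wpM2l D240) ?proj_le.
  have h2 : `|d *: pi i (offset x' c (P x' (P i w)) - offset x' c (P x' (P i w')))| <= d * K * `|w - w'|.
    rewrite normrZ gtr0_norm// -mulrA ler_pM2l// (le_trans (proj_le dotpE hi _))//.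
    rewrite (le_trans (lip1 _ _))// ler_wpM2l// (le_trans (aproj_lip dotpE _ _ hx'))//.
    exact: aproj_lip.
  have : (240 * d + d * K) * `|w - w'| <= 2^-1 * `|w - w'| by rewrite ler_wpM2r//; lra.
  lra.
have [w wb] := near_id_bij SL b.
have Pb : P i b = b by exact: aprojK.
have piS w0 : pi i (S w0) = S w0 by rewrite projK.
have Pw : P i w = w.
  have -> : w = b + - S w by rewrite -wb; vring R E.
  by rewrite aprojD Pb projN piS.
have bx' : `|b - x'| <= 18 / 100.
  have -> : b - x' = (b - a) + (a - x') by vring R E.
  by rewrite (le_trans (ler_normD _ _))//; lra.
have Sb : `|S b| <= 48 * d + d * K.
  rewrite (le_trans (proj_le dotpE hi _))// (le_trans (ler_normD _ _))// Pb lerD//; last exact: offset_le.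
  have := aproj_close dotpE flat b Xx' Xi x'i; rewrite Pb.
  have : 240 * d * `|b - x'| <= 240 * d * (18 / 100) by rewrite (ler_wpM2l D240).
  lra.
have wbn : `|w - b| <= 96 * d + 2 * (d * K).
  have h1 : `|w - b| = `|S w| by rewrite -wb opprD addrA subrr sub0r normrN.
  have h2 : `|S w| <= `|S b| + 2^-1 * `|w - b|.
    have -> : S w = S b + (S w - S b) by vring R E.
    by rewrite (le_trans (ler_normD _ _))// lerD2l.
  lra.
have wx' : `|w - x'| <= 19 / 100.
  have -> : w - x' = (w - b) + (b - x') by vring R E.
  by rewrite (le_trans (ler_normD _ _))//; lra.
pose a' := P x' w.
have a'w : `|a' - w| <= 50 * d.
  have := aproj_close dotpE flat w Xx' Xi x'i; rewrite Pw.
  have : 240 * d * `|w - x'| <= 240 * d * (19 / 100) by rewrite (ler_wpM2l D240).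
  rewrite -/a'; lra.
have a'a : `|a' - a| <= 200 * d + 4 * (d * K).
  have -> : a' - a = (a' - w) + (w - b) + (b - a) by vring R E.
  rewrite (le_trans (ler_normD _ _))//; have := ler_normD (a' - w) (w - b); lra.
have Pa' : P x' a' = a' by exact: aprojK.
exists a'; split=> //.
have a'x' : `|a' - x'| <= 19 / 100.
  have -> : a' - x' = (a' - a) + (a - x') by vring R E.
  by rewrite (le_trans (ler_normD _ _))//; lra.
apply: (@flatten_eq c.+1) => //; rewrite fb /= (flatten_local Xx' Pa' a'x' cN').
have off := offset_le a' Xx' cN'.
rewrite (flatten_step_in Ci); last first.
  have -> : a' + d *: offset x' c a' - i = d *: offset x' c a' + ((a' - a) + (a - i)) by vring R E.
  rewrite (le_trans (ler_normD _ _))//; have := ler_normD (a' - a) (a - i); lra.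
have -> : a' + d *: offset x' c a' = w + (a' - w + d *: offset x' c a') by vring R E.
by rewrite aprojD -wb Pw /S Pw.
Qed.

End Construction.

(** * Graphs and their normal projections *)

Section NearIdentityInverse.
Context {R : realType} {E : completeNormedModType R} (dotp : {dot E for idfun}).
Hypothesis dotpE : forall x : E, dotp x x = `|x| ^+ 2.

Definition inv_near_id (S : E -> E) (y : E) : E := xget 0 [set z | z + S z = y].

Variable S : E -> E.
Hypothesis S1 : Sm 1 2^-1 setT S.

Let lipS x y : `|S x - S y| <= 2^-1 * `|x - y|. Proof. exact: (Sm_lip _ _ dotpE S1). Qed.

Lemma inv_near_idE y : inv_near_id S y + S (inv_near_id S y) = y.
Proof. by have := xgetPex 0 (near_id_bij lipS y). Qed.

Lemma inv_near_id_eq z y : z + S z = y -> inv_near_id S y = z.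
Proof.
move=> zy; apply/eqP; rewrite -subr_eq0 -normr_le0.
by rewrite (le_trans (near_id_inj _ _ lipS))// inv_near_idE zy subrr normr0 mulr0.
Qed.

Lemma inv_near_id_DSm k K : 0 <= K -> DSm k K setT S -> DSm k (diffeo_bound k K) setT (inv_near_id S).
Proof.
apply: near_id_diffeo => //; last exact: inv_near_idE.
by case: S1 => _ h1 h2 x; split; [exact: h1|exact: h2].
Qed.

End NearIdentityInverse.

Lemma Sm_sum {R : realType} (V W : normedModType R) k K (U : set V) n (F : 'I_n -> V -> W) :
  open U -> (forall j, Sm k K U (F j)) -> Sm k (n%:R * K) U (fun x => \sum_j F j x).
Proof.
move=> oU; elim: n F => [|n IH] F hF.
  apply: (@Sm_ext _ _ _ _ _ _ (fun _ => 0)) => //; first by move=> y _; rewrite big_ord0.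
  by apply: Sm_cst => //; rewrite normr0 mul0r.
apply: (@Sm_ext _ _ _ _ _ _ (fun x => F ord0 x + \sum_(j < n) F (lift ord0 j) x)) => //.
  by move=> y _; rewrite big_ord_recl.
rewrite -natr1 mulrDl mul1r addrC; apply: Sm_add => //.
exact: (IH (fun j => F (lift ord0 j))).
Qed.

Lemma D_lip {R : realType} (V E : normedModType R) (dotp : {dot E for idfun}) (f : V -> E) K a b :
  (forall x : E, dotp x x = `|x| ^+ 2) -> 0 <= K -> Sm 2 K setT f -> `|D f a - D f b| <= K * `|a - b|.
Proof.
move=> dotpE K0 [_ _ h]; apply: blin_lub => [|v]; first by rewrite mulr_ge0.
have e z : D f z v = eval_blin E v (D f z) by rewrite eval_blinE.
rewrite blin_add blin_opp !e mulrAC.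
have h1 := Sm_lin (eval_blin E v) (@openT V) K0 (h : Sm 1 K setT (D f)).
apply: (le_trans (Sm_lip a b dotpE h1)).
by rewrite ler_wpM2r// mulrC ler_wpM2l// eval_blin_norm.
Qed.

(** The mean value inequality for [f - D f x], whose derivative along the segment is at most [K]
    times the length of the segment; this yields [K] in place of [K / 2]. *)
Lemma taylor_quadratic {R : realType} (V E : normedModType R) (dotp : {dot E for idfun})
    (f : V -> E) (K : R) x y :
  (forall x : E, dotp x x = `|x| ^+ 2) -> 0 <= K -> Sm 2 K setT f ->
  `|f y - f x - D f x (y - x)| <= K * `|y - x| ^+ 2.
Proof.
move=> dotpE K0 hf; have L := fun z z' => D_lip z z' dotpE K0 hf.
case: hf => _ h1 _; set h := y - x.
have bA : bounded_linear (fun v : V => - D f x v).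
  split; first by move=> a u v; rewrite blinD blinZ; vring R E.
  by exists `|D f x| => v; rewrite normrN blin_ub.
pose g z := f z + - D f x z.
have hg z : hasd g z (D f z - D f x).
  by apply: hasd_add; [exact: h1|exact: (@hasd_lin _ _ _ (- D f x))].
have -> : f y - f x - D f x h = g (x + h) - g x.
  rewrite /g /h [x + _]addrC subrK blinB; vring R E.
apply: (hasd_mean_value (A := fun t => D f (x + t *: h) - D f x) dotpE) => [t _|t /andP[t0 t1]].
  exact: hg.
rewrite (le_trans (blin_ub _ _))// expr2 mulrA ler_wpM2r// (le_trans (L _ _))// ler_wpM2l//.
by rewrite addrC addKr normrZ ger0_norm// ler_piMl.
Qed.

Section Chart.
Context {R : realType} {E : completeNormedModType R} (dotp : {dot E for idfun}) (n : nat).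
Hypothesis dotpE : forall x : E, dotp x x = `|x| ^+ 2.
Variables (f : frame (E := E) n) (x : E) (d : R) (u : E -> E).

Local Notation P := (aproj dotp f).
Local Notation pi := (proj dotp f.2).

(** For [a] in the plane, [a + d *: u a] lies above [a + tangential_shift a]. Inverting this
    near-identity map by [unshift] turns the parametrized surface into the graph of
    [d *: height]. *)
Definition tangential_shift (z : E) : E := d *: pi (u (P z)).
Definition unshift : E -> E := inv_near_id tangential_shift.
Definition height (z : E) : E := u (P (unshift (P z))) - pi (u (P (unshift (P z)))).
Definition graph (z : E) : E := P z + d *: height z.
(** The adjoint of the derivative of [height], applied to the normal vector [w - P w] and written in
    the orthonormal basis of the plane. *)
Definition tilt (w : E) : E := \sum_j dotp (w - P w) (D height (P w) (f.2 j)) *: f.2 j.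
(** [tilt] is controlled only on bounded sets, so it is cut off to make [normal_shift] globally
    small; the value is 1 within 1/2 of [x], where the feet of interest lie. *)
Definition cut (w : E) : R := bump dotp (1 / 2) 1 (w - x).
(* [normal_shift b + nu] is the point with foot [graph b] and normal vector
   [nu - d (height' b)^* nu], so inverting [id + normal_shift] gives the normal projection. *)
Definition normal_shift (w : E) : E := d *: (height w - cut w *: tilt w).
Definition foot : E -> E := inv_near_id normal_shift.
Definition nproj (z : E) : E := graph (foot z).
(** The deviation of [nproj] from [P], divided by [d], as a function of the foot. The sign of [tilt]
    is opposite to that in [normal_shift] because [P z = P w - d *: (cut w *: tilt w)] is solved for
    [P w]. *)
Definition nproj_corr (w : E) : E := height w + cut w *: tilt w.

Variable KU : nat -> R.

Definition K_unshift k := diffeo_bound k (comp_bound k (KU k) 1).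
Definition K_height k :=
  comp_bound k (KU k) (comp_bound k 1 (comp_bound k (K_unshift k) 1)) +
  comp_bound k (KU k) (comp_bound k 1 (comp_bound k (K_unshift k) 1)).
(** 3 bounds the norm of [w - P w] for [w] within 2 of [x]; the order [k.+1] accounts for the
    derivative of [height] inside [tilt]. *)
Definition K_tilt k := n%:R * (2 ^+ k * (1 * 3 * comp_bound k (K_height k.+1) 1)).
Definition K_shift (KB : nat -> R) k := K_height k + 2 ^+ k * (1 * KB k * K_tilt k).
Definition K_corr (KB : nat -> R) k := comp_bound k (K_shift KB k) (diffeo_bound k (K_shift KB k)).

Hypothesis KU0 : forall k, 0 <= KU k.

Lemma K_unshift_ge0 k : 0 <= K_unshift k.
Proof. by apply: diffeo_bound_ge0; exact: comp_bound_ge0. Qed.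

Lemma K_height_ge0 k : 0 <= K_height k.
Proof. by rewrite addr_ge0// comp_bound_ge0// comp_bound_ge0// comp_bound_ge0// K_unshift_ge0. Qed.

Lemma K_tilt_ge0 k : 0 <= K_tilt k.
Proof.
by rewrite /K_tilt !mulr_ge0// ?exprn_ge0// comp_bound_ge0// K_height_ge0.
Qed.

Lemma K_shift_ge0 KB k : (forall k, 0 <= KB k) -> 0 <= K_shift KB k.
Proof.
by move=> h; rewrite addr_ge0 ?K_height_ge0// mulr_ge0 ?exprn_ge0// mulr_ge0 ?K_tilt_ge0// mulr_ge0.
Qed.

Hypotheses (hf : framed dotp f) (d0 : 0 < d) (d1 : d <= 1).
Hypothesis hu : forall k, Sm k (KU k) setT u.
Hypothesis small1 : d * comp_bound 1 (KU 1) 1 <= 2^-1.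
Hypothesis xP : `|P x - x| <= 1.

Let oT : open [set: E]. Proof. exact: openT. Qed.

Lemma Sm_proj k K (U : set E) (g : E -> E) : open U -> 0 <= K -> Sm k K U g -> Sm k K U (fun z => pi (g z)).
Proof.
move=> oU K0 hg; have h := Sm_lin (projb dotp f.2) oU K0 hg.
apply: (@Sm_ext _ _ _ _ _ _ (fun z => projb dotp f.2 (g z))) => //.
  by move=> y _; rewrite projbE.
by apply: Sm_le h; rewrite ler_piMl// projb_norm.
Qed.

Lemma tangential_shift_Sm k : Sm k (d * comp_bound k (KU k) 1) setT tangential_shift.
Proof.
have c0 := comp_bound_ge0 k (KU0 k) (@ler01 R).
rewrite -{1}(gtr0_norm d0); apply: Sm_scale => //; apply: Sm_proj => //.
by apply: (@Sm_comp _ _ _ _ _ _ _ _ setT) => //; exact: DSm_aproj.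
Qed.

Let ts1 : Sm 1 2^-1 setT tangential_shift.
Proof. by apply: Sm_le (tangential_shift_Sm 1). Qed.

Lemma unshift_DSm k : DSm k (K_unshift k) setT unshift.
Proof.
have c0 := comp_bound_ge0 k (KU0 k) (@ler01 R).
apply: inv_near_id_DSm => //; have [_ h] := (SmE _ _ _ _).1 (tangential_shift_Sm k).
by apply: DSm_le h; rewrite ler_piMl.
Qed.

Lemma height_Sm k : Sm k (K_height k) setT height.
Proof.
have h0 := K_unshift_ge0 k.
have h1 : 0 <= comp_bound k (K_unshift k) 1 by exact: comp_bound_ge0.
have h2 : 0 <= comp_bound k 1 (comp_bound k (K_unshift k) 1) by exact: comp_bound_ge0.
have c0 := comp_bound_ge0 k (KU0 k) h2.
have hv : Sm k (comp_bound k (KU k) (comp_bound k 1 (comp_bound k (K_unshift k) 1))) setT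
    (fun z => u (P (unshift (P z)))).
  apply: (@Sm_comp _ _ _ _ _ _ _ _ setT) => //.
  apply: (@DSm_comp _ _ _ _ _ _ _ _ setT (P)) => //; first exact: DSm_aproj.
  apply: (@DSm_comp _ _ _ _ _ _ _ _ setT unshift) => //; first exact: unshift_DSm.
  exact: DSm_aproj.
by apply: Sm_add => //; apply: Sm_opp => //; exact: Sm_proj.
Qed.

Lemma proj_height z : pi (height z) = 0.
Proof. by rewrite /height projB projK// subrr. Qed.

Lemma height_aproj z : height (P z) = height z.
Proof. by rewrite /height aprojK. Qed.

Lemma aproj_graph z : P (graph z) = P z.
Proof. by rewrite /graph aprojD aprojK// projZ proj_height scaler0 addr0. Qed.

Lemma graph_aproj z : graph (P z) = graph z.
Proof. by rewrite /graph aprojK// height_aproj. Qed.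

Lemma graph_shift a : P a = a -> graph (a + d *: u a) = a + d *: u a.
Proof.
move=> Pa.
have Pb : P (a + d *: u a) = a + tangential_shift a by rewrite aprojD Pa projZ /tangential_shift Pa.
have G : unshift (P (a + d *: u a)) = a by apply: inv_near_id_eq.
by rewrite /graph /height G Pb /tangential_shift Pa; vring R E.
Qed.

(** With [graph_shift] this identifies the fixed points of [graph] with the points [a + d *: u a]
    over the plane, so membership in the surface becomes an equation. *)
Lemma graph_inv p : graph p = p -> exists a, P a = a /\ p = a + d *: u a.
Proof.
move=> gp; pose a := unshift (P p).
have aE : a + tangential_shift a = P p by exact: inv_near_idE.
have Pa : P a = a.
  have -> : a = P p + - tangential_shift a by rewrite -aE; vring R E.
  by rewrite aprojD aprojK// projN {1}/tangential_shift projZ projK.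
exists a; split=> //.
rewrite -{1}gp /graph /height -/a -aE /tangential_shift Pa; vring R E.
Qed.

Variable KB : nat -> R.
Hypothesis KB0 : forall k, 0 <= KB k.
Hypothesis hB : forall k, Sm k (KB k) setT cut.
Hypothesis small2 : d * K_shift KB 1 <= 2^-1.

Lemma ne j : `|f.2 j| = 1.
Proof. by apply/eqP; rewrite -(@eqrXn2 _ 2)// ?expr1n -?dotpE ?hf ?eqxx. Qed.

Let U1 : set E := [set w | `|w - x| < 2].

Lemma tilt_Sm k : Sm k (K_tilt k) U1 tilt.
Proof.
have oU1 : open U1.
  apply: (@open_comp _ _ (fun z => `|z - x|) [set y | y < 2]); last exact: open_lt.
  by move=> z _; apply: cvg_norm; apply: cvgB; [exact: cvg_id|exact: cvg_cst].
have c0 := comp_bound_ge0 k (K_height_ge0 k.+1) (@ler01 R).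
have hN : Sm k 3 U1 (fun w => w - P w).
  apply/SmE; split.
    move=> w wx; rewrite distrC (le_trans (aproj_dist dotpE w x hf))//.
    by have wx' : `|w - x| < 2 := wx; have := xP; lra.
  have bQ : bounded_linear (fun v => v - pi v).
    split; first by move=> a v w; rewrite projD projZ; vring R E.
    by exists 1 => v; rewrite mul1r projQ_le.
  apply: (@DSm_ext _ _ _ _ _ _ (fun w => mkblin (fun v => v - pi v) w + (pi f.1 - f.1))) => //.
    by move=> w _; rewrite (mkblinE bQ) /aproj projB; vring R E.
  apply: (@DSm_sub _ _ _ _ _ setT) => //; apply: DSm_affine.
  apply: blin_lub => // v; rewrite (mkblinE bQ).
  by rewrite (le_trans (projQ_le dotpE hf v))// ler_peMl// ler1n.
apply: Sm_sum => // j.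
have ej : Sm k (comp_bound k (K_height k.+1) 1) U1 (fun w => D height (P w) (f.2 j)).
  apply: (@Sm_ext _ _ _ _ _ _ (fun w => eval_blin E (f.2 j) (D height (P w)))) => //.
    by move=> w _; rewrite eval_blinE.
  apply: (@Sm_le _ _ _ _ (`|eval_blin E (f.2 j)| * comp_bound k (K_height k.+1) 1)).
    by rewrite ler_piMl// (le_trans (eval_blin_norm _ _))// ne.
  apply: Sm_lin => //; apply: (@Sm_comp _ _ _ _ _ _ _ _ setT) => //.
  - exact: K_height_ge0.
  - by have [] := height_Sm k.+1.
  - by apply: (@DSm_sub _ _ _ _ _ setT) => //; exact: DSm_aproj.
have := Sm_bilin oU1 ler01 (ler0n R 3) c0 (dotp_bilin dotpE) hN ej.
move=> h; have := @Sm_line _ _ _ _ _ _ (f.2 j) _ oU1 _ h.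
by rewrite ne [1 * (2 ^+ k * _)]mul1r; apply; rewrite mulr_ge0 ?exprn_ge0// mulr_ge0// mulr_ge0.
Qed.

Lemma cut_tilt_Sm k : Sm k (2 ^+ k * (1 * KB k * K_tilt k)) setT (fun w => cut w *: tilt w).
Proof.
have cf : continuous (fun z => `|z - x|).
  by move=> z; apply: cvg_norm; apply: cvgB; [exact: cvg_id|exact: cvg_cst].
apply: (@Sm_cutoff _ _ _ _ _ _ U1 [set w | 1 < `|w - x|]) => //.
- by apply: (@open_comp _ _ (fun z => `|z - x|) [set y | y < 2]); [move=> z _; exact: cf|exact: open_lt].
- by apply: (@open_comp _ _ (fun z => `|z - x|) [set y | 1 < y]); [move=> z _; exact: cf|exact: open_gt].
- apply/seteqP; split=> // w _; have [h|h] := ltP (`|w - x|) 2; [by left|right].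
  by apply: lt_le_trans h; rewrite ltr1n.
- exact: K_tilt_ge0.
- exact: tilt_Sm.
- move=> w /= /ltW wx; apply: (bump_out dotpE) => //; lra.
Qed.

Lemma nproj_corr_Sm0 k : Sm k (K_shift KB k) setT nproj_corr.
Proof. by apply: Sm_add => //; [exact: height_Sm|exact: cut_tilt_Sm]. Qed.

Lemma normal_shift_Sm k : Sm k (d * K_shift KB k) setT normal_shift.
Proof.
have c0 := K_shift_ge0 k KB0.
have t0 : 0 <= 2 ^+ k * (1 * KB k * K_tilt k).
  by rewrite mulr_ge0 ?exprn_ge0// mulr_ge0 ?K_tilt_ge0// mulr_ge0.
rewrite -{1}(gtr0_norm d0); apply: Sm_scale => //; apply: Sm_add => //; first exact: height_Sm.
by apply: Sm_opp => //; exact: cut_tilt_Sm.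
Qed.

Let ns1 : Sm 1 2^-1 setT normal_shift.
Proof. by apply: Sm_le (normal_shift_Sm 1). Qed.

Lemma foot_DSm k : DSm k (diffeo_bound k (K_shift KB k)) setT foot.
Proof.
have c0 := K_shift_ge0 k KB0.
apply: inv_near_id_DSm => //; have [_ h] := (SmE _ _ _ _).1 (normal_shift_Sm k).
by apply: DSm_le h; rewrite ler_piMl.
Qed.

Lemma footE z : foot z + normal_shift (foot z) = z.
Proof. exact: inv_near_idE. Qed.

Lemma foot_dist z : `|z - foot z| <= d * K_shift KB 1.
Proof.
rewrite -{1}(footE z) addrC addKr.
exact: Sm_bound (normal_shift_Sm 1) I.
Qed.

Lemma proj_tilt w : pi (tilt w) = tilt w.
Proof. exact: proj_span. Qed.

Lemma nprojE z : nproj z = P z + d *: nproj_corr (foot z).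
Proof.
have Pz : P z = P (foot z) - d *: (cut (foot z) *: tilt (foot z)).
  rewrite -{1}(footE z) aprojD /normal_shift projZ projB projZ proj_height proj_tilt; vring R E.
rewrite Pz /nproj /graph /nproj_corr; vring R E.
Qed.

Lemma nproj_corr_Sm k : Sm k (K_corr KB k) setT (fun z => nproj_corr (foot z)).
Proof.
have c0 := K_shift_ge0 k KB0.
apply: (@Sm_comp _ _ _ _ _ _ _ _ setT) => //; first exact: diffeo_bound_ge0.
  exact: nproj_corr_Sm0.
exact: foot_DSm.
Qed.

Lemma height_hasd z : hasd height z (D height z).
Proof. by have [_ h _] := height_Sm 1; exact: h. Qed.

Lemma proj_Dheight z v : pi (D height z v) = 0.
Proof.
have h1 : hasd (fun z => projb dotp f.2 (height z)) z (bcomp (projb dotp f.2) (D height z)).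
  exact: (hasd_comp (f := projb dotp f.2) (hasd_lin _ _) (height_hasd z)).
have h2 : hasd (fun z => projb dotp f.2 (height z)) z 0.
  rewrite (_ : (fun z => _) = fun _ => 0); first exact: hasd_cst.
  by apply/funext => y; rewrite projbE// proj_height.
have := hasd_uniq h1 h2 => /(congr1 (fun A : blin E E => A v)).
by rewrite bcompE projbE.
Qed.

Lemma Dheight_proj z v : D height z (pi v) = D height z v.
Proof.
have h1 : hasd (fun z => height (P z)) z (bcomp (D height (P z)) (projb dotp f.2)).
  exact: (hasd_comp (height_hasd (P z)) (hasd_aproj dotpE z hf)).
have hE : (fun z => height (P z)) = height by apply/funext => y; exact: height_aproj.
rewrite hE in h1.
by rewrite (hasdD h1) !bcompE !projbE// projK.
Qed.

(* The right side vanishes at [v = t + d (height' t)] with [t] in the plane: [z - nproj z] is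
   normal to the graph. *)
Lemma dotp_normal z v : `|foot z - x| <= 1 / 2 ->
  dotp (z - nproj z) v = dotp (foot z - P (foot z)) (v - pi v) -
    d * dotp (foot z - P (foot z)) (D height (P (foot z)) v).
Proof.
move=> zx; set w := foot z; set nu := w - P w; set A := D height (P w).
have zE : z - nproj z = nu - d *: tilt w.
  have half0 : 0 <= 1 / 2 :> R by lra.
  have half1 : 1 / 2 < 1 :> R by lra.
  rewrite -{1}(footE z) -/w /normal_shift /cut (bump_in dotpE half0 half1 zx) /nproj -/w /graph /nu.
  vring R E.
rewrite zE dotpBl dotpZl; congr (_ - _ * _).
  have pn : pi nu = 0 by exact: proj_aprojQ.
  by rewrite dotpBr -dotp_projC pn dotp0l subr0.
rewrite /tilt -/nu -/A dotp_suml -Dheight_proj /proj.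
have AE (I : Type) (r : seq I) (t : I -> R) (g : I -> E) :
    A (\sum_(i <- r) t i *: g i) = \sum_(i <- r) t i *: A (g i).
  elim/big_rec2: _ => [|i y1 y2 _ <-]; first exact: blin0.
  by rewrite blinD blinZ.
rewrite AE dotp_sumr; apply: eq_bigr => j _.
by rewrite dotpZl dotpZr [dotp v _]dotpC mulrC.
Qed.

Lemma dotp_normal_tangent z t : `|foot z - x| <= 1 / 2 -> pi t = t ->
  dotp (z - nproj z) (t + d *: D height (P (foot z)) t) = 0.
Proof.
move=> zx pt; rewrite (dotp_normal _ zx) projD projZ proj_Dheight pt scaler0 addr0.
have -> : t + d *: D height (P (foot z)) t - t = d *: D height (P (foot z)) t by vring R E.
rewrite blinD blinZ dotpDr !dotpZr.
have -> : D height (P (foot z)) (D height (P (foot z)) t) = 0.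
  by rewrite -Dheight_proj proj_Dheight blin0.
by rewrite dotp0r mulr0 addr0 subrr.
Qed.

Lemma height_taylor z z' : `|height z' - height z - D height z (z' - z)| <= K_height 2 * `|z' - z| ^+ 2.
Proof.
exact: (taylor_quadratic z z' dotpE (K_height_ge0 2) (height_Sm 2)).
Qed.

Lemma height_le z : `|height z| <= K_height 1.
Proof. exact: Sm_bound (height_Sm 1) I. Qed.

Lemma Dheight_le z : `|D height z| <= K_height 1.
Proof. by have [_ _ h] := height_Sm 1; exact: h. Qed.

Lemma K_height_shift : K_height 1 <= K_shift KB 1.
Proof. by rewrite lerDl mulr_ge0 ?exprn_ge0// mulr_ge0 ?K_tilt_ge0// mulr_ge0. Qed.

Lemma hasd_graph z : hasd graph z (projb dotp f.2 + d *: D height z).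
Proof.
apply: hasd_add; first exact: hasd_aproj.
have bd := bounded_linear_scale E d.
have h := hasd_comp (f := mkblin (fun v : E => d *: v)) (hasd_lin _ _) (height_hasd z).
have -> : d *: D height z = bcomp (mkblin (fun v : E => d *: v)) (D height z).
  by apply: blinP => v; rewrite bcompE (mkblinE bd).
have gE : (mkblin (fun v : E => d *: v) \o height) = (fun z => d *: height z).
  by apply/funext => y; rewrite /= (mkblinE bd).
by rewrite gE in h.
Qed.

Lemma foot_hasd z : hasd foot z (D foot z).
Proof. by have [h _] := foot_DSm 1; exact: h. Qed.

Lemma nproj_hasd z : hasd nproj z (bcomp (projb dotp f.2 + d *: D height (foot z)) (D foot z)).
Proof. exact: (hasd_comp (f := graph) (hasd_graph _) (foot_hasd z)). Qed.

Lemma Dheight_aproj z v : D height (P z) v = D height z v.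
Proof.
have h1 : hasd (fun z => height (P z)) z (bcomp (D height (P z)) (projb dotp f.2)).
  exact: (hasd_comp (height_hasd (P z)) (hasd_aproj dotpE z hf)).
have hE : (fun z => height (P z)) = height by apply/funext => y; exact: height_aproj.
rewrite hE in h1.
by rewrite (hasdD h1) bcompE projbE// Dheight_proj.
Qed.

Definition tangent_at (b : E) : set E := [set t + d *: D height b t | t in [set t | pi t = t]].

Lemma Dnproj_tangent z v : tangent_at (P (foot z)) (D nproj z v).
Proof.
rewrite (hasdD (nproj_hasd z)) bcompE blin_add blin_scale projbE//.
exists (pi (D foot z v)); first by rewrite /= projK.
by rewrite Dheight_proj Dheight_aproj.
Qed.

(** The identity that [z - nproj z] is orthogonal to the moving tangent vector [g z] is
    differentiated at the fixed point [y]. The term with the derivative of [g] carries the factor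
    [y - nproj y = 0]. *)
Lemma Dnproj_normal y v t : nproj y = y -> `|foot y - x| < 1 / 2 -> tangent_at (P (foot y)) t ->
  dotp (v - D nproj y v) t = 0.
Proof.
move=> ny yx [t0 /= pt0 <-].
pose g z := t0 + d *: D height (P (foot z)) t0.
have cg : continuous (fun z => `|foot z - x|).
  move=> z; apply: cvg_norm; apply: cvgB; last exact: cvg_cst.
  exact: hasd_continuous (foot_hasd z).
have oU : open [set z : E | `|foot z - x| < 1 / 2].
  apply: (@open_comp _ _ (fun z => `|foot z - x|) [set y | y < 1 / 2]); last exact: open_lt.
  by move=> z _; exact: cg.
have [B hB'] : exists B, hasd g y B.
  have [_ _ [_ hD _]] := height_Sm 2.
  have h1 := hasd_comp (f := P) (hasd_aproj dotpE _ hf) (foot_hasd y).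
  have h2 := hasd_comp (f := D height) (hD _ I) h1.
  have h3 := hasd_comp (f := eval_blin E (d *: t0)) (hasd_lin _ _) h2.
  have h4 := hasd_add (hasd_cst t0 y) h3.
  exists (0 + bcomp (eval_blin E (d *: t0)) (bcomp (D (D height) ((P \o foot) y)) (bcomp (projb dotp f.2) (D foot y)))).
  have gE : g = fun z => t0 + (eval_blin E (d *: t0) \o (D height \o (P \o foot))) z.
    by apply/funext => z; rewrite /g /= eval_blinE blinZ.
  by rewrite gE.
have bN : hasd (fun z => z - nproj z) y (id_blin - D nproj y).
  apply: (@hasd_near _ _ _ (fun z => id_blin z + - nproj z)); first by rewrite id_blinE.
    by near=> h; rewrite id_blinE.
  apply: hasd_add; first exact: hasd_lin.
  have h0 : D nproj y = bcomp (projb dotp f.2 + d *: D height (foot y)) (D foot y) by apply: hasdD; exact: nproj_hasd.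
  move=> e e0; have := nproj_hasd y e0; rewrite -h0; apply: filterS => h.
  by rewrite blin_opp -!opprD normrN.
have h := hasd_bilin ler01 (dotp_bilin dotpE) bN hB'.
have h' : hasd (fun z => dotp (z - nproj z) (g z) : R) y 0.
  apply: (@hasd_near _ _ _ (fun _ => 0)); last exact: hasd_cst.
    by rewrite ny subrr dotp0l.
  near=> h0; rewrite dotp_normal_tangent//; apply: ltW; near: h0.
  exact: (open_shift oU).
have := hasd_uniq h h' => /(congr1 (fun A : blin E R => A v)).
rewrite blin_add (bilin_lift_lE _ _ _ ler01 (dotp_bilin dotpE)).
rewrite (bilin_lift_rE _ _ _ ler01 (dotp_bilin dotpE)) ny subrr dotp0l addr0.
by rewrite blin_add blin_opp id_blinE.
Unshelve. all: by end_near. Qed.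

End Chart.

Section Coordinates.
Context {R : realType} {E : completeNormedModType R} (dotp : {dot E for idfun}) (n : nat).
Hypothesis dotpE : forall x : E, dotp x x = `|x| ^+ 2.
Variable e : 'I_n -> E.
Hypothesis one : orthonormal dotp e.

Definition span_map (t : 'rV[R]_n) : E := \sum_i t 0 i *: e i.
Definition coords (v : E) : 'rV[R]_n := \row_i dotp v (e i).

Lemma norm_coord_le (t : 'rV[R]_n) i : `|t 0 i| <= `|t|.
Proof.
rewrite [leRHS]mx_normrE.
exact: (le_trans _ (le_bigmax _ (fun i : 'I_1 * 'I_n => `|t i.1 i.2|) (0, i))).
Qed.

Lemma orthonormal_norm i : `|e i| = 1.
Proof. by apply/eqP; rewrite -sqrp_eq1// -dotpE one eqxx. Qed.

Lemma bounded_linear_span_map : bounded_linear span_map.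
Proof.
split=> [a u v|].
  rewrite /span_map scaler_sumr -big_split; apply: eq_bigr => i _ /=.
  by rewrite !mxE scalerDl scalerA.
exists n%:R => t; rewrite (le_trans (ler_norm_sum _ _ _))//.
rewrite (_ : n%:R * `|t| = \sum_(i < n) `|t|); last by rewrite sumr_const card_ord mulr_natl.
apply: ler_sum => i _.
by rewrite normrZ orthonormal_norm mulr1 norm_coord_le.
Qed.

Lemma bounded_linear_coords : bounded_linear coords.
Proof.
split=> [a u v|]; first by apply/rowP => i; rewrite !mxE dotpDl dotpZl.
exists 1 => v; rewrite mul1r [leLHS]mx_normrE; apply/bigmax_leP; split=> //= -[i j] _ /=.
by rewrite mxE (le_trans (dotp_le dotpE _ _))// orthonormal_norm mulr1.
Qed.

Lemma coords_span_map t : coords (span_map t) = t.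
Proof. by apply/rowP => i; rewrite mxE dotp_span. Qed.

Lemma span_map_coords v : span_map (coords v) = proj dotp e v.
Proof. by apply: eq_bigr => i _; rewrite mxE. Qed.

Lemma proj_span_map t : proj dotp e (span_map t) = span_map t.
Proof. exact: proj_span. Qed.

Lemma coords_proj v : coords (proj dotp e v) = coords v.
Proof. by apply/rowP => i; rewrite !mxE dotp_proj_e. Qed.

End Coordinates.

(** Stronger than [local_param]: the bounds hold on all of [V], and the inverse extends to a
    continuous map on [E]. This form is easy to rescale. *)
Definition smooth_param {R : realType} {E : normedModType R} n (M : set E) (V : set 'rV[R]_n)
    (O : set E) (phi : 'rV[R]_n -> E) : Prop :=
  [/\ open V /\ forall k, exists2 K, 0 <= K & DSm k K V phi, open O, phi @` V = M `&` O,
      forall a h, V a -> D phi a h = 0 -> h = 0 &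
      exists2 psi : E -> 'rV[R]_n, forall a, V a -> psi (phi a) = a & continuous psi].

(** * The reconstructed manifold *)

Section Reconstruction.
Context {R : realType} {E : completeNormedModType R} (dotp : {dot E for idfun}) (n : nat).
Hypothesis dotpE : forall x : E, dotp x x = `|x| ^+ 2.
Variables (X : set E) (fr : E -> frame (E := E) n) (eps d : R).
Hypothesis flat : nearly_flat dotp X fr eps d.

Local Notation P x := (aproj dotp (fr x)).
Local Notation pi x := (proj dotp (fr x).2).

(** From here on the flattening is known only through [F_local], [F_transfer] and the bounds on [u].
    The smallness conditions involve derivatives of order at most two. *)
Variables (F : E -> E) (u : E -> E -> E) (KU KB : nat -> R).
Hypothesis F_local : forall x a, X x -> P x a = a -> `|a - x| <= 19 / 100 -> F a = a + d *: u x a.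
Hypothesis F_transfer : forall x x' a, X x -> X x' -> P x a = a ->
  `|a - x| <= 17 / 100 -> `|a - x'| <= 17 / 100 ->
  exists a', [/\ P x' a' = a', `|a' - a| <= 200 * d + 4 * (d * KU 1) & F a' = F a].
Hypothesis u_Sm : forall x k, X x -> Sm k (KU k) setT (u x).
Hypotheses (KU0 : forall k, 0 <= KU k) (KB0 : forall k, 0 <= KB k).
Hypothesis cut_Sm : forall x k, X x -> Sm k (KB k) setT (cut dotp x).
Hypothesis small0 : 100 * (100 * (100 * (100 * (d + d * KU 1)))) <= 1.
Hypothesis small1 : d * comp_bound 1 (KU 1) 1 <= 2^-1.
Hypothesis small2 : 100 * (100 * (100 * (100 * (d * K_shift n KU KB 1)))) <= 1.
Hypothesis small3 : d * K_height KU 2 <= 4^-1.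

Local Notation gr x := (graph dotp (fr x) d (u x)).
Local Notation np x := (nproj dotp (fr x) x d (u x)).
Local Notation ft x := (foot dotp (fr x) x d (u x)).
Local Notation ht x := (height dotp (fr x) d (u x)).

(** The radius 11/100 exceeds [eps + 3 * d], so a point of a somewhat larger disc can be transferred
    to the small disc of some point of [X]. *)
Definition rec_manifold : set E :=
  [set p | exists x a, [/\ X x, P x a = a, `|a - x| < 11 / 100 & p = F a]].

Let Xfr x : X x -> framed dotp (fr x). Proof. by case: flat => h _ _ _; exact: h. Qed.
Let XP x y : X x -> X y -> `|y - x| < 1 -> `|P x y - y| <= 2 * d.
Proof. by case: flat => _ h _ _; exact: h. Qed.
Let XPx x : X x -> `|P x x - x| <= 2 * d.
Proof. by move=> Xx; apply: XP => //; rewrite subrr normr0. Qed.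
Let XQ x a : X x -> P x a = a -> `|a - x| < 1 -> exists q, [/\ X q, `|q - x| < 1 & `|a - q| <= eps + 3 * d].
Proof. by case: flat => _ _ h _; exact: h. Qed.
Let d0 : 0 < d. Proof. by case: flat => _ _ _ []. Qed.
Let dK0 : 0 <= d * KU 1. Proof. by rewrite mulr_ge0// ltW. Qed.
Let KS0 : 0 <= K_shift n KU KB 1. Proof. exact: K_shift_ge0. Qed.
Let dS0 : 0 <= d * K_shift n KU KB 1. Proof. by rewrite mulr_ge0// ltW. Qed.
Let d1 : d <= 1. Proof. have := small0; have := dK0; have := d0; lra. Qed.
Let small2' : d * K_shift n KU KB 1 <= 2^-1. Proof. have := small2; have := dS0; lra. Qed.
Let xP1 x : X x -> `|P x x - x| <= 1.
Proof. move=> Xx; have := XPx Xx; have := small0; have := dK0; have := d0; lra. Qed.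

Lemma offset_norm x z : X x -> `|d *: u x z| <= d * KU 1.
Proof. by move=> Xx; rewrite normrZ gtr0_norm// ler_pM2l//; exact: Sm_bound (u_Sm 1 Xx) I. Qed.

Lemma manifold_near p : rec_manifold p -> exists x a,
  [/\ X x, P x a = a, `|a - x| < 11 / 100, p = F a & `|p - a| <= d * KU 1].
Proof.
have := small0; have := dK0; have := d0 => d0' dK0' s0.
move=> [x [a [Xx Pa ax pE]]]; exists x, a; split=> //.
rewrite pE (F_local Xx Pa); last by lra.
by rewrite [a + _]addrC addrK; exact: offset_norm.
Qed.

Lemma manifold_center p : rec_manifold p -> exists x, X x /\ `|p - x| < 12 / 100.
Proof.
have := small0; have := dK0; have := d0 => d0' dK0' s0.
move=> /manifold_near [x [a [Xx Pa ax _ pa]]]; exists x; split=> //.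
have -> : p - x = (p - a) + (a - x) by vring R E.
by rewrite (le_lt_trans (ler_normD _ _))//; lra.
Qed.

(** Both directions are transfers: a point of another disc is moved to the plane of [x], and the
    preimage of a graph point is moved to the small disc of a nearby point [q] of [X]. *)
Lemma manifold_graph x p : X x -> `|p - x| < 15 / 100 -> (rec_manifold p <-> gr x p = p).
Proof.
have := small0; have := dK0; have := d0 => d0' dK0' s0.
have [_ _ _ [_ dl eps0 eps1]] := flat.
move=> Xx px; split.
  move=> /manifold_near [x0 [a0 [Xx0 Pa0 ax0 pE pa0]]].
  have a0x : `|a0 - x| <= 17 / 100.
    have -> : a0 - x = (p - x) - (p - a0) by vring R E.
    by rewrite (le_trans (ler_normB _ _))//; lra.
  have [|a [Pa aa0 Fa]] := F_transfer Xx0 Xx Pa0 _ a0x; first by lra.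
  have ax : `|a - x| <= 19 / 100.
    have -> : a - x = (a - a0) + (p - x) - (p - a0) by vring R E.
    rewrite (le_trans (ler_normB _ _))//; have := ler_normD (a - a0) (p - x); lra.
  have -> : p = a + d *: u x a by rewrite pE -Fa; exact: F_local.
  apply: (graph_shift dotpE KU0) => //; first exact: Xfr.
  by move=> k; exact: u_Sm.
move=> gp; have hf := Xfr Xx.
have [a [Pa pE]] := graph_inv dotpE KU0 hf d0 (fun k => u_Sm k Xx) small1 gp.
have pa : `|p - a| <= d * KU 1 by rewrite pE [a + _]addrC addrK; exact: offset_norm.
have ax : `|a - x| <= 17 / 100.
  have -> : a - x = (p - x) - (p - a) by vring R E.
  by rewrite (le_trans (ler_normB _ _))//; lra.
have [|q [Xq _ aq]] := XQ Xx Pa; first by lra.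
have aq' : `|a - q| <= 17 / 100 by lra.
have [a' [Pa' aa' Fa']] := F_transfer Xx Xq Pa ax aq'.
exists q, a'; split=> //.
  have -> : a' - q = (a' - a) + (a - q) by vring R E.
  by rewrite (le_lt_trans (ler_normD _ _))//; lra.
by rewrite Fa' pE; apply/esym/F_local => //; lra.
Qed.

Lemma graph_idem x z : X x -> gr x (gr x z) = gr x z.
Proof.
by move=> Xx; have hf := Xfr Xx; rewrite -(graph_aproj _ _ hf (gr x _)) (aproj_graph _ _ hf) (graph_aproj _ _ hf).
Qed.

Lemma graph_continuous x : X x -> continuous (gr x).
Proof.
move=> Xx z; apply: hasd_continuous.
apply: (hasd_graph dotpE KU0) => //; [exact: Xfr|by move=> k; exact: u_Sm].
Qed.

(** A limit point lies within 15/100 of some [x] in [X], and there the set is the fixed point set of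
    the continuous map [gr x]. *)
Lemma manifold_closed : closed rec_manifold.
Proof.
move=> p clp.
have e0 : 0 < 1 / 100 :> R by lra.
have [q [Mq /= pq]] := clp _ (nbhsx_ballx p _ e0).
rewrite -ball_normE /= in pq.
have [x [Xx qx]] := manifold_center Mq.
have px : `|p - x| < 15 / 100.
  have -> : p - x = (p - q) + (q - x) by vring R E.
  by rewrite (le_lt_trans (ler_normD _ _))//; lra.
apply/(manifold_graph Xx px).
have cl : closed [set y | `|gr x y - y| <= 0].
  apply: (@closed_comp _ _ (fun y => `|gr x y - y|) [set t | t <= 0]); last exact: closed_le.
  by move=> y _; apply: cvg_norm; apply: cvgB; [exact: graph_continuous|exact: cvg_id].
suff : [set y | `|gr x y - y| <= 0] p by rewrite /= normr_le0 subr_eq0 => /eqP.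
apply: cl => B nB.
have oU : open [set y : E | `|y - x| < 15 / 100].
  apply: (@open_comp _ _ (fun z : E => `|z - x|) [set y | y < 15 / 100]); last exact: open_lt.
  by move=> z _; apply: cvg_norm; apply: cvgB; [exact: cvg_id|exact: cvg_cst].
have nB' : nbhs p (B `&` [set y : E | `|y - x| < 15 / 100]).
  by apply: filterI => //; apply: open_nbhs_nbhs; split.
have [y [My [By yx]]] := clp _ nB'.
by exists y; split=> //=; rewrite normr_le0 subr_eq0; apply/eqP/(manifold_graph Xx yx).
Qed.

Lemma manifold_height x p : X x -> `|p - x| < 15 / 100 -> rec_manifold p -> p = P x p + d *: ht x p.
Proof. by move=> Xx px /(manifold_graph Xx px) {1}<-. Qed.

(** Short along the plane, where the graph description holds, and long in the normal direction:
    34/100 exceeds the radius 1/3 of the tube. *)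
Definition chart_dom (x : E) : set E := [set z | `|P x z - x| < 13 / 100 /\ `|z - P x z| < 34 / 100].

Lemma chart_dom_open x : X x -> open (chart_dom x).
Proof.
move=> Xx; have hf := Xfr Xx; apply: openI.
  apply: (@open_comp _ _ (fun z => `|P x z - x|) [set y | y < 13 / 100]); last exact: open_lt.
  by move=> z _; exact: dist_aproj_continuous.
apply: (@open_comp _ _ (fun z => `|z - P x z|) [set y | y < 34 / 100]); last exact: open_lt.
move=> z _; apply: cvg_norm; apply: cvgB; first exact: cvg_id.
exact: hasd_continuous (hasd_aproj dotpE z hf).
Qed.

Lemma height_norm x z : X x -> `|d *: ht x z| <= d * K_shift n KU KB 1.
Proof.
move=> Xx; have hf := Xfr Xx; rewrite normrZ gtr0_norm// ler_pM2l//.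
apply: le_trans (K_height_shift n KU0 KB0).
by apply: (height_le dotpE KU0) => // k; exact: u_Sm.
Qed.

Lemma nproj_basic x z : X x -> chart_dom x z ->
  [/\ `|z - ft x z| <= d * K_shift n KU KB 1, `|ft x z - x| < 1 / 2,
      `|np x z - x| < 15 / 100 & rec_manifold (np x z)].
Proof.
have := small2; have := dS0; have := d0 => d0' dS0' s2.
move=> Xx [zx zp]; have hf := Xfr Xx.
have fd : `|z - ft x z| <= d * K_shift n KU KB 1.
  apply: (foot_dist dotpE KU0) => //; [by move=> k; exact: u_Sm|exact: xP1|by move=> k; exact: cut_Sm].
have fx : `|ft x z - x| < 1 / 2.
  have -> : ft x z - x = (P x z - x) + (z - P x z) - (z - ft x z) by vring R E.
  rewrite (le_lt_trans (ler_normB _ _))//; have := ler_normD (P x z - x) (z - P x z); lra.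
have nx : `|np x z - x| < 15 / 100.
  have -> : np x z - x = (P x z - x) - (P x z - P x (ft x z)) + d *: ht x (ft x z).
    by rewrite /nproj /graph; vring R E.
  rewrite (le_lt_trans (ler_normD _ _))//.
  have := ler_normB (P x z - x) (P x z - P x (ft x z)).
  have := aproj_lip dotpE z (ft x z) hf; have := height_norm (ft x z) Xx; lra.
split=> //; apply/(manifold_graph Xx nx).
exact: graph_idem.
Qed.

Lemma nproj_dist x z : X x -> chart_dom x z -> `|z - np x z| < 345 / 1000.
Proof.
have := small2; have := dS0; have := d0 => d0' dS0' s2.
move=> Xx Oz; have [zx zp] := Oz; have hf := Xfr Xx; have [fd _ _ _] := nproj_basic Xx Oz.
have -> : z - np x z = (z - P x z) + (P x z - P x (ft x z)) - d *: ht x (ft x z).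
  by rewrite /nproj /graph; vring R E.
rewrite (le_lt_trans (ler_normB _ _))//.
have := ler_normD (z - P x z) (P x z - P x (ft x z)).
have := aproj_lip dotpE z (ft x z) hf; have := height_norm (ft x z) Xx; lra.
Qed.

(** Serves for points too far from [x] for the graph description; 240 * 83/100 + 4 is below 210. *)
Lemma manifold_flat x p : X x -> rec_manifold p -> `|p - x| <= 83 / 100 ->
  `|p - P x p| <= 210 * d + d * KU 1.
Proof.
have := small0; have := dK0; have := d0 => d0' dK0' s0.
move=> Xx Mp px; have [x' [a [Xx' Pa ax' _ pa]]] := manifold_near Mp.
have hx' := Xfr Xx'.
have xx' : `|x - x'| <= 95 / 100.
  have -> : x - x' = (p - a) + (a - x') - (p - x) by vring R E.
  rewrite (le_trans (ler_normB _ _))//; have := ler_normD (p - a) (a - x'); lra.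
have h1 : `|P x' p - p| <= d * KU 1 by apply: le_trans pa; exact: aproj_near.
have h2 := aproj_close dotpE flat p Xx Xx' xx'.
have D240 : 0 <= 240 * d by lra.
have h3 : 240 * d * `|p - x| <= 240 * d * (83 / 100) by rewrite (ler_wpM2l D240).
have -> : p - P x p = - ((P x p - P x' p) + (P x' p - p)) by vring R E.
rewrite normrN (le_trans (ler_normD _ _))//; lra.
Qed.

(* Near [x] the quadratic bound is Taylor's formula for the graph; away from it
   the left side is [O(d)] while [y' - y] is bounded below. *)
Lemma nproj_secant x z y' : X x -> chart_dom x z -> rec_manifold y' -> `|y' - np x z| <= 69 / 100 ->
  dotp (z - np x z) (y' - np x z) <= 4^-1 * `|y' - np x z| ^+ 2.
Proof.
have := small0; have := dK0; have := d0 => d0' dK0' s0.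
have := small2; have := dS0 => dS0' s2.
move=> Xx Oz My' yy; have [zx zp] := Oz; have hf := Xfr Xx; have [fd fx nx My] := nproj_basic Xx Oz.
set y := np x z in yy nx My *; set w := ft x z in fd fx.
have yE : y = P x w + d *: ht x w by [].
have Py : P x y = P x w by exact: (aproj_graph _ _ hf).
have hu := fun k => u_Sm k Xx; have hc := fun k => cut_Sm k Xx.
have dn := dotp_normal dotpE KU0 hf d0 d1 hu small1 (xP1 Xx) KB0 hc small2' (y' - y) (ltW fx).
rewrite -/w -/y in dn.
have nu : `|w - P x w| <= 35 / 100.
  have -> : w - P x w = (z - P x z) - ((z - w) - pi x (z - w)) by rewrite -aprojB; vring R E.
  rewrite (le_trans (ler_normB _ _))//; have := projQ_le dotpE hf (z - w); lra.
have nuI v : dotp (w - P x w) v <= 35 / 100 * `|v|.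
  by rewrite (le_trans (ler_norm _))// (le_trans (dotp_le dotpE _ _))// ler_wpM2r.
have [y'x|y'x] := ltP (`|y' - x|) (15 / 100).
  have y'E := manifold_height Xx y'x My'.
  have pE : pi x (y' - y) = P x y' - P x w by rewrite -aprojB Py.
  have e1 : y' - y - pi x (y' - y) = d *: (ht x y' - ht x w).
    rewrite pE {1}y'E yE; vring R E.
  rewrite dn -(Dheight_proj dotpE KU0 hf d0 d1 hu small1) e1 dotpZr -mulrBr -dotpBr pE.
  have ta := height_taylor dotpE KU0 hf d0 d1 hu small1 (P x w) (P x y').
  rewrite !height_aproj// in ta.
  have h1 : d * dotp (w - P x w) (ht x y' - ht x w - D (ht x) (P x w) (P x y' - P x w)) <=
      d * (35 / 100 * (K_height KU 2 * `|P x y' - P x w| ^+ 2)).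
    by rewrite ler_pM2l// (le_trans (nuI _))// ler_wpM2l// ; lra.
  have h2 : `|P x y' - P x w| ^+ 2 <= `|y' - y| ^+ 2.
    by rewrite ler_pXn2r ?nnegrE// -pE proj_le.
  have h3 : d * K_height KU 2 * `|P x y' - P x w| ^+ 2 <= 4^-1 * `|y' - y| ^+ 2.
    by rewrite ler_pM ?exprn_ge0// mulr_ge0 ?K_height_ge0 ?ltW.
  have h4 : 0 <= d * K_height KU 2 * `|P x y' - P x w| ^+ 2.
    by rewrite mulr_ge0 ?exprn_ge0// mulr_ge0 ?K_height_ge0 ?ltW.
  lra.
have yx : `|y - x| <= 14 / 100.
  have -> : y - x = (P x z - x) - (P x z - P x w) + d *: ht x w by rewrite yE; vring R E.
  rewrite (le_trans (ler_normD _ _))//.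
  have := ler_normB (P x z - x) (P x z - P x w).
  have := aproj_lip dotpE z w hf; have := height_norm w Xx; rewrite -/w.
  lra.
have y'x2 : `|y' - x| <= 83 / 100.
  have -> : y' - x = (y' - y) + (y - x) by vring R E.
  by rewrite (le_trans (ler_normD _ _))//; lra.
(* [y'] is at least 15/100 and [y] at most 14/100 away from [x]. The square of 1/100 dominates the
   error terms, since [d], [d * KU 1] and [d * K_shift n KU KB 1] are at most 1e-8. *)
have far : 1 / 100 <= `|y' - y|.
  have : `|y' - x| <= `|y' - y| + `|y - x|.
    have {1}-> : y' - x = (y' - y) + (y - x) by vring R E.
    exact: ler_normD.
  lra.
have h1 : `|y' - y - pi x (y' - y)| <= 210 * d + d * KU 1 + d * K_shift n KU KB 1.
  have -> : y' - y - pi x (y' - y) = (y' - P x y') - (y - P x y) by rewrite -aprojB; vring R E.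
  rewrite (le_trans (ler_normB _ _))// lerD//; first exact: manifold_flat.
  have -> : y - P x y = d *: ht x w by rewrite Py yE; vring R E.
  exact: height_norm.
have h2 : - dotp (w - P x w) (D (ht x) (P x w) (y' - y)) <= K_shift n KU KB 1.
  rewrite -dotpNr (le_trans (nuI _))// normrN.
  have h3 : `|D (ht x) (P x w) (y' - y)| <= K_shift n KU KB 1 * `|y' - y|.
    rewrite (le_trans (blin_ub _ _))// ler_wpM2r//.
    apply: le_trans (K_height_shift n KU0 KB0).
    exact: (Dheight_le dotpE KU0 hf d0 d1 hu small1).
  have h4 : K_shift n KU KB 1 * `|y' - y| <= K_shift n KU KB 1 * (69 / 100) by rewrite ler_wpM2l.
  have := KS0; lra.
have h3 : - (d * dotp (w - P x w) (D (ht x) (P x w) (y' - y))) <= d * K_shift n KU KB 1.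
  by rewrite -mulrN ler_pM2l.
have h4 : (1 / 100) ^+ 2 <= `|y' - y| ^+ 2 by rewrite ler_pXn2r ?nnegrE//; lra.
have h5 := nuI (y' - y - pi x (y' - y)).
rewrite dn; lra.
Qed.

(** Expanding the square of [(z - y) - (y' - y)] and using [nproj_secant] leaves an excess of half
    the squared distance from [y] to [y'], which must vanish. The range 69/100 is twice 345/1000. *)
Lemma nproj_nearest x z y' : X x -> chart_dom x z -> rec_manifold y' ->
  `|z - y'| <= `|z - np x z| -> y' = np x z.
Proof.
move=> Xx Oz My' h; have nd := nproj_dist Xx Oz.
have := @nproj_secant x z y' Xx Oz My'.
set y := np x z in h nd *; move=> sec.
have e : y' - y = (z - y) - (z - y') by vring R E.
have yy : `|y' - y| <= 69 / 100.
  by rewrite e (le_trans (ler_normB _ _))//; lra.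
have := sec yy.
have h2 : `|z - y'| ^+ 2 <= `|z - y| ^+ 2 by rewrite ler_pXn2r ?nnegrE.
have e2 : z - y' = (z - y) + - (y' - y) by vring R E.
move: h2; rewrite e2 (normD_sqr dotpE) dotpNr normrN => h2 h3.
apply/eqP; rewrite -subr_eq0 -normr_eq0 -sqrf_eq0 eq_le sqr_ge0 andbT.
lra.
Qed.

(** The centre near [y] is replaced by a point of [X] close to the projection of [z], so that the
    offset along the plane becomes small. The excess of 337/1000 over 1/3 pays for the change of
    plane. *)
Lemma near_cover z y : rec_manifold y -> `|z - y| < 1 / 3 ->
  exists x, [/\ X x, `|P x z - x| < 11 / 100 & `|z - P x z| < 337 / 1000].
Proof.
have := small0; have := dK0; have := d0 => d0' dK0' s0.
have := small2; have := dS0 => dS0' s2.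
have [_ _ _ [_ _ _ eps1]] := flat.
move=> My zy; have [x0 [Xx0 yx0]] := manifold_center My; have hf0 := Xfr Xx0.
have yP : `|P x0 y - y| <= d * K_shift n KU KB 1.
  have e : y = P x0 y + d *: ht x0 y by apply: manifold_height => //; lra.
  have -> : P x0 y - y = - (d *: ht x0 y) by rewrite {2}e; vring R E.
  by rewrite normrN; exact: height_norm.
have zP : `|z - P x0 z| <= 335 / 1000.
  rewrite distrC; have := aproj_dist dotpE z y hf0; lra.
have px : `|P x0 z - x0| <= 456 / 1000.
  have -> : P x0 z - x0 = (P x0 z - P x0 y) + (P x0 y - y) + (y - x0) by vring R E.
  rewrite (le_trans (ler_normD _ _))//; have := ler_normD (P x0 z - P x0 y) (P x0 y - y).
  have := aproj_lip dotpE z y hf0; lra.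
have [|q [Xq _ pq]] := XQ Xx0 (aprojK z hf0); first by lra.
have qx : `|x0 - q| <= 95 / 100.
  have -> : x0 - q = (P x0 z - q) - (P x0 z - x0) by vring R E.
  by rewrite (le_trans (ler_normB _ _))//; lra.
have cl := aproj_close dotpE flat z Xx0 Xq qx.
have D240 : 0 <= 240 * d by lra.
have zx : 240 * d * `|z - x0| <= 240 * d * 1.
  rewrite (ler_wpM2l D240)//.
  have -> : z - x0 = (z - y) + (y - x0) by vring R E.
  by rewrite (le_trans (ler_normD _ _))//; lra.
exists q; split=> //.
  have -> : P q z - q = (P x0 z - q) - (P x0 z - P q z) by vring R E.
  by rewrite (le_lt_trans (ler_normB _ _))//; lra.
have -> : z - P q z = (z - P x0 z) + (P x0 z - P q z) by vring R E.
by rewrite (le_lt_trans (ler_normD _ _))//; lra.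
Qed.

(** The same chart must contain the projected point, because the derivative at [z] is later compared
    with the derivative at [np x z], where it is the tangent projector. *)
Lemma chart_cover z y : rec_manifold y -> `|z - y| < 1 / 3 ->
  exists x, [/\ X x, chart_dom x z & chart_dom x (np x z)].
Proof.
have := small2; have := dS0; have := d0 => d0' dS0' s2.
move=> My zy; have [x [Xx zx zp]] := near_cover My zy; have hf := Xfr Xx.
have Oz : chart_dom x z by split; lra.
have [fd _ _ _] := nproj_basic Xx Oz.
have Pn : P x (np x z) = P x (ft x z) by exact: (aproj_graph _ _ hf).
exists x; split=> //; split; rewrite /= Pn.
  have -> : P x (ft x z) - x = (P x z - x) - (P x z - P x (ft x z)) by vring R E.
  rewrite (le_lt_trans (ler_normB _ _))//; have := aproj_lip dotpE z (ft x z) hf; lra.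
have -> : np x z - P x (ft x z) = d *: ht x (ft x z) by rewrite /nproj /graph; vring R E.
have := height_norm (ft x z) Xx; lra.
Qed.

Lemma nproj_is_nearest x z : X x -> chart_dom x z ->
  is_nearest rec_manifold z (np x z) /\ forall y, is_nearest rec_manifold z y -> y = np x z.
Proof.
move=> Xx Oz; have [_ _ _ Mn] := nproj_basic Xx Oz; split.
  split=> // y My; rewrite leNgt; apply/negP => h.
  by have := h; rewrite -(nproj_nearest Xx Oz My (ltW h)) ltxx.
by move=> y [My h]; apply: nproj_nearest => //; exact: h.
Qed.

Lemma nproj_fix x y : X x -> chart_dom x y -> rec_manifold y -> np x y = y.
Proof. by move=> Xx Oy My; rewrite -(nproj_nearest Xx Oy My)// subrr normr0. Qed.

Let hu x (Xx : X x) k := u_Sm k Xx.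
Let hc x (Xx : X x) k := cut_Sm k Xx.

Lemma nproj_orthogonal x y v w : X x -> chart_dom x y -> rec_manifold y ->
  dotp (v - D (np x) y v) (D (np x) y w) = 0.
Proof.
move=> Xx Oy My; have [_ fx _ _] := nproj_basic Xx Oy.
apply: (Dnproj_normal dotpE KU0 (Xfr Xx) d0 d1 (hu Xx) small1 (xP1 Xx) KB0 (hc Xx) small2') => //; first exact: nproj_fix.
exact: (Dnproj_tangent dotpE KU0 (Xfr Xx) d0 d1 (hu Xx) small1 (xP1 Xx) KB0 (hc Xx) small2').
Qed.

Let corr x z := nproj_corr dotp (fr x) x d (u x) (ft x z).

Let nproj_split x : X x -> np x = fun z => P x z + d *: corr x z.
Proof. by move=> Xx; apply/funext => z; exact: (nprojE dotpE KU0 (Xfr Xx) d0 d1 (hu Xx) small1 (xP1 Xx) KB0 (hc Xx) small2'). Qed.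

Let corr_Sm x k : X x -> Sm k (K_corr n KU KB k) setT (corr x).
Proof. by move=> Xx; exact: (nproj_corr_Sm dotpE KU0 (Xfr Xx) d0 d1 (hu Xx) small1 (xP1 Xx) KB0 (hc Xx) small2'). Qed.

Lemma K_corr_ge0 k : 0 <= K_corr n KU KB k.
Proof. by apply: comp_bound_ge0; [|apply: diffeo_bound_ge0]; exact: K_shift_ge0. Qed.

Let dcorr_DSm x k : X x -> DSm k (d * K_corr n KU KB k) setT (fun z => d *: corr x z).
Proof.
move=> Xx; have := Sm_scale d (@openT E) (K_corr_ge0 k) (corr_Sm k Xx).
by rewrite gtr0_norm// => /SmE[].
Qed.

Lemma nproj_DSm x k : X x -> DSm k (1 + d * K_corr n KU KB k) setT (np x).
Proof.
move=> Xx; rewrite nproj_split//; apply: DSm_add => //.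
- exact: openT.
- exact: DSm_aproj (Xfr Xx).
- exact: dcorr_DSm.
Qed.

(** The affine part [P x] has no differential of order two or more, so only the term with the factor
    [d] remains. *)
Lemma nproj_diff_norm x k z : X x -> (2 <= k)%N ->
  (diff_norm (np x) k z <= (d * K_corr n KU KB k)%:E)%E.
Proof.
move=> Xx k2; have c0 : 0 <= d * K_corr n KU KB k by rewrite mulr_ge0 ?K_corr_ge0// ltW.
have h : (diff_norm (fun z => d *: corr x z) k z <= (d * K_corr n KU KB k)%:E)%E.
  by case: k k2 c0 => // k k2 c0; apply: (@diff_norm_le _ _ _ _ _ setT) => //; [exact: openT|exact: dcorr_DSm].
apply: multi_norm_le => vs sv nv; rewrite -lee_fin (le_trans _ h)//.
have <- : iter_diff (fun z => d *: corr x z) vs z = iter_diff (np x) vs z.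
  rewrite nproj_split// (iter_diff_add (K1 := 1) (K2 := d * K_corr n KU KB (size vs)) (U := setT))//.
  - case/lastP: vs sv {nv} k2 => [<-//|vs w]; case/lastP: vs => [<-//|vs v] sv k2.
    by rewrite (aprojE dotpE (Xfr Xx)) iter_diff_affine add0r.
  - exact: openT.
  - by rewrite mulr_ge0 ?K_corr_ge0// ltW.
  - exact: DSm_aproj (Xfr Xx).
  - exact: dcorr_DSm.
by apply: ereal_sup_ubound; exists vs.
Qed.

(** The derivative of [P x] is constant and cancels. Comparing two points avoids comparing the plane
    of [x] with the tangent plane. *)
Lemma nproj_D_close x z z' : X x ->
  `|D (np x) z - D (np x) z'| <= 2 * (d * K_corr n KU KB 1).
Proof.
move=> Xx; have [h1 h2] := dcorr_DSm 1 Xx.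
have e w : D (np x) w = projb dotp (fr x).2 + D (fun z => d *: corr x z) w.
  apply: hasdD; rewrite nproj_split//; apply: hasd_add; last exact: h1.
  exact: hasd_aproj (Xfr Xx).
rewrite !e opprD addrACA subrr add0r (le_trans (ler_normB _ _))//.
by rewrite mulr_natl mulr2n lerD//; [exact: (h2 z I)|exact: (h2 z' I)].
Qed.

(** The graph is parametrized by coordinates in the plane of [x]; the inverse is the affine
    coordinate map, defined and continuous on all of [E]. *)
Lemma nproj_chart x y : X x -> chart_dom x y -> rec_manifold y -> exists V O phi a,
  [/\ smooth_param (n := n) rec_manifold V O phi, O y, V a, phi a = y &
      forall v, exists h, D phi a h = D (np x) y v].
Proof.
move=> Xx Oy My; have hf := Xfr Xx; have [_ _ yx _] := nproj_basic Xx Oy.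
rewrite nproj_fix// in yx; set e := (fr x).2; set c := (fr x).1.
have bS := bounded_linear_span_map dotpE hf.
pose S := mkblin (span_map e); have SE t : S t = span_map e t by exact: mkblinE.
pose L t := S t + c; pose psi p := coords dotp e (p - c); pose phi t := gr x (L t).
have PL t : P x (L t) = L t by rewrite /L /aproj addrK SE proj_span_map// addrC.
have Lpsi p : L (psi p) = P x p by rewrite /L /aproj SE span_map_coords addrC.
have psiphi t : psi (phi t) = t.
  rewrite /psi -coords_proj// (_ : proj _ _ _ = S t).
    by rewrite SE coords_span_map.
  apply: (@addrI _ c); transitivity (P x (phi t)) => //.
  by rewrite /phi (aproj_graph _ _ hf) PL addrC.
have phipsi p : gr x p = p -> phi (psi p) = p.
  by move=> gp; rewrite /phi Lpsi (graph_aproj _ _ hf).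
have hL t : hasd L t S by rewrite -[S]addr0; apply: hasd_add; [exact: hasd_lin|exact: hasd_cst].
have hphi t : hasd phi t (bcomp (projb dotp e + d *: D (ht x) (L t)) S).
  exact: (hasd_comp (f := gr x) (hasd_graph dotpE KU0 hf d0 d1 (hu Xx) small1 (L t)) (hL t)).
have Dphi t h : D phi t h = S h + d *: D (ht x) (L t) (S h).
  by rewrite (hasdD (hphi t)) bcompE blin_add blin_scale projbE// SE proj_span_map.
have projS h : proj dotp e (S h) = S h by rewrite SE proj_span_map.
exists [set t | `|phi t - x| < 15 / 100], [set p | `|p - x| < 15 / 100], phi, (psi y).
have phia : phi (psi y) = y by apply: phipsi; apply/(manifold_graph Xx yx).
have oV : open [set t | `|phi t - x| < 15 / 100].
  apply: (@open_comp _ _ (fun t => `|phi t - x|) [set y | y < 15 / 100]); last exact: open_lt.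
  move=> t _; apply: (@continuous_comp _ _ _ (fun t => phi t - x) Num.norm); last exact: norm_continuous.
  exact: hasd_continuous (hasd_add (hphi t) (hasd_cst (- x) t)).
split=> //; last 1 first.
- move=> v; have [t /= pt <-] : tangent_at dotp (fr x) d (u x) (P x (ft x y)) (D (np x) y v).
    exact: (Dnproj_tangent dotpE KU0 (Xfr Xx) d0 d1 (hu Xx) small1 (xP1 Xx) KB0 (hc Xx) small2').
  exists (coords dotp e t); rewrite Dphi Lpsi.
  have -> : S (coords dotp e t) = t by rewrite SE span_map_coords.
  (* The base point [P x (ft x y)] of the tangent vector is [P x y], because [y] is its own
     projection. *)
  by rewrite -[in P x y](nproj_fix Xx Oy My) (aproj_graph _ _ hf).
- split=> //.
  + split=> // k; exists (comp_bound k (1 + d * K_height KU k) `|S|).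
      by rewrite comp_bound_ge0// addr_ge0// mulr_ge0 ?K_height_ge0// ltW.
    apply: (@DSm_sub _ _ _ _ _ setT) => //.
    apply: (@DSm_comp _ _ _ _ _ _ _ _ setT) => //.
    * exact: openT.
    * by rewrite addr_ge0// mulr_ge0 ?K_height_ge0// ltW.
    * apply: DSm_add; [exact: openT|exact: DSm_aproj|].
      have := Sm_scale d (@openT E) (K_height_ge0 KU0 k) (height_Sm dotpE KU0 hf d0 d1 (hu Xx) small1 k).
      by rewrite gtr0_norm// => /SmE[].
    * exact: DSm_affine.
  + apply: (@open_comp _ _ (fun z : E => `|z - x|) [set y | y < 15 / 100]); last exact: open_lt.
    by move=> z _; apply: cvg_norm; apply: cvgB; [exact: cvg_id|exact: cvg_cst].
  + apply/seteqP; split=> [_ [t /= tx <-]|p [Mp /= px]].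
      by split=> //; apply/(manifold_graph Xx tx); exact: graph_idem.
    have pE : phi (psi p) = p by apply: phipsi; apply/(manifold_graph Xx px).
    by exists (psi p); rewrite /= pE.
  (* Projecting [D phi a h] to the plane removes the height term and returns [S h], which determines
     [h]. *)
  + move=> a h _; rewrite Dphi => /(congr1 (proj dotp e)).
    rewrite projD projZ projS (proj_Dheight dotpE KU0 hf d0 d1 (hu Xx) small1) scaler0 addr0.
    rewrite /proj big1; last by move=> i _; rewrite dotp0l scale0r.
    move=> S0; have := coords_span_map hf h; rewrite -SE S0 => <-.
    by apply/rowP => i; rewrite !mxE dotp0l.
  + exists psi => // p; apply: (@continuous_comp _ _ _ (fun p => p - c) (coords dotp e)).
      by apply: cvgB; [exact: cvg_id|exact: cvg_cst].
    have bC := bounded_linear_coords dotpE hf.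
    have -> : coords dotp e = mkblin (coords dotp e) by apply/funext => v; rewrite mkblinE.
    exact: blin_continuous.
by rewrite /= phia.
Qed.

Lemma manifold_near_set x : X x -> exists y, rec_manifold y /\ `|x - y| <= 2 * d + d * KU 1.
Proof.
have := small0; have := dK0; have := d0 => d0' dK0' s0.
move=> Xx; have hf := Xfr Xx; have xx := XPx Xx; have PP := aprojK x hf.
exists (F (P x x)); split; first by exists x, (P x x); split=> //; lra.
rewrite (F_local Xx PP); last by lra.
have -> : x - (P x x + d *: u x (P x x)) = - (P x x - x) - d *: u x (P x x) by vring R E.
by rewrite (le_trans (ler_normB _ _))// normrN lerD//; exact: offset_norm.
Qed.

(* Slide [m] along the graph towards the point above the nearby data point [q] by just enough
   to absorb the error terms. *)
Lemma manifold_net m : rec_manifold m -> exists y q, [/\ rec_manifold y, X q,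
  `|y - q| <= 5 * d + d * KU 1 + 2 * (d * K_shift n KU KB 1) & `|m - y| <= eps].
Proof.
have := small0; have := dK0; have := d0 => d0' dK0' s0.
have := small2; have := dS0 => dS0' s2.
have [_ _ _ [_ _ eps0 eps1]] := flat.
move=> Mm; have [x [a [Xx Pa ax _ ma]]] := manifold_near Mm.
have [|q [Xq _ aq]] := XQ Xx Pa; first by lra.
have hf := Xfr Xq; have qq := XPx Xq.
have mq : `|m - q| <= eps + 3 * d + d * KU 1.
  have -> : m - q = (m - a) + (a - q) by vring R E.
  by rewrite (le_trans (ler_normD _ _))//; lra.
have mE : m = P q m + d *: ht q m by apply: manifold_height => //; lra.
have lmq := aproj_lip dotpE m q hf.
set bm := P q m in mE lmq; set bq := P q q in qq lmq.
have hm := height_norm m Xq.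
have [small|big] := leP `|bm - bq| (3 * d + d * KU 1 + d * K_shift n KU KB 1).
  exists m, q; split=> //; last by rewrite subrr normr0 ltW.
  have -> : m - q = (bm - bq) + d *: ht q m + (bq - q) by rewrite {1}mE; vring R E.
  rewrite (le_trans (ler_normD _ _))//; have := ler_normD (bm - bq) (d *: ht q m); lra.
have l0 : 0 < `|bm - bq| by lra.
(* The slide has length [3 * d + d * KU 1 + d * K_shift n KU KB 1]: the first two terms are the
   excess over [eps] in [mq], the last covers the change of height. *)
pose s := (3 * d + d * KU 1 + d * K_shift n KU KB 1) / `|bm - bq|.
have s0' : 0 <= s by rewrite divr_ge0// ?ltW//; lra.
have s1 : s <= 1 by rewrite ler_pdivrMr// mul1r ltW.
have sE : s * `|bm - bq| = 3 * d + d * KU 1 + d * K_shift n KU KB 1 by rewrite divfK// gt_eqF.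
pose b := bq + s *: (bm - bq); pose y := gr q b.
have Pb : P q b = b by rewrite aprojD projZ proj_aproj// /bq aprojK.
have yE : y = b + d *: ht q b by rewrite /y /graph Pb.
have hb := height_norm b Xq.
have yq : `|y - q| <= 5 * d + d * KU 1 + 2 * (d * K_shift n KU KB 1).
  have -> : y - q = s *: (bm - bq) + d *: ht q b + (bq - q) by rewrite yE /b; vring R E.
  rewrite (le_trans (ler_normD _ _))//; have := ler_normD (s *: (bm - bq)) (d *: ht q b).
  by rewrite normrZ (ger0_norm s0') sE; lra.
exists y, q; split=> //.
  by apply/(manifold_graph Xq); [lra|exact: graph_idem].
have hl : `|ht q bm - ht q b| <= K_shift n KU KB 1 * `|bm - b|.
  have hS := height_Sm dotpE KU0 hf d0 d1 (hu Xq) small1 1.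
  by rewrite (le_trans (Sm_lip _ _ dotpE hS))// ler_wpM2r// K_height_shift.
have mb : `|bm - b| = `|bm - bq| - (3 * d + d * KU 1 + d * K_shift n KU KB 1).
  have -> : bm - b = (1 - s) *: (bm - bq) by rewrite /b; vring R E.
  by rewrite normrZ ger0_norm ?subr_ge0// mulrBl mul1r sE.
have -> : m - y = (bm - b) + d *: (ht q bm - ht q b).
  by rewrite yE {1}mE /bm height_aproj//; vring R E.
rewrite (le_trans (ler_normD _ _))// normrZ (gtr0_norm d0).
have h1 : d * `|ht q bm - ht q b| <= d * (K_shift n KU KB 1 * 1).
  by rewrite ler_pM2l// (le_trans hl)// ler_wpM2l//; lra.
lra.
Qed.

End Reconstruction.

(** * Manifolds with local normal projections *)

(** What the remaining arguments need to know about the manifold, free of the construction. [c k]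
    bounds the differentials of order [k >= 2], whereas [c 1] bounds the oscillation of [D g], since
    [D g] itself is not small. *)
Definition proj_chart {R : realType} {E : normedModType R} (dotp : {dot E for idfun}) (n : nat)
    (M O : set E) (g : E -> E) (c : nat -> R) : Prop :=
  [/\ open O, forall k, exists2 K, 0 <= K & DSm k K O g,
      forall z, O z -> is_nearest M z (g z) /\ forall y, is_nearest M z y -> y = g z,
      (forall z k, O z -> (2 <= k)%N -> (diff_norm g k z <= (c k)%:E)%E) /\
      (forall z z', O z -> O z' -> `|D g z - D g z'| <= c 1) &
      forall y, M y -> O y -> (forall v w, dotp (v - D g y v) (D g y w) = 0) /\
        exists V O' (phi : 'rV[R]_n -> E) a, [/\ smooth_param M V O' phi, O' y, V a, phi a = y &
          forall v, exists h, D phi a h = D g y v]].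

Lemma choice_exists2 (T U : Type) (P Q : T -> U -> Prop) :
  (forall x, exists2 y, P x y & Q x y) -> exists f, forall x, P x (f x) /\ Q x (f x).
Proof.
move=> h; have /choice[f fP] : forall x, exists y, P x y /\ Q x y by move=> x; have [y] := h x; exists y.
by exists f.
Qed.

Lemma small_products {R : realFieldType} (d k a b c : R) :
  0 < d -> 0 <= k -> 0 <= a -> 0 <= b -> 0 <= c ->
  d <= (100 * (100 * (100 * (100 * (1 + k + a + b + c)))))^-1 ->
  [/\ 100 * (100 * (100 * (100 * (d + d * k)))) <= 1, d * a <= 2^-1,
      100 * (100 * (100 * (100 * (d * b)))) <= 1 & d * c <= 4^-1].
Proof.
move=> d0 k0 a0 b0 c0; have h : 0 < 1 + k + a + b + c by lra.
rewrite -div1r ler_pdivlMr ?mulr_gt0// => dB.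
have := mulr_ge0 (ltW d0) k0; have := mulr_ge0 (ltW d0) a0.
have := mulr_ge0 (ltW d0) b0; have := mulr_ge0 (ltW d0) c0.
by split; lra.
Qed.

Lemma nearly_flat_manifold {R : realType} (n : nat) : exists (s : R) (CK : nat -> R) (CY : R),
  [/\ 0 < s, forall k, 0 <= CK k & 0 <= CY] /\
  forall (E : completeNormedModType R) (dotp : {dot E for idfun}) (X : set E)
    (fr : E -> frame (E := E) n) (eps d : R),
  (forall x : E, dotp x x = `|x| ^+ 2) -> nearly_flat dotp X fr eps d -> d <= s ->
  exists M, [/\ closed M,
    forall z y, M y -> `|z - y| < 1 / 3 -> exists O g,
      [/\ proj_chart dotp n M O g (fun k => d * CK k), O z & O (g z)],
    forall x, X x -> exists2 y, M y & `|x - y| <= CY * d &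
    forall m, M m -> exists y x, [/\ M y, X x, `|y - x| <= CY * d & `|m - y| <= eps]].
Proof.
have [N hN] := @center_classes R n.
have [KU hKU] := choice_exists2 (@stages_Sm R N); have KU0 k := (hKU k).1.
have ha : 0 <= 1 / 2 :> R by lra.
have hb : 1 / 2 < 1 :> R by lra.
have [Kb hKb] := choice_exists2 (fun k => @bump_Sm R k (1 / 2) 1 ha hb).
pose KB k : R := comp_bound k (Kb k) 1.
have KB0 k : 0 <= KB k by apply: comp_bound_ge0 => //; exact: (hKb k).1.
have a0 := comp_bound_ge0 1 (KU0 1) (@ler01 R).
have b0 := K_shift_ge0 n KU0 1 KB0.
have c0 := K_height_ge0 KU0 2.
have k0 := KU0 1%N.
(* Only constants of orders 1 and 2 occur, so the threshold is the same for every [k]. *)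
exists (100 * (100 * (100 * (100 *
  (1 + KU 1 + comp_bound 1 (KU 1) 1 + K_shift n KU KB 1 + K_height KU 2)))))^-1.
(* The factor 2 comes from [nproj_D_close]; the second constant is that of [manifold_net], which
   exceeds that of [manifold_near_set]. *)
exists (fun k => 2 * K_corr n KU KB k), (5 + KU 1 + 2 * K_shift n KU KB 1); split.
  split=> [|k|]; last by clear -k0 b0; lra.
    by rewrite invr_gt0 !mulr_gt0//; clear -k0 a0 b0 c0; lra.
  by rewrite mulr_ge0//; exact: (K_corr_ge0 n KU0 KB0).
move=> E dotp X fr eps d dotpE flat ds.
have [hfr hnear _ [d0 d1' _ _]] := flat.
have [small0 small1 small2 small3] := small_products d0 k0 a0 b0 c0 ds.
have dk := mulr_ge0 (ltW d0) k0; have dS := mulr_ge0 (ltW d0) b0.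
have dK : 100 * (100 * (d + d * KU 1)) <= 1 / 100 by clear -small0; lra.
have d1 : d <= 1 by clear -d1' d0; lra.
have [C [CX Csep Ccov]] := hN E dotp X fr eps d dotpE flat.
have offSm x c k : X x -> (c <= N)%N -> Sm k (KU k) setT (offset dotp fr d C x c).
  move=> Xx cN; apply: (hKU k).2 => //; [exact: hfr| |].
    by apply: hnear => //; rewrite subrr normr0.
  by move=> c' i fri; apply: centers_close => //; exact: flat.
have u_Sm x k : X x -> Sm k (KU k) setT (offset dotp fr d C x N) by move=> Xx; exact: offSm.
have cut_Sm x k : X x -> Sm k (KB k) setT (cut dotp x).
  move=> _.
  apply: (@Sm_comp _ _ _ _ _ _ _ _ setT (bump dotp (1 / 2) 1) (fun w => w - x)) => //.
  - exact: openT.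
  - exact: (hKb k).1.
  - exact: (hKb k).2.
  have -> : (fun w => w - x) = (fun w : E => @id_blin R E w + - x) by apply/funext => w; rewrite id_blinE.
  exact: DSm_affine id_blin_norm.
have off1 x c : X x -> (c <= N)%N -> Sm 1 (KU 1) setT (offset dotp fr d C x c) by exact: offSm.
have F_local x a Xx Pa ax := flatten_local dotpE flat Csep off1 dK (x := x) (a := a) Xx Pa ax (leqnn N).
have F_transfer := transfer dotpE flat CX Csep Ccov off1 dK.
exists (rec_manifold dotp X fr (flatten dotp fr C N)); split.
- exact: (manifold_closed dotpE flat F_local F_transfer u_Sm KU0 small0 small1).
- move=> z y My zy.
  have [x [Xx Oz Og]] := chart_cover dotpE flat F_local F_transfer u_Sm KU0 KB0 cut_Sm small0 small1 small2 My zy.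
  exists (chart_dom dotp fr x), (nproj dotp (fr x) x d (offset dotp fr d C x N)); split=> //; split.
  + exact: (chart_dom_open dotpE flat Xx).
  + move=> k; exists (1 + d * K_corr n KU KB k).
      by apply: addr_ge0 => //; apply: mulr_ge0; [exact: ltW|exact: (K_corr_ge0 n KU0 KB0)].
    apply: (@DSm_sub _ _ _ _ _ setT) => //.
    exact: (nproj_DSm dotpE flat u_Sm KU0 KB0 cut_Sm small0 small1 small2 k Xx).
  + move=> w Ow.
    exact: (nproj_is_nearest dotpE flat F_local F_transfer u_Sm KU0 KB0 cut_Sm small0 small1 small2 small3 Xx Ow).
  + split=> [w k _ k2|w w' _ _].
      apply: (le_trans (nproj_diff_norm dotpE flat u_Sm KU0 KB0 cut_Sm small0 small1 small2 w Xx k2)).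
      by rewrite lee_fin ler_pM2l// ler_peMl ?K_corr_ge0// ler1n.
    have := nproj_D_close dotpE flat u_Sm KU0 KB0 cut_Sm small0 small1 small2 w w' Xx.
    by rewrite mulrCA.
  + move=> w Mw Ow; split=> [v v'|].
      exact: (nproj_orthogonal dotpE flat F_local F_transfer u_Sm KU0 KB0 cut_Sm small0 small1 small2 small3 v v' Xx Ow Mw).
    exact: (nproj_chart dotpE flat F_local F_transfer u_Sm KU0 KB0 cut_Sm small0 small1 small2 small3 Xx Ow Mw).
- move=> x Xx; have [y [My xy]] := manifold_near_set flat F_local u_Sm KU0 small0 Xx.
  by exists y => //; apply: le_trans xy _; clear -d0 dk dS; lra.
move=> m Mm.
have [y [q [My Xq yq my]]] := manifold_net dotpE flat F_local F_transfer u_Sm KU0 KB0 small0 small1 small2 Mm.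
by exists y, q; split=> //; apply: le_trans yq _; clear -d0 dk dS; lra.
Qed.

(** * Rescaling *)

Section Distances.
Context {R : realType} {E : normedModType R}.
Implicit Types (A B : set E) (x y : E) (r : R).

Lemma edist_inf_ltP A x r : reflect (exists2 a, A a & `|x - a| < r) (edist_inf A x < r%:E)%E.
Proof.
apply: (iffP idP) => [/ereal_inf_lt[_ [a Aa <-] /edist_lt_ball]|[a Aa xa]].
  by rewrite -ball_normE; exists a.
(* A radius strictly in between is needed because [edist] is an infimum over radii of open balls. *)
pose s := (`|x - a| + r) / 2.
have xs : `|x - a| < s by rewrite /s; lra.
have sr : s < r by rewrite /s; lra.
apply: (@le_lt_trans _ _ s%:E); last by rewrite lte_fin.
apply: (@le_trans _ _ (edist (x, a))); first by apply: ereal_inf_lbound; exists a.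
apply: ereal_inf_lbound; exists s => //; split; first exact: le_lt_trans (normr_ge0 _) xs.
by rewrite -ball_normE.
Qed.

Lemma nbhd_ofP r A x : nbhd_of r A x <-> exists2 a, A a & `|x - a| < r.
Proof. by split=> /edist_inf_ltP. Qed.

Lemma edist_inf_le A x a r : A a -> `|x - a| <= r -> (edist_inf A x <= r%:E)%E.
Proof.
move=> Aa xa; apply/lee_addgt0Pr => e e0; rewrite ltW//.
by rewrite -EFinD; apply/edist_inf_ltP; exists a => //; rewrite (le_lt_trans xa)// ltrDl.
Qed.

Lemma hausdorff_dist_le A B r : 0 <= r -> (forall a, A a -> exists2 b, B b & `|a - b| <= r) ->
  (forall b, B b -> exists2 a, A a & `|b - a| <= r) -> (hausdorff_dist A B <= r%:E)%E.
Proof.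
move=> r0 AB BA; apply/lee_addgt0Pr => e e0; rewrite -EFinD.
have lt (t : R) : t <= r -> t < r + e by move=> h; rewrite (le_lt_trans h)// ltrDl.
apply: ereal_inf_lbound; exists (r + e) => //; split; first by rewrite ltr_wpDl.
by split=> [a /AB[b Bb ab]|b /BA[a Aa ba]]; apply/nbhd_ofP; [exists b|exists a] => //; exact: lt.
Qed.

Lemma hausdorff_dist_lt A B r : (hausdorff_dist A B < r%:E)%E ->
  (forall a, A a -> exists2 b, B b & `|a - b| < r) /\ (forall b, B b -> exists2 a, A a & `|b - a| < r).
Proof.
move=> /ereal_inf_lt[_ [s [s0 [AB BA]] <-]]; rewrite lte_fin => sr.
split=> [a /AB/nbhd_ofP[b Bb ab]|b /BA/nbhd_ofP[a Aa ba]].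
  by exists b => //; exact: lt_trans ab sr.
by exists a => //; exact: lt_trans ba sr.
Qed.

End Distances.

Section Rescaling.
Context {R : realType} {E : normedModType R} (r : R).
Hypothesis r0 : 0 < r.

(** The dilate of [M] by [r], encoded as a preimage so that openness and closedness follow from
    continuity. *)
Definition scaled (M : set E) : set E := [set z | M (r^-1 *: z)].
Definition rescale (g : E -> E) : E -> E := fun z => r *: g (r^-1 *: z).

Let nz : r != 0. Proof. by rewrite gt_eqF. Qed.

Lemma norm_unscale (z : E) : `|r^-1 *: z| = r^-1 * `|z|.
Proof. by rewrite normrZ gtr0_norm// invr_gt0. Qed.

Lemma norm_scale (z : E) : `|r *: z| = r * `|z|.
Proof. by rewrite normrZ gtr0_norm. Qed.

Lemma scaled_open (M : set E) : open M -> open (scaled M).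
Proof. by move=> oM; apply: open_comp => // z _; exact: scaler_continuous. Qed.

Lemma scaled_closed (M : set E) : closed M -> closed (scaled M).
Proof. by move=> cM; apply: closed_comp => // z _; exact: scaler_continuous. Qed.

Lemma is_nearest_scaled (M : set E) z y :
  is_nearest (scaled M) z y <-> is_nearest M (r^-1 *: z) (r^-1 *: y).
Proof.
split=> -[My h]; split=> // w Mw.
  have := h (r *: w); rewrite /scaled /= scalerA mulVf// scale1r => /(_ Mw) h'.
  rewrite -scalerBr norm_unscale -[leRHS]mul1r -(mulVf nz) -mulrA ler_pM2l ?invr_gt0//.
  by rewrite -norm_scale scalerBr scalerA mulfV// scale1r.
have := h _ Mw; rewrite -!scalerBr !norm_unscale ler_pM2l// invr_gt0//.
Qed.

Definition scaleb (c : R) : blin E E := mkblin (fun x => c *: x).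

Lemma scalebE c x : scaleb c x = c *: x.
Proof. exact: mkblinE (bounded_linear_scale E c) x. Qed.

Lemma hasd_rescale g z A : hasd g (r^-1 *: z) A -> hasd (rescale g) z A.
Proof.
move=> hg.
have e w : r^-1 *: w = scaleb r^-1 w by rewrite scalebE.
have -> : rescale g = fun w => scaleb r (g (scaleb r^-1 w)).
  by apply/funext => w; rewrite !scalebE.
have -> : A = bcomp (scaleb r) (bcomp A (scaleb r^-1)).
  by apply: blinP => v; rewrite !bcompE !scalebE blinZ scalerA mulfV// scale1r.
apply: (hasd_comp (f := scaleb r)); first exact: hasd_lin.
by apply: (hasd_comp (f := g)); [rewrite -e|exact: hasd_lin].
Qed.

Lemma DSm_scale_out (V : normedModType R) k K (U : set V) (f : V -> E) : open U -> 0 <= K ->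
  DSm k K U f -> exists2 K', 0 <= K' & DSm k K' U (fun x => r *: f x).
Proof.
move=> oU K0 hf; exists (comp_bound k `|scaleb r| K); first exact: comp_bound_ge0.
have -> : (fun x => r *: f x) = fun x => scaleb r (f x) by apply/funext => x; rewrite scalebE.
by apply: (@DSm_comp _ _ _ _ _ _ _ _ setT) => //; exact: DSm_lin.
Qed.

Lemma DSm_rescale k K (U : set E) g : open U -> 0 <= K ->
  DSm k K U g -> exists2 K', 0 <= K' & DSm k K' (scaled U) (rescale g).
Proof.
move=> oU K0 hg; have oU' := scaled_open oU.
apply: (@DSm_scale_out _ k (comp_bound k K `|scaleb r^-1|)) => //; first exact: comp_bound_ge0.
have -> : (fun z => g (r^-1 *: z)) = fun z => g (scaleb r^-1 z) by apply/funext => z; rewrite scalebE.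
apply: (@DSm_comp _ _ _ _ _ _ _ _ U) => //.
  by move=> x; rewrite scalebE.
by apply: (@DSm_sub _ _ _ _ _ setT) => //; exact: DSm_lin.
Qed.

(** Each direction contributes [r^-1] and the outer scaling [r]; bounds of size [delta / r] thus
    become multiples of [delta * r ^- k]. *)
Lemma iter_diff_rescale vs K (U : set E) g : open U -> 0 <= K -> DSm (size vs) K U g ->
  forall x, scaled U x ->
  iter_diff (rescale g) vs x = (r * r^-1 ^+ size vs) *: iter_diff g vs (r^-1 *: x).
Proof.
move=> oU K0; have oU' := scaled_open oU.
elim: vs => [|v vs IH] hg x Ux; first by rewrite expr0 mulr1.
rewrite !iter_diff_cons; set c := r * r^-1 ^+ size vs.
have IHx := IH (DSm_leq (leqnSn _) hg).
have [hA _] : DSm 1 (\prod_(w <- vs) `|w| * K) U (iter_diff g vs).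
  by apply: DSm_iter => //; rewrite addn1.
have h1 := hasd_comp (f := iter_diff g vs) (g := scaleb r^-1) (x := x) (hA (scaleb r^-1 x) _) (hasd_lin _ _).
have {h1}h1 := hasd_comp (f := scaleb c) (hasd_lin _ _) (h1 _).
have : hasd (iter_diff (rescale g) vs) x
    (bcomp (scaleb c) (bcomp (D (iter_diff g vs) (scaleb r^-1 x)) (scaleb r^-1))).
  apply: hasd_near (h1 _); last by rewrite scalebE.
    by rewrite /= !scalebE IHx.
  have := open_shift oU' Ux; apply: filterS => h Uh.
  by rewrite /= !scalebE IHx.
move=> /hasd_diff->; rewrite !bcompE !scalebE blinZ scalerA.
rewrite (hasd_diff _ (hA _ Ux)); congr (_ *: _).
by rewrite /c /= exprS; ring.
Qed.

Lemma diff_norm_rescale k K (U : set E) g C x : open U -> 0 <= K -> DSm k K U g ->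
  scaled U x -> (diff_norm g k (r^-1 *: x) <= C%:E)%E ->
  (diff_norm (rescale g) k x <= (C * (r * r^-1 ^+ k))%:E)%E.
Proof.
move=> oU K0 hg Ux hC; apply: multi_norm_le => vs sv nv.
rewrite (iter_diff_rescale oU K0) ?sv// normrZ mulrC gtr0_norm; last first.
  by rewrite mulr_gt0// exprn_gt0// invr_gt0.
rewrite ler_pM2r; last by rewrite mulr_gt0// exprn_gt0// invr_gt0.
by rewrite -lee_fin (le_trans _ hC)//; apply: ereal_sup_ubound; exists vs.
Qed.

Lemma smooth_param_scaled n (M : set E) V O (phi : 'rV[R]_n -> E) :
  smooth_param M V O phi -> smooth_param (scaled M) V (scaled O) (fun t => r *: phi t).
Proof.
move=> [[oV sphi] oO im inj [psi psiK cpsi]]; split.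
- split=> // k; have [K K0 hK] := sphi k; exact: DSm_scale_out hK.
- exact: scaled_open.
- apply/seteqP; split=> [_ [t Vt <-]|z [Mz Oz]].
    have : (phi @` V) (phi t) by exists t.
    by rewrite im /scaled /= scalerA mulVf// scale1r => -[].
  have : (M `&` O) (r^-1 *: z) by split.
  by rewrite -im => -[t Vt tz]; exists t => //; rewrite tz scalerA mulfV// scale1r.
- move=> a h Va; have [K K0 [hK _]] := sphi 1.
  have e : (fun t => r *: phi t) = fun t => scaleb r (phi t) by apply/funext => t; rewrite scalebE.
  rewrite e (hasdD (hasd_comp (f := scaleb r) (hasd_lin _ _) (hK a Va))) bcompE scalebE.
  by move=> /eqP; rewrite scaler_eq0 (negbTE nz) => /eqP; exact: inj.
exists (fun z => psi (r^-1 *: z)) => [a Va|]; first by rewrite scalerA mulVf// scale1r psiK.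
by move=> z; apply: continuous_comp; [exact: scaler_continuous|exact: cpsi].
Qed.

Lemma proj_chart_scaled (dotp : {dot E for idfun}) n (M O : set E) g c :
  proj_chart dotp n M O g c ->
  proj_chart dotp n (scaled M) (scaled O) (rescale g) (fun k => c k * (r * r^-1 ^+ k)).
Proof.
move=> [oO sg near [hk h1] tan].
have rK (z : E) : r^-1 *: (r *: z) = z by rewrite scalerA mulVf// scale1r.
have Kr (z : E) : r *: (r^-1 *: z) = z by rewrite scalerA mulfV// scale1r.
have DE z : scaled O z -> D (rescale g) z = D g (r^-1 *: z).
  by have [K K0 [hK _]] := sg 1%N => Oz; apply/hasdD/hasd_rescale/hK.
split.
- exact: scaled_open.
- by move=> k; have [K K0 hK] := sg k; exact: DSm_rescale hK.
- move=> z Oz; have [nz1 nz2] := near _ Oz; split.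
    by apply/is_nearest_scaled; rewrite rK.
  by move=> y /is_nearest_scaled/nz2 e; rewrite /rescale -e Kr.
- split=> [z k Oz k2|z z' Oz Oz'].
    by have [K K0 hK] := sg k; apply: (diff_norm_rescale oO K0) => //; exact: hk.
  by rewrite !DE// expr1 mulfV// mulr1 h1.
move=> y My Oy; have [hort [V [W [phi [a [sphi Wy Va pa hd]]]]]] := tan _ My Oy; split.
  by move=> v w; rewrite !DE// hort.
exists V, (scaled W), (fun t => r *: phi t), a; split=> //.
- exact: smooth_param_scaled.
- by rewrite pa Kr.
move=> v; have [h hE] := hd (r^-1 *: v); exists h; rewrite DE//.
have [[_ sp] _ _ _ _] := sphi; have [K K0 [hK _]] := sp 1%N.
have e : (fun t => r *: phi t) = fun t => scaleb r (phi t) by apply/funext => t; rewrite scalebE.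
by rewrite e (hasdD (hasd_comp (f := scaleb r) (hasd_lin _ _) (hK a Va))) bcompE scalebE hE blinZ Kr.
Qed.

End Rescaling.

(** * Consequences of the charts: smoothness, reach and second fundamental form *)

Lemma linear_unit_bound {R : realType} (V W : normedModType R) (T : V -> W) C : linear T ->
  (forall v, `|v| <= 1 -> `|T v| <= C) -> forall v, `|T v| <= C * `|v|.
Proof.
move=> lT hC v.
have T0 : T 0 = 0 by have := lT (-1) 0 0; rewrite scaler0 addr0 scaleN1r addNr.
have [->|v0] := eqVneq v 0; first by rewrite T0 !normr0 mulr0.
have nv : 0 < `|v| by rewrite normr_gt0.
have {1}-> : v = `|v| *: (`|v|^-1 *: v) + 0 by rewrite addr0 scalerA mulfV ?scale1r// gt_eqF.
rewrite lT T0 addr0 normrZ normr_id mulrC ler_pM2r//; apply: hC.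
by rewrite normrZ normrV ?unitfE ?gt_eqF// normr_id mulVf// gt_eqF.
Qed.

(** ['d] is linear but not known to be bounded: boundedness comes from the finite norm of one order
    higher, differentiability from the Taylor clause. Both norms are suprema over directions of norm
    at most 1, hence the condition on [vs]. *)
Lemma smooth_on_hasd_iter {R : realType} (V W : normedModType R) (U : set V) (f : V -> W) vs x :
  smooth_on U f -> U x -> (forall v, v \in vs -> `|v| <= 1) ->
  exists A : blin V W, hasd (iter_diff f vs) x A.
Proof.
move=> [_ sf] Ux nvs; have [+ _] := sf (size vs).+1 x Ux; have [_ tay] := sf (size vs) x Ux.
pose T : V -> W := 'd (iter_diff f vs) x.
have ub v : `|v| <= 1 -> (`|T v|%:E <= diff_norm f (size vs).+1 x)%E.
  move=> v1; apply: ereal_sup_ubound; exists (v :: vs) => //=; split=> // w.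
  by rewrite in_cons => /orP[/eqP->//|]; exact: nvs.
move: ub; case: (diff_norm _ _ _) => [C| |] // ub _; last first.
  by have := ub 0; rewrite normr0 => /(_ ler01).
have lT : linear T by exact: linearP.
have bT : bounded_linear T by split=> //; exists C; exact: linear_unit_bound.
exists (mkblin T) => e e0; have := tay e e0; apply: filterS => h hle.
rewrite mkblinE// -lee_fin; apply: le_trans hle.
by apply: ereal_sup_ubound; exists vs.
Qed.

Lemma smooth_on_hasd {R : realType} (V W : normedModType R) (U : set V) (f : V -> W) x :
  smooth_on U f -> U x -> exists A : blin V W, hasd f x A.
Proof. by move=> sf Ux; exact: (@smooth_on_hasd_iter _ _ _ _ _ [::] _ sf Ux). Qed.

Lemma smooth_on_hasd_diff {R : realType} (V W : normedModType R) (U : set V) (f : V -> W) x k :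
  smooth_on U f -> U x -> exists A : blin V W, hasd (fun y => 'd f y k) x A.
Proof.
move=> sf Ux; have [->|k0] := eqVneq k 0.
  exists 0; have -> : (fun y => 'd f y 0) = fun _ => 0 by apply/funext => y; rewrite linear0.
  exact: hasd_cst.
have nk : `|k| != 0 by rewrite normr_eq0.
have [|A hA] := @smooth_on_hasd_iter _ _ _ _ _ [:: `|k|^-1 *: k] _ sf Ux.
  by move=> v; rewrite inE => /eqP->; rewrite normrZ normrV ?unitfE// normr_id mulVf.
exists (bcomp (scaleb `|k|) A).
have -> : (fun y => 'd f y k) = fun y => scaleb `|k| (iter_diff f [:: `|k|^-1 *: k] y).
  by apply/funext => y; rewrite scalebE /= linearZ scalerA mulfV// scale1r.
exact: (hasd_comp (f := scaleb `|k|) (hasd_lin _ _) hA).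
Qed.

Lemma smooth_param_local {R : realType} {E : normedModType R} n (M : set E) V O (phi : 'rV[R]_n -> E) :
  smooth_param M V O phi -> local_param M V O phi.
Proof.
move=> [[oV sphi] oO im inj [psi psiK cpsi]]; split=> //.
- apply: smooth_onP => // k x Vx; have [K K0 hK] := sphi k; by exists K, V.
- move=> a Va h h' e; have [K K0 [hK _]] := sphi 1%N.
  apply/eqP; rewrite -subr_eq0; apply/eqP; apply: (inj a) => //.
  by rewrite blinB -!(hasd_diff _ (hK a Va)) e subrr.
by exists psi => //; exact: continuous_subspaceT.
Qed.

Lemma open_nbhd_of {R : realType} {E : normedModType R} r (A : set E) : open (nbhd_of r A).
Proof.
have -> : nbhd_of r A = \bigcup_(a in A) ball a r.
  apply/seteqP; split=> [x /nbhd_ofP[a Aa xa]|x [a Aa]].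
    by exists a => //; rewrite -ball_normE /= distrC.
  by rewrite -ball_normE /= distrC => ax; apply/nbhd_ofP; exists a.
have [r0|r0] := ltP 0 r; first by apply: bigcup_open => a _; exact: ball_open.
rewrite (_ : \bigcup_(_ in _) _ = set0); first exact: open0.
by rewrite -subset0 => x [a _]; rewrite -ball_normE /= => /lt_le_trans/(_ r0); rewrite normr_lt0.
Qed.

Section ProjChart.
Context {R : realType} {E : normedModType R} (dotp : {dot E for idfun}) (n : nat).
Hypothesis dotpE : forall x : E, dotp x x = `|x| ^+ 2.
Variables (M O : set E) (g : E -> E) (c : nat -> R).
Hypotheses (ch : proj_chart dotp n M O g c) (c0 : forall k, 0 <= c k).

Lemma normal_projE z : O z -> normal_proj M z = g z.
Proof. by case: ch => _ _ h _ _ /h[h1 h2]; apply: h2; apply: (xgetPex 0); exists (g z). Qed.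

Lemma chart_hasd z : O z -> hasd g z (D g z).
Proof. by case: ch => _ + _ _ _ => /(_ 1%N)[K _ [h _]]; exact: h. Qed.

Lemma chart_fix y : M y -> O y -> g y = y.
Proof.
case: ch => _ _ h _ _ My /h[_ h2]; apply/esym/h2; split=> // z Mz.
by rewrite subrr normr0.
Qed.

(** Stated for an arbitrary parametrization, because the tangent space and the second fundamental
    form range over all of them. *)
Lemma param_fix V W (phi : 'rV[R]_n -> E) a : local_param M V W phi -> V a -> O (phi a) ->
  \forall h \near (0 : 'rV[R]_n), V (a + h) /\ g (phi (a + h)) = phi (a + h).
Proof.
move=> [sphi oW im _ _] Va Oa; have [oV _] := sphi; have [A hA] := smooth_on_hasd sphi Va.
have oO : open O by case: ch.
have h1 := open_shift oV Va.
have h2 : \forall h \near (0 : 'rV[R]_n), O (phi (a + h)).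
  apply/(@nbhs0P _ _ (fun b => O (phi b))); apply: (hasd_continuous hA).
  exact: open_nbhs_nbhs.
near=> h; have Vh : V (a + h) by near: h.
have Oh : O (phi (a + h)) by near: h.
split=> //; apply: chart_fix => //.
have : (phi @` V) (phi (a + h)) by exists (a + h).
by rewrite im => -[].
Unshelve. all: by end_near. Qed.

Lemma param_fix0 V W (phi : 'rV[R]_n -> E) a : local_param M V W phi -> V a -> O (phi a) ->
  g (phi a) = phi a.
Proof. by move=> lp Va Oa; have := nbhs_singleton (param_fix lp Va Oa); rewrite addr0 => -[]. Qed.

Lemma param_diff_fix V W (phi : 'rV[R]_n -> E) a h : local_param M V W phi -> V a -> O (phi a) ->
  D g (phi a) ('d phi a h) = 'd phi a h.
Proof.
move=> lp Va Oa; have [sphi _ _ _ _] := lp; have [A hA] := smooth_on_hasd sphi Va.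
have hc := hasd_comp (f := g) (chart_hasd Oa) hA.
have hA' : hasd phi a (bcomp (D g (phi a)) A).
  apply: (hasd_near _ _ hc); first exact: param_fix0 lp Va Oa.
  by apply: filterS (param_fix lp Va Oa) => k [].
by rewrite (hasd_diff _ hA) -bcompE (hasd_uniq hA' hA).
Qed.

(** Differentiating [g (phi t) = phi t] shows that tangent vectors are fixed, for any
    parametrization. Conversely a fixed vector lies in the range of [D g y], which the
    parametrization supplied by the chart reaches. *)
Lemma chart_tangentP y u : M y -> O y -> tangent_space n M y u <-> D g y u = u.
Proof.
move=> My Oy; split=> [[V [W [phi [a [lp Va pa [h <-]]]]]]|gu].
  by rewrite -pa (param_diff_fix h lp Va)// pa.
case: ch => _ _ _ _ /(_ y My Oy)[_ [V [W [phi [a [sp Wy Va pa hd]]]]]].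
have [h hE] := hd u; exists V, W, phi, a; split=> //; first exact: smooth_param_local.
have [[_ sphi] _ _ _ _] := sp; have [K _ [hK _]] := sphi 1%N.
by exists h; rewrite (hasd_diff _ (hK a Va)) hE.
Qed.

Lemma chart_idem y v : M y -> O y -> D g y (D g y v) = D g y v.
Proof.
move=> My Oy; case: (ch) => _ _ _ _ /(_ y My Oy)[_ [V [W [phi [a [sp Wy Va pa hd]]]]]].
have [[_ sphi] _ _ _ _] := sp; have [K _ [hK _]] := sphi 1%N.
have [h <-] := hd v; have Oa : O (phi a) by rewrite pa.
by have := param_diff_fix h (smooth_param_local sp) Va Oa; rewrite (hasd_diff _ (hK a Va)) pa.
Qed.

(** [D g y] has the defining property; another candidate differs from it by a tangent vector
    orthogonal to all tangent vectors, hence to itself. *)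
Lemma chart_orth_projector y v : M y -> O y ->
  orth_projector dotp (tangent_space n M y) v = D g y v.
Proof.
move=> My Oy; have [_ _ _ _ /(_ y My Oy)[hort _]] := ch.
have Tv : tangent_space n M y (D g y v) by apply/chart_tangentP => //; exact: chart_idem.
have tort t : tangent_space n M y t -> dotp (v - D g y v) t = 0.
  by move=> /(chart_tangentP _ My Oy) <-; exact: hort.
have [Tw wort] : [set w | tangent_space n M y w /\ forall t, tangent_space n M y t -> dotp (v - w) t = 0] (orth_projector dotp (tangent_space n M y) v).
  by apply: (xgetPex 0); exists (D g y v).
move: (orth_projector _ _ _) Tw wort => w Tw wort.
have T : tangent_space n M y (w - D g y v).
  by apply/chart_tangentP => //; rewrite blinB chart_idem//; congr (_ - _); apply/chart_tangentP.
apply/eqP; rewrite -subr_eq0 -normr_eq0 -sqrf_eq0 -dotpE.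
have {1}-> : w - D g y v = (v - D g y v) - (v - w) by vring R E.
by rewrite dotpBl tort// wort// subrr.
Qed.

Lemma chart_D2_le y u v : O y -> `|D (D g) y u v| <= c 2 * `|u| * `|v|.
Proof.
move=> Oy; case: (ch) => oO /(_ 2)[K K0 hK] _ [/(_ y 2 Oy isT) hk _] _.
have unit u' v' : `|u'| <= 1 -> `|v'| <= 1 -> `|D (D g) y u' v'| <= c 2.
  move=> u1 v1.
  have -> : D (D g) y u' v' = iter_diff g (rcons [:: u'] v') y.
    rewrite (@iter_diff_D _ _ _ _ K O)// iter_diff_cons.
    by case: hK => _ [_ h _]; rewrite (hasd_diff _ (h y Oy)).
  rewrite -lee_fin (le_trans _ hk)//; apply: ereal_sup_ubound; exists [:: u'; v'] => //=.
  by split=> // w; rewrite !inE => /orP[]/eqP->.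
have unit1 u' : `|u'| <= 1 -> `|D (D g) y u' v| <= c 2 * `|v|.
  by move=> u1; apply: linear_unit_bound => [|v']; [exact: blin_linear|exact: unit].
rewrite mulrAC; apply: (linear_unit_bound (T := fun u => D (D g) y u v)) => [|u'].
  by move=> a p q; rewrite blinD blinZ.
exact: unit1.
Qed.

(* Differentiating [g (phi t) = phi t] twice shows that the normal part of [d^2 phi] is
   [d^2 g (d phi, d phi)]. *)
Lemma chart_second_fundamental y u v : M y -> O y ->
  `|second_fundamental_form dotp n M y u v| <= c 2 * `|u| * `|v|.
Proof.
move=> My Oy; rewrite /second_fundamental_form.
(* If no parametrization realizes [u] and [v], the form has the default value 0. Otherwise [w] comes
   from an unspecified parametrization, and the estimate is proved for any. *)
case: xgetP => [w wE|_]; last by rewrite normr0 !mulr_ge0.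
move=> [V [W [phi [a [h [k [lp Va pa [hu hv] wE']]]]]]].
rewrite wE'; set d2 := iter_diff _ _ _; rewrite chart_orth_projector// -hu -hv.
have Oa : O (phi a) by rewrite pa.
have [sphi _ _ _ _] := lp; have [A hA] := smooth_on_hasd sphi Va.
have [B hB] := smooth_on_hasd_diff k sphi Va.
have [oV _] := sphi.
have d2E : d2 = B h by rewrite /d2 iter_diff_cons (hasd_diff _ hB).
have hDg : hasd (D g) (phi a) (D (D g) (phi a)).
  by case: ch => _ /(_ 2)[K _ [_ [_ h' _]]] _ _ _; exact: h'.
have be : bilin (fun (L : blin E E) (e : E) => L e) 1.
  split=> [e b L L'|L|L e]; [by rewrite blin_add blin_scale|exact: blin_linear|].
  by rewrite mul1r blin_ub.
have hp := hasd_bilin ler01 be (hasd_comp (f := D g) hDg hA) hB.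
have hB' := hasd_near _ _ hp.
have {}hB' : hasd (fun b => 'd phi b k) a
    (bilin_lift_l (fun (L : blin E E) e => L e) (bcomp (D (D g) (phi a)) A) ('d phi a k) +
     bilin_lift_r (fun (L : blin E E) e => L e) ((D g \o phi) a) B).
  apply: hB'; first by rewrite /= (param_diff_fix k lp Va Oa).
  have nO : \forall h \near (0 : 'rV[R]_n), O (phi (a + h)).
    apply/(@nbhs0P _ _ (fun b => O (phi b))); apply: (hasd_continuous hA).
    by apply: open_nbhs_nbhs; split=> //; case: ch.
  have nV := open_shift oV Va.
  near=> h'; rewrite /= (param_diff_fix k lp)//; by near: h'.
have := hasd_uniq hB hB' => BE.
have e : d2 - D g y d2 = D (D g) y ('d phi a h) ('d phi a k).
  rewrite d2E {1}BE blin_add (bilin_lift_lE _ _ _ ler01 be) (bilin_lift_rE _ _ _ ler01 be).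
  by rewrite bcompE /= pa (hasd_diff h hA) addrK.
by rewrite e; exact: chart_D2_le.
Unshelve. all: by end_near. Qed.

End ProjChart.

Lemma proj_charts_conclusion {R : realType} (E : normedModType R) (dotp : {dot E for idfun}) n
    (M : set E) (c : nat -> R) (rho : R) :
  (forall x : E, dotp x x = `|x| ^+ 2) -> 0 < rho -> (forall k, 0 <= c k) -> closed M ->
  (forall z y, M y -> `|z - y| < rho ->
    exists O g, [/\ proj_chart dotp n M O g c, O z & O (g z)]) ->
  [/\ closed_submanifold n M, second_fundamental_form_le dotp n M (c 2),
      (rho%:E <= reach M)%E, smooth_on (nbhd_of rho M) (normal_proj M) &
      forall x, nbhd_of rho M x ->
        (forall k, (2 <= k)%N -> (diff_norm (normal_proj M) k x <= (c k)%:E)%E) /\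
        (opnorm (fun v => ('d (normal_proj M) x v -
          orth_projector dotp (tangent_space n M (normal_proj M x)) v)%R) <= (c 1)%:E)%E].
Proof.
move=> dotpE rho0 c0 cM cov.
have covM y : M y -> exists O g, [/\ proj_chart dotp n M O g c, O y & O (g y)].
  by move=> My; apply: (cov y y) => //; rewrite subrr normr0.
split.
- split=> // y My; have [U [g [ch Oy _]]] := covM y My.
  case: ch => _ _ _ _ /(_ y My Oy)[_ [V [W [phi [a [sp Wy _ _ _]]]]]].
  by exists V, W, phi; split=> //; exact: smooth_param_local.
- move=> y u v My _ _; have [U [g [ch Oy _]]] := covM y My.
  exact: (chart_second_fundamental dotpE ch c0).
- apply: ereal_sup_ubound; exists rho => //; split=> // x /nbhd_ofP[y My xy].
  have [U [g [[_ _ near _ _] Ox _]]] := cov x y My xy.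
  by have [h1 h2] := near x Ox; exists (g x); split=> // z hz; apply/esym/h2.
- apply: smooth_onP => [|k x /nbhd_ofP[y My xy]]; first exact: open_nbhd_of.
  have [U [g [ch Ox _]]] := cov x y My xy.
  have [oO sg _ _ _] := ch; have [K K0 hK] := sg k; exists K, U; split=> //.
  by apply: DSm_ext hK => // z Oz; rewrite (normal_projE ch).
move=> x /nbhd_ofP[y My xy]; have [U [g [ch Ox Ogx]]] := cov x y My xy.
have [oO sg near [hk h1] _] := ch.
have npE z : U z -> g z = normal_proj M z by move=> Oz; rewrite (normal_projE ch).
split=> [k k2|].
  apply: le_trans (hk x k Ox k2); rewrite /diff_norm /multi_norm.
  have [K K0 hK] := sg k; apply: le_ereal_sup => _ [vs [sv nv] <-].
  exists vs => //; congr (`|_|%:E).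
  by apply: (iter_diff_ext oO K0 npE); rewrite ?sv.
apply: ge_ereal_sup => _ [v /= v1 <-]; rewrite lee_fin -(npE x Ox).
have [[Mg _] _] := near x Ox.
rewrite (chart_orth_projector dotpE ch)//.
have hx : hasd (normal_proj M) x (D g x).
  have := chart_hasd ch Ox; apply: hasd_near; first exact: npE.
  by have := open_shift oO Ox; apply: filterS => h; exact: npE.
rewrite (hasd_diff _ hx) -blin_opp -blin_add (le_trans (blin_ub _ _))//.
(* [D g (g x)] is the orthogonal projector at the nearest point, so the bound on the oscillation of
   [D g] applies to [x] and [g x]. *)
rewrite (le_trans _ (h1 x (g x) Ox Ogx))// ler_piMr//.
Qed.

(** * From the hypothesis on nets to the rescaled data, and the conclusion *)

Lemma net_frame {R : realType} (E : completeNormedModType R) (dotp : {dot E for idfun}) n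
    (X A N : set E) (x : E) (r eps delta : R) :
  (forall x : E, dotp x x = `|x| ^+ 2) -> 0 < delta -> affine_subspace n A ->
  eps_net eps N (A `&` ball x r) -> (hausdorff_dist (X `&` ball x r) N <= delta%:E)%E ->
  exists fr : frame (E := E) n, [/\ framed dotp fr,
    forall y, X y -> `|y - x| < r -> `|aproj dotp fr y - y| <= 2 * delta &
    forall a, aproj dotp fr a = a -> `|a - x| < r ->
      exists q, [/\ X q, `|q - x| < r & `|a - q| <= eps + 3 * delta]].
Proof.
move=> dotpE delta0 [p [V [[e ind VE] AE]]] [NA netN] hd.
have [f one fE] := gram_schmidt dotpE ind.
(* The Hausdorff distance is an infimum, so the bound is relaxed to a strict one before nearby
   points are extracted. *)
have hd2 : (hausdorff_dist (X `&` ball x r) N < (2 * delta)%:E)%E.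
  by apply: le_lt_trans hd _; rewrite lte_fin; lra.
have [XN NX] := hausdorff_dist_lt hd2.
have inA a : aproj dotp (p, f) a = a <-> A a.
  rewrite AE VE fE; split=> [aE|[_ [t _ <-] <-]].
    by exists (proj dotp f (a - p)) => //; exists (fun i => dotp (a - p) (f i)).
  by rewrite /aproj /=; congr (_ + _); rewrite [p + _]addrC addrK proj_span.
exists (p, f); split=> // [y Xy yx|a /inA Aa ax].
  have [|b Nb yb] := XN y; first by split=> //; rewrite -ball_normE /= distrC.
  by apply: le_trans (ltW yb); apply: aproj_near => //; apply/inA; have [] := NA b Nb.
(* Likewise for the net; [eps + delta] and [2 * delta] together give [eps + 3 * delta]. *)
have : (edist_inf N a < (eps + delta)%:E)%E.
  apply: (@le_lt_trans _ _ eps%:E); last by rewrite lte_fin ltrDl.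
  by apply: netN; split=> //; rewrite -ball_normE /= distrC.
move=> /edist_inf_ltP[m Nm am]; have [q [Xq xq] mq] := NX m Nm.
exists q; split=> //; first by move: xq; rewrite -ball_normE /= distrC.
have -> : a - q = (a - m) + (m - q) by vring R E.
by rewrite (le_trans (ler_normD _ _))//; lra.
Qed.

Lemma nearly_flat_unscale {R : realType} (E : completeNormedModType R) (dotp : {dot E for idfun}) n
    (X : set E) (r eps delta : R) :
  (forall x : E, dotp x x = `|x| ^+ 2) -> 0 < r -> 0 < eps -> eps < r / 10 -> 0 < delta ->
  100 * (delta / r) <= 1 / 100 ->
  (forall x, X x -> exists A N : set E, [/\ affine_subspace n A, eps_net eps N (A `&` ball x r) &
    (hausdorff_dist (X `&` ball x r) N <= delta%:E)%E]) ->
  exists fr : E -> frame (E := E) n,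
    nearly_flat dotp [set z | X (r *: z)] fr (eps / r) (delta / r).
Proof.
move=> dotpE r0 eps0 epsr delta0 small hX.
have nz : r != 0 by rewrite gt_eqF.
have rK (z : E) : r^-1 *: (r *: z) = z by rewrite scalerA mulVf// scale1r.
have Kr (z : E) : r *: (r^-1 *: z) = z by rewrite scalerA mulfV// scale1r.
have hfr x : exists fr : frame (E := E) n, X x -> [/\ framed dotp fr,
    forall y, X y -> `|y - x| < r -> `|aproj dotp fr y - y| <= 2 * delta &
    forall a, aproj dotp fr a = a -> `|a - x| < r ->
      exists q, [/\ X q, `|q - x| < r & `|a - q| <= eps + 3 * delta]].
  have [Xx|nXx] := pselect (X x); last by exists (0, fun=> 0) => /nXx.
  have [A [N [affA netN hd]]] := hX x Xx.
  by have [fr h] := net_frame dotpE delta0 affA netN hd; exists fr.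
have [fr frP] := choice hfr.
pose fr' x : frame (E := E) n := (r^-1 *: (fr (r *: x)).1, (fr (r *: x)).2).
have frE x z : aproj dotp (fr' x) z = r^-1 *: aproj dotp (fr (r *: x)) (r *: z).
  rewrite /aproj /fr' /= scalerDr -projZ; congr (_ + proj _ _ _).
  by rewrite scalerBr rK.
have scl (z w : E) : `|z - w| = r^-1 * `|r *: z - r *: w|.
  by rewrite -scalerBr normrZ gtr0_norm// mulKf.
have lt1 (z w : E) : `|z - w| < 1 -> `|r *: z - r *: w| < r.
  by rewrite scl mulrC ltr_pdivrMr// mul1r.
exists fr'; split.
- by move=> x Xx; have [] := frP _ Xx.
- move=> x y Xx Xy yx; have [_ h _] := frP _ Xx.
  by rewrite scl frE Kr mulrC ler_pdivrMr// mulrA divfK// h//; exact: lt1.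
- move=> x a Xx; rewrite frE => aE ax; have [_ _ h] := frP _ Xx.
  have [||q [Xq qx aq]] := h (r *: a); [by rewrite -[in RHS]aE Kr|exact: lt1|].
  exists (r^-1 *: q); rewrite /= Kr; split=> //.
    by rewrite scl Kr mulrC ltr_pdivrMr// mul1r.
  by rewrite scl Kr mulrC ler_pdivrMr// mulrDl mulrA !divfK.
split=> //; [exact: divr_gt0|exact: divr_gt0|].
by rewrite ltr_pdivrMr// mulrC.
Qed.

Theorem corollary1p12 (R : realType) (n : nat) :
  exists (sigma2 C11 C14 : R) (C13 : nat -> R),
    [/\ 0 < sigma2, 0 < C11, 0 < C14 & forall k : nat, 0 < C13 k] /\
    forall (E : completeNormedModType R) (dotp : {dot E for idfun}),
      (forall x : E, dotp x x = `|x| ^+ 2) ->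
      separable E ->
    forall (X : set E) (r eps delta : R),
      0 < eps -> eps < r / 10 -> 0 < delta -> delta < sigma2 * r ->
      (forall x, X x -> exists A N : set E,
        [/\ affine_subspace n A,
            eps_net eps N (A `&` ball x r) &
            (hausdorff_dist (X `&` ball x r) N <= delta%:E)%E]) ->
    exists M Y : set E,
      [/\ closed_submanifold n M,
          eps_net eps Y M &
          (hausdorff_dist X Y <= (C14 * delta)%:E)%E] /\
      [/\ second_fundamental_form_le dotp n M (C11 * delta * r ^- 2),
          ((r / 3)%:E <= reach M)%E,
          smooth_on (nbhd_of (r / 3) M) (normal_proj M) &
          forall x, nbhd_of (r / 3) M x ->
            (forall k : nat, (2 <= k)%N ->
              (diff_norm (normal_proj M) k x
                < (C13 k * delta * r ^- k)%:E)%E) /\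
            (let y := normal_proj M x in
             (opnorm (fun v => ('d (normal_proj M) x v
                        - orth_projector dotp (tangent_space n M y) v)%R)
                < (C13 1%N * delta * r^-1)%:E)%E)].
Proof.
have [s [CK [CY [[s0 CK0 CY0] main]]]] := @nearly_flat_manifold R n.
(* The second entry ensures [100 * (delta / r) <= 1 / 100], as [nearly_flat] demands. *)
pose sigma := Num.min s (1 / (100 * 100)).
(* Adding 1 makes the constants positive and the inequalities of (iii) strict. *)
exists sigma, (CK 2 + 1), (CY + 1), (fun k => CK k + 1).
have lt1 (x : R) : 0 <= x -> 0 < x + 1 by move=> x0; rewrite ltr_wpDl.
split; first by split=> [|||k]; [rewrite lt_min s0/= divr_gt0// mulr_gt0|exact: lt1|exact: lt1|exact: lt1].
move=> E dotp dotpE _ X r eps delta eps0 epsr delta0 deltas hX.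
have r0 : 0 < r by lra.
have nz : r != 0 by rewrite gt_eqF.
pose d := delta / r; have d0 : 0 < d by exact: divr_gt0.
have : d < sigma by rewrite ltr_pdivrMr.
rewrite lt_min => /andP[ds d1].
have small : 100 * (delta / r) <= 1 / 100 by rewrite -/d; lra.
have [fr flat] := nearly_flat_unscale dotpE r0 eps0 epsr delta0 small hX.
have [M [cM cov XM net]] := main E dotp _ fr _ _ dotpE flat (ltW ds).
have rK (z : E) : r^-1 *: (r *: z) = z by rewrite scalerA mulVf// scale1r.
have Kr (z : E) : r *: (r^-1 *: z) = z by rewrite scalerA mulfV// scale1r.
have dr : d * r = delta by rewrite divfK.
have cE k : d * CK k * (r * r^-1 ^+ k) = CK k * delta * r ^- k.
  by rewrite -dr exprVn; ring.
pose c k := CK k * delta * r ^- k.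
have c0 k : 0 <= c k by apply: mulr_ge0; [apply: mulr_ge0 => //; exact: ltW|rewrite invr_ge0 exprn_ge0 ?ltW].
have clt k : c k < (CK k + 1) * delta * r ^- k.
  by rewrite /c -!mulrA ltr_pM2r ?ltrDl// mulr_gt0// invr_gt0 exprn_gt0.
have scl (z w : E) : `|z - w| = r * `|r^-1 *: z - r^-1 *: w|.
  by rewrite -scalerBr norm_unscale// mulVKf.
have scl' (z w : E) : `|r *: z - r *: w| = r * `|z - w| by rewrite -scalerBr norm_scale.
have scov z y : scaled r M y -> `|z - y| < r / 3 -> exists U g,
    [/\ proj_chart dotp n (scaled r M) U g c, U z & U (g z)].
  move=> My; rewrite scl -ltr_pdivlMl// => zy.
  have [|U [g [ch Uz Ug]]] := cov (r^-1 *: z) _ My.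
    by apply: lt_le_trans zy _; rewrite mulKf// div1r.
  exists (scaled r U), (rescale r g); split=> //; last by rewrite /scaled /= rK.
  have -> : c = fun k => d * CK k * (r * r^-1 ^+ k) by apply/funext => k; rewrite cE.
  exact: proj_chart_scaled.
have r3 : 0 < r / 3 by exact: divr_gt0.
have [sub II rch smo der] := proj_charts_conclusion dotpE r3 c0 (scaled_closed cM) scov.
(* One tolerance [CY * delta] defines [Y]: it admits both the points that make [Y] a net of the
   manifold and, for each point of [X], a nearby point of the manifold. *)
exists (scaled r M), [set m | scaled r M m /\ exists2 x, X x & `|m - x| <= CY * delta].
split.
  split=> //.
    split=> [m []//|m Mm].
    have [y [x [My Xx yx my]]] := net _ Mm.
    apply: (@edist_inf_le _ _ _ _ (r *: y)); last first.
      by rewrite scl rK -ler_pdivlMl// mulrC.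
    split; first by rewrite /scaled /= rK.
    by exists (r *: x) => //; rewrite scl' -ler_pdivlMl// (le_trans yx)// mulrA mulrC.
  apply: hausdorff_dist_le => [|x Xx|m [Mm [x Xx mx]]].
  - by rewrite mulr_ge0 ?ltW// lt1.
  - have [|y My xy] := XM (r^-1 *: x); first by rewrite /= Kr.
    have xy' : `|x - r *: y| <= CY * delta.
      by rewrite scl rK -ler_pdivlMl// (le_trans xy)// mulrA mulrC.
    exists (r *: y); last by rewrite (le_trans xy')// ler_pM2r// lerDl.
    by split; [rewrite /scaled /= rK|exists x => //; rewrite distrC].
  by exists x => //; rewrite (le_trans mx)// ler_pM2r// lerDl.
split=> //.
  move=> y u v My Tu Tv; apply: le_trans (II y u v My Tu Tv) _.
  by rewrite ler_wpM2r// ler_wpM2r//; exact: ltW (clt 2).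
move=> x nx; have [hk h1] := der x nx; split=> [k k2|].
  by apply: le_lt_trans (hk k k2) _; rewrite lte_fin.
apply: le_lt_trans h1 _; rewrite lte_fin; exact: clt 1%N.
Qed.
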